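(* Fix $\Delta>0$ and $g>0$. Then there is an exceptional set of integers $n$ containing at most $O(N^{3/4+o(1)})$ elements $n\le N$ (as $N\to\infty$) such that for every positive integer $n$ outside this set, the following holds: the open interval $(n,n+1)$ contains exactly two elements of one of the shifted parity spectra $\mathcal X^{+}$, $\mathcal X^{-}$ and no element of the other; each of the adjacent intervals $(n-1,n)$ and $(n+1,n+2)$ contains exactly two elements of that other shifted parity spectrum and no element of the first one; and none of $n-1,n,n+1$ belongs to $\mathcal X^+\cup\mathcal X^-$. In particular, for all but $O(N^{3/4+o(1)})$ integers $n\le N$, the interval $[n,n+1]$ contains exactly two elements of $\mathcal X^+\cup\mathcal X^-$.
   Context: The quantum Rabi model is the Hamiltonian $H=a^\dagger a+\Delta\sigma_z+g\sigma_x(a+a^\dagger)$ acting on $L^2(\mathbb R)\otimes\mathbb C^2$, where $a^\dagger,a$ are the creation and annihilation operators of the harmonic oscillator (frequency $1$), $\sigma_x=\begin{pmatrix}0&1\\1&0\end{pmatrix}$, $\sigma_z=\begin{pmatrix}1&0\\0&-1\end{pmatrix}$, $\Delta>0$ and $g>0$. $H$ commutes with the parity operator $P=(-1)^{a^\dagger a}\sigma_z$, and on each of the $\pm1$-eigenspaces of $P$ it is unitarily equivalent to the Jacobi matrix (indices $k\ge0$) with diagonal entries $d_\pm(k)=k\pm(-1)^k\Delta$ and off-diagonal entries $a(k)=g\sqrt k$ in positions $(k-1,k)$ and $(k,k-1)$, $k\ge1$. The spectrum in each parity class $\pm$ is discrete and simple; its eigenvalues are labeled in increasing order $E^\pm_n$,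 with the indexing normalized so that $E^\pm_n=n-g^2+o(1)$ as $n\to\infty$. The shifted eigenvalues are $x_n^\pm=E_n^\pm+g^2$ and the shifted parity spectra are $\mathcal X^\pm=\{x_n^\pm\}$. (Known background: Boutet de Monvel and Zielinski proved $E_n^\pm=n-g^2\mp\frac{\Delta}{\sqrt{2\pi g}}\frac{(-1)^n\cos(4g\sqrt n-\pi/4)}{n^{1/4}}+O(n^{-1/2+o(1)})$.) *)

(* Defs.v *)
From Stdlib Require Import Reals ClassicalEpsilon List.
From Coquelicot Require Import Coquelicot.
Open Scope R_scope.

(* Jacobi matrix of the parity class [s] (s = true for "+", false for "-"):
   diagonal d_s(k) = k + sgn(s) (-1)^k Delta, off-diagonal a(k) = g sqrt k. *)
Definition sgn (s : bool) : R := if s then 1 else -1.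

Definition rabi_diag (Delta : R) (s : bool) (k : nat) : R :=
  INR k + sgn s * (-1) ^ k * Delta.

Definition rabi_off (g : R) (k : nat) : R := g * sqrt (INR k).

(* E is an eigenvalue of the (self-adjoint) Jacobi operator on l^2(N):
   there is a nonzero square-summable u with (J u)(k) = E u(k) for all k,
   where (J u)(k) = a(k) u(k-1) + d(k) u(k) + a(k+1) u(k+1)
   (for k = 0 the first term vanishes since a(0) = 0). *)
Definition rabi_eigenvalue (Delta g : R) (s : bool) (E : R) : Prop :=
  exists u : nat -> R,
    (exists k, u k <> 0) /\
    ex_series (fun k => (u k) ^ 2) /\
    forall k : nat,
      (match k with S k' => rabi_off g k * u k' | O => 0 end)
      + rabi_diag Delta s k * u k
      + rabi_off g (S k) * u (S k) = E * u k.

Definition shifted_spec (Delta g : R) (s : bool) (x : R) : Prop :=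
  rabi_eigenvalue Delta g s (x - g ^ 2).

Definition exactly_two_in (X : R -> Prop) (a b : R) : Prop :=
  exists x1 x2, a < x1 < b /\ a < x2 < b /\ x1 <> x2 /\ X x1 /\ X x2 /\
    forall y, a < y < b -> X y -> y = x1 \/ y = x2.

Definition none_in (X : R -> Prop) (a b : R) : Prop :=
  forall y, a < y < b -> ~ X y.

Definition count_upto (S : nat -> Prop) (N : nat) : nat :=
  length (List.filter (fun n => if ClassicalEpsilon.excluded_middle_informative (S n)
                                then true else false) (List.seq 1 N)).

(* Main.v *)
(* In the basis of displaced number states (Charlier functions), which diagonalises the Jacobi
   matrix at [Delta = 0], the shifted Hamiltonian becomes [diag(n) + delta * K] with
   [delta = +-Delta] and [K] the matrix of the displaced parity operator, an orthogonal involution.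
   Each row of [K] satisfies a three-term recurrence whose discrete energy varies by a bounded
   factor over a window of length [~ sqrt n] around the diagonal; since the row has norm 1, this forces
   [K n m = O(n^(-1/4))] there. Second-order perturbation theory then places the eigenvalues near
   [n] at [n + delta * K n n + O(ln n / sqrt n)], at most one of them by orthogonality. Existence
   is a homotopy argument: a solution of the recurrence either enters a cone, where it keeps a
   constant sign and blows up, or is an eigenvector; if no eigenvalue were near [n], that sign
   would be constant along a path from [Delta = g = 0], [x = n - 1/2] to [Delta = g = 0],
   [x = n + 1/2], where the two signs differ.

   The numbers [(-1)^n * K n n] are Laguerre values: they oscillate with amplitude [n^(-1/4)]
   and have steps [O(n^(-3/4))], so wherever they exceed the error term in absolute value they
   keep a constant sign, and the displacements of the levels alternate with [n] and with the
   parity. Where they are small their increments are of exact order [n^(-3/4)], so in a window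
   of length [~ sqrt n] they are smaller than [C ln n / sqrt n] at most [O(n^(1/4) ln n)] times;
   there are [O(sqrt N)] windows up to [N]. *)

Require Import Defs.
From Stdlib Require Import Reals Arith Lra Lia Psatz Classical ClassicalEpsilon List.
From Coquelicot Require Import Coquelicot.
Open Scope R_scope.

(** * Square-summable sequences and Parseval *)

(** The displacement [delta * K n n] has size [n^(-1/4)], which is also the size of the error that
    one pass of Cauchy-Schwarz leaves. The coefficients of an eigenvector are therefore estimated
    twice: the first pass shows that those near [n] carry a factor [n^(-1/4)], the second inserts
    this pointwise bound and gains another such factor, at the price of a harmonic sum, the
    logarithm. Both amplitude bounds for the Laguerre values come from energies: the upper one
    spreads the norm 1 of a row over a window of comparable energies, the lower one follows an
    energy that grows like [sqrt n]. Completeness of the displaced basis comes from duality: the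
    columns of the Charlier matrix are orthonormal, so pairing with its rows is an isometry. Levels
    are located one by one, in the closed interval of radius 1/2 around each large [n]; the count in
    [(n, n+1)] is then read off from the sides on which the levels of [n] and [n+1] lie.
    Eigenvectors are only known to be square summable, so adjoints are always moved onto the rapidly
    decaying basis functions. *)

Definition l2 (a : nat -> R) : Prop := ex_series (fun k => a k ^ 2).

Definition ip (a b : nat -> R) : R := Series (fun k => a k * b k).

Lemma ex_series_bounded (a : nat -> R) (B : R) :
  (forall k, 0 <= a k) -> (forall N, sum_n a N <= B) -> ex_series a.
Proof.
intros Ha HB.
apply (ex_finite_lim_seq_incr (sum_n a) B); [|exact HB].
intros n. rewrite sum_Sn. unfold plus; simpl. specialize (Ha (S n)). lra.
Qed.

Lemma sum_n_le_Series (a : nat -> R) (N : nat) :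
  (forall k, 0 <= a k) -> ex_series a -> sum_n a N <= Series a.
Proof.
intros Ha Hex.
apply (is_lim_seq_incr_compare (sum_n a) (Series a)).
- exact (Series_correct a Hex).
- intros n. rewrite sum_Sn. unfold plus; simpl. specialize (Ha (S n)). lra.
Qed.

Lemma Series_le_bound (a : nat -> R) (B : R) :
  ex_series a -> (forall N, sum_n a N <= B) -> Series a <= B.
Proof.
intros Hex HB.
exact (is_lim_seq_le (sum_n a) (fun _ => B) (Series a) B HB
  (Series_correct a Hex) (is_lim_seq_const B)).
Qed.

Lemma term_le_Series (a : nat -> R) (k : nat) :
  (forall k, 0 <= a k) -> ex_series a -> a k <= Series a.
Proof.
intros Ha Hex. apply Rle_trans with (sum_n a k); [|now apply sum_n_le_Series].
destruct k as [|k]; [rewrite sum_O; lra|].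
rewrite sum_Sn. unfold plus; simpl.
assert (0 <= sum_n a k); [|lra].
clear -Ha. induction k as [|k IH]; [rewrite sum_O; apply Ha|].
rewrite sum_Sn. unfold plus; simpl. specialize (Ha (S k)). lra.
Qed.

Lemma l2_mul (a b : nat -> R) : l2 a -> l2 b -> ex_series (fun k => a k * b k).
Proof.
intros Ha Hb.
apply (ex_series_le (K := R_AbsRing) (V := R_CompleteNormedModule) _ (fun k => a k ^ 2 + b k ^ 2)).
- intros k. unfold norm; simpl; unfold abs; simpl.
  apply Rabs_le. nra.
- exact (ex_series_plus _ _ Ha Hb).
Qed.

Lemma l2_axpy (t : R) (a b : nat -> R) : l2 a -> l2 b -> l2 (fun k => a k + t * b k).
Proof.
intros Ha Hb. unfold l2.
apply (ex_series_ext (fun k => plus (a k ^ 2) (plus (2 * t * (a k * b k)) (t ^ 2 * b k ^ 2)))).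
- intros k. unfold plus; simpl. ring.
- apply (ex_series_plus (V := R_NormedModule)); [exact Ha|].
  apply (ex_series_plus (V := R_NormedModule)).
  + exact (ex_series_scal_l (2 * t) _ (l2_mul a b Ha Hb)).
  + exact (ex_series_scal_l (t ^ 2) _ Hb).
Qed.

Lemma l2_ext (a b : nat -> R) : (forall k, a k = b k) -> l2 a -> l2 b.
Proof.
intros E. apply ex_series_ext. intros k. now rewrite E.
Qed.

Lemma l2_le (a b : nat -> R) : (forall k, Rabs (a k) <= Rabs (b k)) -> l2 b -> l2 a.
Proof.
intros H Hb.
apply (ex_series_le (K := R_AbsRing) (V := R_CompleteNormedModule) _ (fun k => b k ^ 2)); [|exact Hb].
intros k. unfold norm; simpl; unfold abs; simpl.
change (Rabs (a k ^ 2) <= b k ^ 2).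
rewrite (Rabs_pos_eq (a k ^ 2)); [|nra].
rewrite <- (pow2_abs (a k)), <- (pow2_abs (b k)).
apply pow_incr. split; [apply Rabs_pos|apply H].
Qed.

Lemma ip_sym (a b : nat -> R) : ip a b = ip b a.
Proof. apply Series_ext. intros k. ring. Qed.

Lemma ip_axpy (t : R) (a b w : nat -> R) :
  l2 a -> l2 b -> l2 w -> ip (fun k => a k + t * b k) w = ip a w + t * ip b w.
Proof.
intros Ha Hb Hw. unfold ip.
rewrite <- Series_scal_l, <- Series_plus.
- apply Series_ext. intros k. ring.
- now apply l2_mul.
- now apply (ex_series_scal_l t _ (l2_mul b w Hb Hw)).
Qed.

Lemma ip_axpy2 (t : R) (a b : nat -> R) :
  l2 a -> l2 b ->
  ip (fun k => a k + t * b k) (fun k => a k + t * b k)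
    = ip a a + 2 * t * ip a b + t ^ 2 * ip b b.
Proof.
intros Ha Hb.
rewrite ip_axpy; auto using l2_axpy.
rewrite (ip_sym a), (ip_sym b), !ip_axpy; auto.
rewrite (ip_sym b a). ring.
Qed.

Lemma ip_ge0 (a : nat -> R) : l2 a -> 0 <= ip a a.
Proof.
intros Ha. unfold ip.
rewrite <- (Rmult_0_l (Series (fun k => a k ^ 2))), <- Series_scal_l.
apply Series_le.
- intros k. nra.
- now apply l2_mul.
Qed.

Lemma sqr_le_ip (a : nat -> R) (k : nat) : l2 a -> a k ^ 2 <= ip a a.
Proof.
intros Ha. unfold ip.
rewrite (Series_ext _ (fun k => a k ^ 2)); [|intros; ring].
now apply (term_le_Series (fun k => a k ^ 2)); [intros; nra|].
Qed.

Lemma cauchy_schwarz (a b : nat -> R) :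
  l2 a -> l2 b -> ip a b ^ 2 <= ip a a * ip b b.
Proof.
intros Ha Hb.
assert (Hq : forall t, 0 <= ip a a + 2 * t * ip a b + t ^ 2 * ip b b).
{ intros t. rewrite <- ip_axpy2; auto. apply ip_ge0. now apply l2_axpy. }
pose proof (ip_ge0 a Ha). pose proof (ip_ge0 b Hb).
destruct (Req_dec (ip b b) 0) as [E|E].
- destruct (Req_dec (ip a b) 0) as [E'|E']; [rewrite E'; nra|].
  specialize (Hq (- (ip a a + 1) / (2 * ip a b))). rewrite E in Hq.
  replace (2 * (- (ip a a + 1) / (2 * ip a b)) * ip a b) with (- (ip a a + 1)) in Hq by (field; auto).
  lra.
- specialize (Hq (- ip a b / ip b b)).
  apply Rmult_le_compat_r with (r := ip b b) in Hq; [|lra].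
  replace ((ip a a + 2 * (- ip a b / ip b b) * ip a b + (- ip a b / ip b b) ^ 2 * ip b b) * ip b b)
    with (ip a a * ip b b - ip a b ^ 2) in Hq by (field; auto).
  lra.
Qed.

Lemma cauchy_schwarz_abs (a b : nat -> R) (A B : R) :
  l2 a -> l2 b -> 0 <= A -> 0 <= B -> ip a a <= A ^ 2 -> ip b b <= B ^ 2 ->
  Rabs (ip a b) <= A * B.
Proof.
intros Ha Hb HA HB H1 H2.
pose proof (cauchy_schwarz a b Ha Hb).
pose proof (ip_ge0 a Ha). pose proof (ip_ge0 b Hb).
assert (ip a b ^ 2 <= (A * B) ^ 2).
{ apply Rle_trans with (ip a a * ip b b); auto.
  replace ((A * B) ^ 2) with (A ^ 2 * B ^ 2) by ring.
  apply Rmult_le_compat; auto. }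
rewrite <- (Rabs_pos_eq (A * B)); [|nra].
apply Rsqr_le_abs_0. unfold Rsqr. nra.
Qed.

Definition kron (k j : nat) : R := if Nat.eq_dec k j then 1 else 0.

Lemma kron_same (k : nat) : kron k k = 1.
Proof. unfold kron. now destruct (Nat.eq_dec k k). Qed.

Lemma kron_diff (k j : nat) : k <> j -> kron k j = 0.
Proof. unfold kron. intros. now destruct (Nat.eq_dec k j). Qed.

Section Parseval.

Variable V : nat -> nat -> R.
Hypothesis row_l2 : forall m, l2 (V m).
Hypothesis col_l2 : forall k, l2 (fun m => V m k).
Hypothesis col_orth : forall k j, ip (fun m => V m k) (fun m => V m j) = kron k j.

(** The map that sends the [k]-th unit vector to column [k] of [V], each coordinate being read off
    as a pairing with a row. Orthonormal columns make it an isometry, hence the rows a complete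
    system. *)
Definition transform (u : nat -> R) (m : nat) : R := ip u (V m).

Let ptransform (u : nat -> R) (N m : nat) : R := sum_n (fun k => u k * V m k) N.

(** The claims are proved together: orthogonality to the columns not yet added kills the cross term
    when the norm is expanded at the next step. *)
Lemma ptransform_spec (u : nat -> R) (N : nat) :
  l2 (ptransform u N) /\
  (forall j, (N < j)%nat -> ip (ptransform u N) (fun m => V m j) = 0) /\
  ip (ptransform u N) (ptransform u N) = sum_n (fun k => u k ^ 2) N.
Proof.
induction N as [|N [IH1 [IH2 IH3]]].
- assert (E : forall m, ptransform u 0 m = 0 * 0 + u O * V m O).
  { intros m. unfold ptransform. rewrite sum_O. ring. }
  assert (Hz : l2 (fun _ => 0 * 0)).
  { apply ex_series_bounded with 0; [intros; nra|].
    intros n. rewrite (sum_n_ext _ (fun _ => 0)); [|intros k; change (@eq R ((0 * 0) ^ 2) 0); ring].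
    rewrite sum_n_const. lra. }
  assert (Hiz : forall w, ip (fun _ => 0 * 0) w = 0).
  { intros w. unfold ip. rewrite (Series_ext _ (fun k => 0 * w k)); [|intros; ring].
    rewrite Series_scal_l. ring. }
  assert (E' : forall w, ip (ptransform u 0) w = ip (fun m => 0 * 0 + u O * V m O) w).
  { intros w. apply Series_ext. intros m. now rewrite E. }
  split; [|split].
  + apply l2_ext with (fun m => 0 * 0 + u O * V m O); [intros; now rewrite E|].
    now apply (l2_axpy (u O) (fun _ => 0 * 0)).
  + intros j Hj. rewrite E'.
    rewrite (ip_axpy (u O) (fun _ => 0 * 0) (fun m => V m O)); auto.
    rewrite Hiz, col_orth, kron_diff by lia. ring.
  + rewrite E', ip_sym, E'.
    rewrite (ip_axpy2 (u O) (fun _ => 0 * 0) (fun m => V m O)); auto.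
    rewrite !Hiz, col_orth, kron_same, sum_O. ring.
- assert (E : forall m, ptransform u (S N) m = ptransform u N m + u (S N) * V m (S N)).
  { intros m. unfold ptransform. now rewrite sum_Sn. }
  assert (E' : forall w, ip (ptransform u (S N)) w
     = ip (fun m => ptransform u N m + u (S N) * V m (S N)) w).
  { intros w. apply Series_ext. intros m. now rewrite E. }
  split; [|split].
  + apply l2_ext with (fun m => ptransform u N m + u (S N) * V m (S N)); [intros; now rewrite E|].
    now apply l2_axpy.
  + intros j Hj. rewrite E'.
    rewrite (ip_axpy (u (S N)) (ptransform u N) (fun m => V m (S N))); auto.
    rewrite IH2 by lia. rewrite col_orth, kron_diff by lia. ring.
  + rewrite E', ip_sym, E'.
    rewrite (ip_axpy2 (u (S N)) (ptransform u N) (fun m => V m (S N))); auto.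
    rewrite IH2 by lia. rewrite IH3, col_orth, kron_same, sum_Sn. unfold plus; simpl. ring.
Qed.

(** Finitely many coordinates are limits of those of the truncations, whose norms are partial sums
    of the norm of [u]; the bound does not depend on how many coordinates are taken. *)
Lemma bessel (u : nat -> R) : l2 u ->
  l2 (transform u) /\ ip (transform u) (transform u) <= ip u u.
Proof.
intros Hu.
assert (Hsq : ip u u = Series (fun k => u k ^ 2)) by (apply Series_ext; intros; ring).
assert (Hb : forall M, sum_n (fun m => transform u m ^ 2) M <= ip u u).
{ intros M.
  assert (HL : is_lim_seq (fun N => sum_n (fun m => ptransform u N m ^ 2) M)
                 (sum_n (fun m => transform u m ^ 2) M)).
  { assert (H1 : forall m, is_lim_seq (fun N => ptransform u N m ^ 2) (transform u m ^ 2)).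
    { intros m.
      assert (is_lim_seq (fun N => ptransform u N m) (transform u m)).
      { exact (Series_correct _ (l2_mul u (V m) Hu (row_l2 m))). }
      apply is_lim_seq_ext with (fun N => ptransform u N m * ptransform u N m).
      - intros; ring.
      - replace (transform u m ^ 2) with (transform u m * transform u m) by ring.
        now apply is_lim_seq_mult'. }
    induction M as [|M IH].
    - rewrite sum_O. apply is_lim_seq_ext with (fun N => ptransform u N O ^ 2); auto.
      intros N. now rewrite sum_O.
    - rewrite sum_Sn.
      apply is_lim_seq_ext with
        (fun N => sum_n (fun m => ptransform u N m ^ 2) M + ptransform u N (S M) ^ 2).
      + intros N. now rewrite sum_Sn.
      + now apply is_lim_seq_plus'. }
  refine (is_lim_seq_le _ (fun _ => ip u u) _ (ip u u) _ HL (is_lim_seq_const _)).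
  intros N. destruct (ptransform_spec u N) as [H1 [_ H3]].
  apply Rle_trans with (ip (ptransform u N) (ptransform u N)).
  - unfold ip. rewrite (Series_ext _ (fun m => ptransform u N m ^ 2)); [|intros; ring].
    apply (sum_n_le_Series (fun m => ptransform u N m ^ 2)); [intros; nra|exact H1].
  - rewrite H3, Hsq. apply sum_n_le_Series; [intros; nra|exact Hu]. }
assert (Hl : l2 (transform u)).
{ apply ex_series_bounded with (ip u u); auto. intros; nra. }
split; auto.
unfold ip at 1. rewrite (Series_ext _ (fun m => transform u m ^ 2)); [|intros; ring].
now apply Series_le_bound.
Qed.

(** Truncations are mapped isometrically and, by Bessel, the tail has a small image; only the cross
    term between head and tail remains to be controlled. *)
Lemma parseval_norm (u : nat -> R) : l2 u -> ip (transform u) (transform u) = ip u u.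
Proof.
intros Hu.
apply Rle_antisym; [now apply bessel|].
assert (Hsq : ip u u = Series (fun k => u k ^ 2)) by (apply Series_ext; intros; ring).
pose proof (ip_ge0 u Hu) as Hpos.
apply Rnot_lt_le. intros Hlt.
set (gap := ip u u - ip (transform u) (transform u)) in *.
assert (Hgap : 0 < gap) by (unfold gap; lra).
(* The tail will have squared norm at most [eta ^ 2], and the cross term then costs at most
   [eta * (ip u u + 1)]; this choice keeps the total loss below [gap]. *)
set (eta := Rmin (1 / 2) (gap / (2 * (ip u u + 2)))).
assert (Heta : 0 < eta).
{ apply Rmin_glb_lt; [lra|]. apply Rdiv_lt_0_compat; lra. }
assert (Heta1 : eta <= 1 / 2) by apply Rmin_l.
assert (Heta2 : eta * (ip u u + 2) <= gap / 2).
{ apply Rle_trans with (gap / (2 * (ip u u + 2)) * (ip u u + 2)).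
  - apply Rmult_le_compat_r; [lra|]. apply Rmin_r.
  - apply Req_le. field. lra. }
assert (HL : is_lim_seq (sum_n (fun k => u k ^ 2)) (ip u u)).
{ rewrite Hsq. exact (Series_correct _ Hu). }
apply is_lim_seq_spec in HL.
destruct (HL (mkposreal (eta ^ 2) (pow_lt _ 2 Heta))) as [N HN].
specialize (HN N (Nat.le_refl N)).
change (Rabs (sum_n (fun k => u k ^ 2) N - ip u u) < eta ^ 2) in HN.
set (r := fun k => if le_dec k N then 0 else u k).
set (w := fun k => if le_dec k N then u k else 0).
assert (Hr : l2 r).
{ apply l2_le with u; auto. intros k. unfold r. destruct (le_dec k N); [|lra].
  rewrite Rabs_R0. apply Rabs_pos. }
assert (Hw : l2 w).
{ apply l2_le with u; auto. intros k. unfold w. destruct (le_dec k N); [lra|].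
  rewrite Rabs_R0. apply Rabs_pos. }
assert (Hsum : forall f : nat -> R,
   Series (fun k => if le_dec k N then f k else 0) = sum_n f N).
{ intros f.
  apply is_series_unique.
  change (is_lim_seq (sum_n (fun k => if le_dec k N then f k else 0)) (sum_n f N)).
  apply (is_lim_seq_ext_loc (fun _ => sum_n f N)).
  - exists N. intros n Hn. induction Hn as [|n Hn IH].
    + apply sum_n_ext_loc. intros k Hk. now destruct (le_dec k N).
    + rewrite sum_Sn, <- IH. destruct (le_dec (S n) N); [lia|].
      unfold plus; simpl. lra.
  - exact (is_lim_seq_const (sum_n f N)). }
assert (Ew : ip w w = sum_n (fun k => u k ^ 2) N).
{ rewrite <- Hsum. apply Series_ext. intros k. unfold w. destruct (le_dec k N); ring. }
assert (Eu : ip u u = ip w w + ip r r).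
{ unfold ip. rewrite <- Series_plus.
  - apply Series_ext. intros k. unfold w, r. destruct (le_dec k N); ring.
  - now apply l2_mul.
  - now apply l2_mul. }
assert (Et : forall m, transform u m = transform w m + 1 * transform r m).
{ intros m. unfold transform. rewrite <- ip_axpy; auto.
  apply Series_ext. intros k. unfold w, r. destruct (le_dec k N); ring. }
assert (Etw : forall m, transform w m = ptransform u N m).
{ intros m. unfold ptransform. rewrite <- Hsum. apply Series_ext. intros k.
  unfold w. destruct (le_dec k N); ring. }
destruct (ptransform_spec u N) as [Hp1 [_ Hp3]].
destruct (bessel r Hr) as [Hr1 Hr2].
destruct (bessel w Hw) as [Hw1 _].
assert (Ew' : ip (transform w) (transform w) = ip w w).
{ rewrite Ew, <- Hp3. apply Series_ext. intros m. now rewrite Etw. }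
assert (E : ip (transform u) (transform u)
  = ip (transform w) (transform w) + 2 * 1 * ip (transform w) (transform r)
    + 1 ^ 2 * ip (transform r) (transform r)).
{ rewrite <- ip_axpy2; auto. apply Series_ext. intros m. now rewrite Et. }
assert (Hrr : ip r r <= eta ^ 2).
{ rewrite Ew in Eu. apply Rabs_def2 in HN. lra. }
pose proof (ip_ge0 _ Hr1) as Hr0.
assert (HY : 0 <= eta * (eta * ip w w) + 2 * eta * ip (transform w) (transform r)
        + ip (transform r) (transform r)).
{ assert (Hq : 0 <= ip (fun m => transform r m + eta * transform w m)
                       (fun m => transform r m + eta * transform w m)).
  { apply ip_ge0. now apply l2_axpy. }
  rewrite ip_axpy2 in Hq; auto. rewrite Ew', (ip_sym (transform r) (transform w)) in Hq. nra. }
assert (Hww : ip w w <= ip u u).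
{ rewrite Eu. pose proof (ip_ge0 r Hr). lra. }
assert (HY2 : 0 <= eta * ip w w + 2 * ip (transform w) (transform r) + eta).
{ apply Rmult_le_reg_l with eta; auto. rewrite Rmult_0_r.
  apply Rle_trans with (1 := HY). nra. }
assert (ip u u - ip (transform u) (transform u) < gap); [|unfold gap in *; lra].
rewrite E, Ew'. nra.
Qed.

Theorem parseval (u w : nat -> R) : l2 u -> l2 w ->
  ip (transform u) (transform w) = ip u w.
Proof.
intros Hu Hw.
destruct (bessel u Hu) as [Hu1 _]. destruct (bessel w Hw) as [Hw1 _].
assert (H := parseval_norm (fun k => u k + 1 * w k) (l2_axpy 1 u w Hu Hw)).
rewrite (ip_axpy2 1 u w) in H; auto.
replace (ip (transform (fun k => u k + 1 * w k)) (transform (fun k => u k + 1 * w k)))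
  with (ip (fun m => transform u m + 1 * transform w m) (fun m => transform u m + 1 * transform w m)) in H.
- rewrite ip_axpy2 in H; auto. rewrite !parseval_norm in H; auto. lra.
- apply Series_ext. intros m. unfold transform. rewrite ip_axpy; auto.
Qed.

End Parseval.

(** * Charlier functions *)

Lemma sqrt_INR_S_pos (k : nat) : 0 < sqrt (INR (S k)).
Proof. apply sqrt_lt_R0, lt_0_INR. lia. Qed.

Lemma sqrt_INR_sqr (k : nat) : sqrt (INR k) * sqrt (INR k) = INR k.
Proof. apply sqrt_sqrt, pos_INR. Qed.

Lemma sqrt_INR_S_le_pow (m : nat) : sqrt (INR (S m)) <= 2 ^ m.
Proof.
apply Rle_trans with (INR (S m)).
- assert (1 <= INR (S m)) by (rewrite S_INR; pose proof (pos_INR m); lra).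
  rewrite <- (sqrt_square (INR (S m))) at 2 by lra.
  apply sqrt_le_1_alt. nra.
- induction m as [|m IH]; [simpl; lra|].
  rewrite S_INR. simpl pow. assert (1 <= 2 ^ m) by (apply pow_R1_Rle; lra). lra.
Qed.

Lemma pow_m1_sqr (k : nat) : (-1) ^ k * (-1) ^ k = 1.
Proof. rewrite <- Rpow_mult_distr. replace (-1 * -1) with 1 by ring. apply pow1. Qed.

Lemma Rabs_pow_m1 (k : nat) : Rabs ((-1) ^ k) = 1.
Proof. apply pow_1_abs. Qed.

(** Decay faster than every geometric sequence: the factor [sqrt (m + 1)], at most [2 ^ m], is
    absorbed by halving [r], so the class is stable under [raise] and [lower]. *)
Definition fast (a : nat -> R) : Prop :=
  forall r, 0 < r -> exists B, forall m, Rabs (a m) <= B * r ^ m.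

Definition raise (a : nat -> R) (m : nat) : R :=
  match m with O => 0 | S m' => sqrt (INR (S m')) * a m' end.

Definition lower (a : nat -> R) (m : nat) : R := sqrt (INR (S m)) * a (S m).

Lemma raise_0 (a : nat -> R) : raise a 0 = 0.
Proof. reflexivity. Qed.

Lemma raise_S (a : nat -> R) (m : nat) : raise a (S m) = sqrt (INR (S m)) * a m.
Proof. reflexivity. Qed.

Lemma fast_bound (a : nat -> R) (r : R) : fast a -> 0 < r ->
  exists B, 0 <= B /\ forall m, Rabs (a m) <= B * r ^ m.
Proof.
intros Ha Hr. destruct (Ha r Hr) as [B HB]. exists B. split; auto.
specialize (HB O). simpl in HB. pose proof (Rabs_pos (a O)). lra.
Qed.

Lemma fast_axpy (t : R) (a b : nat -> R) : fast a -> fast b -> fast (fun m => a m + t * b m).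
Proof.
intros Ha Hb r Hr. destruct (Ha r Hr) as [A HA]. destruct (Hb r Hr) as [B HB].
exists (A + Rabs t * B). intros m.
apply Rle_trans with (1 := Rabs_triang _ _). rewrite Rabs_mult.
specialize (HA m). specialize (HB m). pose proof (Rabs_pos t). nra.
Qed.

Lemma fast_le (t : R) (a b : nat -> R) : 0 <= t ->
  (forall m, Rabs (a m) <= t * Rabs (b m)) -> fast b -> fast a.
Proof.
intros Ht H Hb r Hr. destruct (Hb r Hr) as [B HB].
exists (t * B). intros m. specialize (HB m). specialize (H m). nra.
Qed.

Lemma fast_lower (a : nat -> R) : fast a -> fast (lower a).
Proof.
intros Ha r Hr.
destruct (fast_bound a (r / 2) Ha) as [B [HB0 HB]]; [lra|].
exists (B * (r / 2)). intros m. unfold lower.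
rewrite Rabs_mult, (Rabs_pos_eq (sqrt _)) by apply sqrt_pos.
replace (B * (r / 2) * r ^ m) with (2 ^ m * (B * (r / 2) ^ S m)).
- apply Rmult_le_compat; auto using sqrt_pos, Rabs_pos, sqrt_INR_S_le_pow.
- replace (r ^ m) with ((2 * (r / 2)) ^ m) by (f_equal; field).
  rewrite Rpow_mult_distr. simpl. ring.
Qed.

Lemma fast_raise (a : nat -> R) : fast a -> fast (raise a).
Proof.
intros Ha r Hr.
destruct (fast_bound a (r / 2) Ha) as [B [HB0 HB]]; [lra|].
exists (B / r). intros [|m]; rewrite ?raise_S, ?raise_0.
- rewrite Rabs_R0. simpl. rewrite Rmult_1_r.
  apply Rmult_le_pos; auto. left; now apply Rinv_0_lt_compat.
- rewrite Rabs_mult, (Rabs_pos_eq (sqrt _)) by apply sqrt_pos.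
  replace (B / r * r ^ S m) with (2 ^ m * (B * (r / 2) ^ m)).
  + apply Rmult_le_compat; auto using sqrt_pos, Rabs_pos, sqrt_INR_S_le_pow.
  + replace (r ^ S m) with (r * (2 * (r / 2)) ^ m) by (simpl; f_equal; f_equal; field).
    rewrite Rpow_mult_distr. field. lra.
Qed.

Lemma fast_l2 (a : nat -> R) : fast a -> l2 a.
Proof.
intros Ha. destruct (fast_bound a (1 / 2) Ha) as [B [HB0 HB]]; [lra|].
apply (ex_series_le (K := R_AbsRing) (V := R_CompleteNormedModule) _
  (fun m => B ^ 2 * (1 / 4) ^ m)).
- intros m. change (Rabs (a m ^ 2) <= B ^ 2 * (1 / 4) ^ m).
  rewrite <- RPow_abs.
  replace (B ^ 2 * (1 / 4) ^ m) with ((B * (1 / 2) ^ m) ^ 2).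
  + apply pow_incr. split; auto using Rabs_pos.
  + rewrite Rpow_mult_distr, <- pow_mult, Nat.mul_comm, pow_mult.
    do 2 f_equal. field.
- apply (ex_series_scal_l (B ^ 2) (fun m => (1 / 4) ^ m)), ex_series_geom.
  rewrite Rabs_pos_eq; lra.
Qed.

Lemma ip_raise (a b : nat -> R) : ex_series (fun k => a k * lower b k) ->
  ex_series (fun k => raise a k * b k) /\ ip (raise a) b = ip a (lower b).
Proof.
intros H.
assert (H1 : ex_series (fun k => raise a k * b k)).
{ apply ex_series_incr_1.
  apply ex_series_ext with (2 := H). intros k. unfold lower; rewrite ?raise_S, ?raise_0.
  change (@eq R (a k * (sqrt (INR (S k)) * b (S k))) (sqrt (INR (S k)) * a k * b (S k))). ring. }
split; auto. unfold ip.
rewrite Series_incr_1 by exact H1. change (raise a 0) with 0.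
rewrite Rmult_0_l, Rplus_0_l. apply Series_ext. intros k. unfold lower.
change (raise a (S k)) with (sqrt (INR (S k)) * a k). ring.
Qed.

Lemma lower_raise (a : nat -> R) (m : nat) : lower (raise a) m = raise (lower a) m + a m.
Proof.
unfold lower. rewrite raise_S. rewrite <- Rmult_assoc, sqrt_INR_sqr.
destruct m as [|m]; rewrite ?raise_S, ?raise_0.
- simpl. ring.
- rewrite <- Rmult_assoc, sqrt_INR_sqr. rewrite (S_INR (S m)). ring.
Qed.

(* The coordinates, in the number basis, of the displaced number states: [charlier g k m] is
   the matrix entry of a displacement operator between the states [k] and [m]. *)
Fixpoint charlier (g : R) (k : nat) : nat -> R :=
  match k with
  | O => fun m => exp (- (g ^ 2 / 2)) * (g ^ m / sqrt (INR (fact m)))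
  | S k' => fun m => (raise (charlier g k') m - g * charlier g k' m) / sqrt (INR (S k'))
  end.

Lemma charlier_raise (g : R) (k m : nat) :
  sqrt (INR (S k)) * charlier g (S k) m = raise (charlier g k) m - g * charlier g k m.
Proof.
change (charlier g (S k) m)
  with ((raise (charlier g k) m - g * charlier g k m) / sqrt (INR (S k))).
field. apply Rgt_not_eq, sqrt_INR_S_pos.
Qed.

Lemma charlier_0_lower (g : R) (m : nat) : lower (charlier g 0) m = g * charlier g 0 m.
Proof.
unfold lower.
change (sqrt (INR (S m)) * (exp (- (g ^ 2 / 2)) * (g ^ S m / sqrt (INR (fact (S m)))))
  = g * (exp (- (g ^ 2 / 2)) * (g ^ m / sqrt (INR (fact m))))).
rewrite fact_simpl, mult_INR, sqrt_mult by apply pos_INR.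
pose proof (sqrt_INR_S_pos m).
assert (0 < sqrt (INR (fact m))) by apply sqrt_lt_R0, INR_fact_lt_0.
rewrite <- (tech_pow_Rmult g m). field. split; lra.
Qed.

(** After squaring and division by [r ^ (2 m)] the claim is that [((g / r) ^ 2) ^ m / m!] is
    bounded, which holds because it tends to 0. *)
Lemma charlier_0_fast (g : R) : fast (charlier g 0).
Proof.
intros r Hr.
destruct (maj_by_pos _ (exist _ 0 (cv_speed_pow_fact ((g / r) ^ 2)))) as [B [HB0 HB]].
set (e := exp (- (g ^ 2 / 2))).
assert (He : 0 < e) by apply exp_pos.
exists (e * sqrt B). intros m. specialize (HB m).
assert (Hf : 0 < sqrt (INR (fact m))) by apply sqrt_lt_R0, INR_fact_lt_0.
change (charlier g 0 m) with (e * (g ^ m / sqrt (INR (fact m)))). rewrite Rabs_mult, (Rabs_pos_eq e), Rmult_assoc by lra.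
apply Rmult_le_compat_l; [lra|].
unfold Rdiv. rewrite Rabs_mult, (Rabs_pos_eq (/ _)) by (left; now apply Rinv_0_lt_compat).
apply Rmult_le_reg_r with (sqrt (INR (fact m))); auto.
rewrite Rmult_assoc, Rinv_l, Rmult_1_r by lra.
rewrite Rmult_assoc, (Rmult_comm (r ^ m)), <- Rmult_assoc, <- sqrt_mult by (lra || apply pos_INR).
apply Rmult_le_reg_r with (/ r ^ m); [apply Rinv_0_lt_compat, pow_lt; auto|].
rewrite Rmult_assoc, Rinv_r, Rmult_1_r by (apply pow_nonzero; lra).
rewrite <- (Rabs_pos_eq (/ r ^ m)) by (left; apply Rinv_0_lt_compat, pow_lt; auto).
rewrite <- Rabs_mult, <- sqrt_Rsqr_abs.
apply sqrt_le_1_alt.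
apply Rle_trans with (((g / r) ^ 2) ^ m).
- apply Req_le. rewrite <- pow_mult, Nat.mul_comm, pow_mult.
  unfold Rsqr. unfold Rdiv. rewrite Rpow_mult_distr, pow_inv. ring.
- apply Rmult_le_reg_r with (/ INR (fact m)); [apply Rinv_0_lt_compat, INR_fact_lt_0|].
  rewrite Rmult_assoc, Rinv_r, Rmult_1_r by apply INR_fact_neq_0.
  apply Rle_trans with (2 := HB). apply Rle_abs.
Qed.

Lemma charlier_fast (g : R) (k : nat) : fast (charlier g k).
Proof.
induction k as [|k IH]; [apply charlier_0_fast|].
pose proof (sqrt_INR_S_pos k) as Hk.
apply fast_le with (/ sqrt (INR (S k))) (fun m => raise (charlier g k) m + - g * charlier g k m).
- left; now apply Rinv_0_lt_compat.
- intros m.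
  change (charlier g (S k) m)
    with ((raise (charlier g k) m - g * charlier g k m) / sqrt (INR (S k))).
  unfold Rdiv.
  rewrite Rabs_mult, (Rabs_pos_eq (/ _)) by (left; now apply Rinv_0_lt_compat).
  apply Req_le. rewrite Rmult_comm. do 2 f_equal. ring.
- apply fast_axpy; auto. now apply fast_raise.
Qed.

Lemma charlier_lower_step (g : R) (k m : nat) :
  sqrt (INR (S k)) * lower (charlier g (S k)) m
    = raise (lower (charlier g k)) m + charlier g k m - g * lower (charlier g k) m.
Proof.
rewrite <- lower_raise. unfold lower.
transitivity (sqrt (INR (S m)) * (sqrt (INR (S k)) * charlier g (S k) (S m))); [ring|].
rewrite charlier_raise. ring.
Qed.

(* The canonical commutation relation [lower_raise] propagates
   [lower (charlier g k) = g * charlier g k + sqrt k * charlier g (k - 1)]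
   from [k] to [k + 1]. *)
Lemma charlier_lower (g : R) (k m : nat) :
  lower (charlier g (S k)) m = g * charlier g (S k) m + sqrt (INR (S k)) * charlier g k m.
Proof.
(* [f] stands for [sqrt k] times the previous state, and for 0 when [k = 0], so that one argument
   serves the base case and the inductive step. *)
assert (Hstep : forall (k : nat) (f : nat -> R),
  (forall m, lower (charlier g k) m = g * charlier g k m + f m) ->
  (forall m, raise f m = INR k * charlier g k m + g * f m) ->
  forall m, lower (charlier g (S k)) m
    = g * charlier g (S k) m + sqrt (INR (S k)) * charlier g k m).
{ clear k m. intros k f H1 H2 m.
  pose proof (sqrt_INR_S_pos k) as Hk.
  apply Rmult_eq_reg_l with (sqrt (INR (S k))); [|lra].
  rewrite charlier_lower_step, H1.
  replace (raise (lower (charlier g k)) m) with (g * raise (charlier g k) m + raise f m)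
    by (destruct m as [|m]; rewrite ?raise_0, ?raise_S, ?H1; ring).
  transitivity (g * (sqrt (INR (S k)) * charlier g (S k) m)
    + (sqrt (INR (S k)) * sqrt (INR (S k))) * charlier g k m); [|ring].
  rewrite H2, charlier_raise, sqrt_INR_sqr, S_INR. ring. }
revert m. induction k as [|k IH].
- apply (Hstep O (fun _ => 0)); intros m.
  + rewrite charlier_0_lower. ring.
  + destruct m; rewrite ?raise_0, ?raise_S; simpl INR; ring.
- apply (Hstep (S k) (fun m => sqrt (INR (S k)) * charlier g k m)); auto.
  intros m.
  transitivity (sqrt (INR (S k)) * raise (charlier g k) m).
  + destruct m; rewrite ?raise_0, ?raise_S; ring.
  + replace (raise (charlier g k) m)
      with (sqrt (INR (S k)) * charlier g (S k) m + g * charlier g k m)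
      by (rewrite charlier_raise; ring).
    rewrite Rmult_plus_distr_l, <- Rmult_assoc, sqrt_INR_sqr. ring.
Qed.

Lemma charlier_at_0 (g : R) (k : nat) : charlier g k 0 = (-1) ^ k * charlier g 0 k.
Proof.
induction k as [|k IH]; [simpl; ring|].
pose proof (sqrt_INR_S_pos k) as Hk.
apply Rmult_eq_reg_l with (sqrt (INR (S k))); [|lra].
rewrite charlier_raise, IH. rewrite ?raise_S, ?raise_0.
transitivity ((-1) ^ S k * lower (charlier g 0) k).
- rewrite charlier_0_lower. simpl pow. ring.
- unfold lower. ring.
Qed.

(** Increasing [k] by [charlier_raise] corresponds, on the right, to lowering in the argument of
    [charlier g m]; the alternating sign turns one recurrence into the other. *)
Lemma charlier_sym (g : R) (k m : nat) : charlier g k m = (-1) ^ (k + m) * charlier g m k.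
Proof.
revert m. induction k as [|k IH]; intros m.
- rewrite charlier_at_0, <- Rmult_assoc. simpl plus. rewrite pow_m1_sqr. ring.
- pose proof (sqrt_INR_S_pos k) as Hk.
  apply Rmult_eq_reg_l with (sqrt (INR (S k))); [|lra].
  rewrite charlier_raise.
  replace (sqrt (INR (S k)) * ((-1) ^ (S k + m) * charlier g m (S k)))
    with ((-1) ^ (S k + m) * lower (charlier g m) k) by (unfold lower; ring).
  destruct m as [|m]; rewrite ?raise_S, ?raise_0.
  + rewrite charlier_0_lower, (IH O). simpl. ring.
  + rewrite charlier_lower, (IH m), (IH (S m)).
    replace (S k + S m)%nat with (S (S (k + m))) by lia.
    replace (k + S m)%nat with (S (k + m)) by lia. simpl pow. ring.
Qed.

Lemma charlier_row_fast (g : R) (m : nat) : fast (fun k => charlier g k m).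
Proof.
apply fast_le with 1 (charlier g m); [lra| |apply charlier_fast].
intros k. rewrite charlier_sym, Rabs_mult, Rabs_pow_m1. lra.
Qed.

Lemma ip_ext (a a' b b' : nat -> R) :
  (forall k, a k = a' k) -> (forall k, b k = b' k) -> ip a b = ip a' b'.
Proof. intros Ha Hb. apply Series_ext. intros k. now rewrite Ha, Hb. Qed.

Lemma ip_scal_l (t : R) (a b : nat -> R) : ip (fun k => t * a k) b = t * ip a b.
Proof. unfold ip. rewrite <- Series_scal_l. apply Series_ext. intros; ring. Qed.

Lemma charlier_0_norm (g : R) : ip (charlier g 0) (charlier g 0) = 1.
Proof.
unfold ip. transitivity (exp (- g ^ 2) * exp (g ^ 2)).
- rewrite (exp_Reals (g ^ 2)). unfold PSeries. rewrite <- Series_scal_l.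
  apply Series_ext. intros m.
  change (charlier g 0 m) with (exp (- (g ^ 2 / 2)) * (g ^ m / sqrt (INR (fact m)))).
  assert (Hf : 0 < sqrt (INR (fact m))) by apply sqrt_lt_R0, INR_fact_lt_0.
  replace (exp (- g ^ 2)) with (exp (- (g ^ 2 / 2)) * exp (- (g ^ 2 / 2)))
    by (rewrite <- exp_plus; f_equal; field).
  rewrite <- (sqrt_sqrt (INR (fact m))) at 3 by apply pos_INR.
  rewrite <- pow_mult, Nat.mul_comm, pow_mult. field. lra.
- rewrite <- exp_plus. replace (- g ^ 2 + g ^ 2) with 0 by ring. apply exp_0.
Qed.

Lemma charlier_orth_step (g : R) (k : nat) (b : nat -> R) : fast b ->
  sqrt (INR (S k)) * ip (charlier g (S k)) b
    = ip (charlier g k) (fun m => lower b m - g * b m).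
Proof.
intros Hb.
assert (Hk := charlier_fast g k).
rewrite <- ip_scal_l.
transitivity (ip (fun m => raise (charlier g k) m + - g * charlier g k m) b).
{ apply ip_ext; auto. intros m. rewrite charlier_raise. ring. }
rewrite ip_axpy; auto using fast_l2, fast_raise.
destruct (ip_raise (charlier g k) b) as [_ ->].
{ apply l2_mul; auto using fast_l2, fast_lower. }
rewrite (ip_sym _ (fun m => _ - _)).
transitivity (ip (fun m => lower b m + - g * b m) (charlier g k)).
- rewrite ip_axpy; auto using fast_l2, fast_lower. rewrite (ip_sym b), (ip_sym (lower b)). ring.
- apply ip_ext; auto. intros; ring.
Qed.

(** As for Hermite functions: the adjoint [lower - g] of the creation step annihilates the state 0
    and maps the state [j + 1] to [sqrt (j + 1)] times the state [j], so both indices descend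
    together. *)
Lemma charlier_orth (g : R) (k j : nat) : ip (charlier g k) (charlier g j) = kron k j.
Proof.
revert j. induction k as [|k IH]; intros j.
- destruct j as [|j]; [rewrite kron_same; apply charlier_0_norm|].
  rewrite kron_diff by lia. rewrite ip_sym.
  pose proof (sqrt_INR_S_pos j) as Hj.
  apply Rmult_eq_reg_l with (sqrt (INR (S j))); [|lra].
  rewrite charlier_orth_step by apply charlier_fast.
  rewrite ip_sym, Rmult_0_r. unfold ip.
  rewrite (Series_ext _ (fun k => 0 * charlier g 0 k)); [rewrite Series_scal_l; ring|].
  intros m. rewrite charlier_0_lower. ring.
- pose proof (sqrt_INR_S_pos k) as Hk.
  apply Rmult_eq_reg_l with (sqrt (INR (S k))); [|lra].
  rewrite charlier_orth_step by apply charlier_fast.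
  destruct j as [|j].
  + rewrite kron_diff by lia. rewrite ip_sym, Rmult_0_r. unfold ip.
    rewrite (Series_ext _ (fun m => 0 * charlier g k m)); [rewrite Series_scal_l; ring|].
    intros m. rewrite charlier_0_lower. ring.
  + transitivity (sqrt (INR (S j)) * kron k j).
    * rewrite <- IH, (ip_sym _ (charlier g j)), <- ip_scal_l, ip_sym.
      apply ip_ext; auto. intros m. rewrite charlier_lower. ring.
    * destruct (Nat.eq_dec k j) as [->|E]; [now rewrite !kron_same|].
      rewrite !kron_diff by lia. ring.
Qed.

(** * The displaced parity matrix *)

(** Here [b] is merely square summable, so [lower b] need not be; convergence comes from [raise a].
    This is the form that applies to eigenvectors. *)
Lemma ip_raise_l2 (a b : nat -> R) : l2 (raise a) -> l2 b ->
  ip (raise a) b = ip a (lower b) /\ ex_series (fun k => a k * lower b k).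
Proof.
intros Ha Hb.
assert (H : ex_series (fun k => a k * lower b k)).
{ pose proof (l2_mul _ _ Ha Hb) as H. apply ex_series_incr_1 in H.
  apply ex_series_ext with (2 := H). intros k. rewrite raise_S. unfold lower.
  change (@eq R (sqrt (INR (S k)) * a k * b (S k)) (a k * (sqrt (INR (S k)) * b (S k)))). ring. }
split; auto. now apply ip_raise.
Qed.

Definition alt (u : nat -> R) (k : nat) : R := (-1) ^ k * u k.

Lemma alt_l2 (u : nat -> R) : l2 u -> l2 (alt u).
Proof.
apply l2_le. intros k. unfold alt. rewrite Rabs_mult, Rabs_pow_m1. lra.
Qed.

Lemma alt_fast (u : nat -> R) : fast u -> fast (alt u).
Proof.
apply fast_le with 1; [lra|].
intros k. unfold alt. rewrite Rabs_mult, Rabs_pow_m1. lra.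
Qed.

Lemma ip_alt (u w : nat -> R) : ip (alt u) w = ip u (alt w).
Proof. apply Series_ext. intros k. unfold alt. ring. Qed.

Lemma ip_alt_alt (u w : nat -> R) : ip (alt u) (alt w) = ip u w.
Proof.
apply Series_ext. intros k. unfold alt.
transitivity ((-1) ^ k * (-1) ^ k * (u k * w k)); [ring|]. rewrite pow_m1_sqr. ring.
Qed.

(** A row of the Charlier matrix. By [charlier_sym] it is [charlier g m] with alternating signs,
    that is, displaced by [- g] instead of [g], as the coupling with positive sign demands. *)
Definition mode (g : R) (m k : nat) : R := charlier g k m.

Lemma mode_fast (g : R) (m : nat) : fast (mode g m).
Proof. apply charlier_row_fast. Qed.

Lemma mode_l2 (g : R) (m : nat) : l2 (mode g m).
Proof. apply fast_l2, mode_fast. Qed.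

Lemma mode_norm (g : R) (m : nat) : ip (mode g m) (mode g m) = 1.
Proof.
rewrite <- (kron_same m), <- (charlier_orth g m m).
apply Series_ext. intros k. unfold mode. rewrite charlier_sym.
transitivity ((-1) ^ (k + m) * (-1) ^ (k + m) * (charlier g m k * charlier g m k)); [ring|].
rewrite pow_m1_sqr. ring.
Qed.

Lemma lower_mode (g : R) (m k : nat) :
  lower (mode g m) k = raise (fun i => mode g i k) m - g * mode g m k.
Proof. apply charlier_raise. Qed.

Lemma raise_mode (g : R) (m k : nat) :
  raise (mode g m) k = sqrt (INR (S m)) * mode g (S m) k - g * mode g m k.
Proof.
change (sqrt (INR (S m)) * mode g (S m) k) with (lower (charlier g k) m).
destruct k as [|k]; rewrite ?raise_0, ?raise_S; unfold mode.
- rewrite charlier_0_lower. ring.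
- rewrite charlier_lower. ring.
Qed.

(** The operator is [(raise + g) (lower + g) - g^2], and by [lower_mode] and [raise_mode] the two
    factors act on the modes as annihilation and creation. *)
Lemma mode_eigen (g : R) (m k : nat) :
  g * raise (mode g m) k + INR k * mode g m k + g * lower (mode g m) k
    = (INR m - g ^ 2) * mode g m k.
Proof.
rewrite lower_mode.
destruct k as [|k].
- rewrite raise_0. destruct m as [|m]; rewrite ?raise_0, ?raise_S; simpl (INR 0); [ring|].
  pose proof (raise_mode g m 0) as H. rewrite raise_0 in H.
  pose proof (sqrt_INR_sqr (S m)) as Es. set (sm := sqrt (INR (S m))) in *. rewrite <- Es.
  assert (E : sm * 0 = sm * (sm * mode g (S m) 0 - g * mode g m 0)) by now rewrite H.
  cbv beta. lra.
- rewrite raise_S.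
  pose proof (lower_mode g m k) as H. unfold lower in H.
  pose proof (sqrt_INR_sqr (S k)) as Ek. set (sk := sqrt (INR (S k))) in *. rewrite <- Ek.
  rewrite Rmult_assoc, H. destruct m as [|m]; rewrite ?raise_0, ?raise_S; simpl (INR 0).
  + ring.
  + pose proof (raise_mode g m (S k)) as H1. rewrite raise_S in H1. fold sk in H1.
    pose proof (sqrt_INR_sqr (S m)) as Es. set (sm := sqrt (INR (S m))) in *. rewrite <- Es.
    assert (E : sm * (sk * mode g m k)
       = sm * (sm * mode g (S m) (S k) - g * mode g m (S k))) by now rewrite H1.
    cbv beta. lra.
Qed.

Definition coef (g : R) (u : nat -> R) (m : nat) : R := ip u (mode g m).

Lemma coef_l2 (g : R) (u : nat -> R) : l2 u -> l2 (coef g u).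
Proof.
intros Hu.
apply (bessel (mode g) (mode_l2 g) (fun k => fast_l2 _ (charlier_fast g k)) (charlier_orth g) u Hu).
Qed.

Lemma coef_parseval (g : R) (u w : nat -> R) : l2 u -> l2 w ->
  ip (coef g u) (coef g w) = ip u w.
Proof.
exact (parseval (mode g) (mode_l2 g) (fun k => fast_l2 _ (charlier_fast g k)) (charlier_orth g) u w).
Qed.

(** The matrix [K] of the overview. *)
Definition parity (g : R) (m n : nat) : R := ip (alt (mode g m)) (mode g n).

Lemma parity_sym (g : R) (m n : nat) : parity g m n = parity g n m.
Proof. unfold parity. now rewrite ip_alt, ip_sym. Qed.

Lemma parity_l2 (g : R) (m : nat) : l2 (parity g m).
Proof. apply (coef_l2 g (alt (mode g m))), alt_l2, mode_l2. Qed.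

Lemma parity_norm (g : R) (m : nat) : ip (parity g m) (parity g m) = 1.
Proof.
change (ip (coef g (alt (mode g m))) (coef g (alt (mode g m))) = 1).
rewrite coef_parseval by apply alt_l2, mode_l2.
rewrite ip_alt_alt. apply mode_norm.
Qed.

Lemma coef_alt (g : R) (u : nat -> R) (m : nat) : l2 u ->
  coef g (alt u) m = ip (parity g m) (coef g u).
Proof.
intros Hu. unfold coef at 1. rewrite ip_alt.
rewrite <- (coef_parseval g u (alt (mode g m))); auto using alt_l2, mode_l2.
apply ip_sym.
Qed.

Definition eigvec (g delta E : R) (u : nat -> R) : Prop :=
  forall k, g * raise u k + (INR k + (-1) ^ k * delta) * u k + g * lower u k = E * u k.

(** Pair the eigenvalue equation with [mode g m] and move the part with [delta = 0] onto the mode,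
    whose eigenvalue is known; the rapid decay of the mode makes every series converge. *)
Lemma eigvec_coef (g delta x : R) (u : nat -> R) (m : nat) :
  l2 u -> eigvec g delta (x - g ^ 2) u ->
  (x - INR m) * coef g u m = delta * coef g (alt u) m.
Proof.
intros Hu He. set (v := mode g m).
assert (Hv : fast v) by apply mode_fast.
assert (Hr : ex_series (fun k => u k * lower v k)) by auto using l2_mul, fast_l2, fast_lower.
destruct (ip_raise u v Hr) as [Er Hr'].
destruct (ip_raise_l2 v u) as [El Hl]; auto using fast_l2, fast_raise.
assert (Hd : ex_series (fun k => u k * raise (lower v) k))
  by auto using l2_mul, fast_l2, fast_raise, fast_lower.
assert (Ed : forall k, raise (lower v) k = INR k * v k).
{ intros [|k]; rewrite ?raise_0, ?raise_S; [simpl; ring|].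
  unfold lower. rewrite <- Rmult_assoc, sqrt_INR_sqr. ring. }
assert (Ha := l2_mul (alt u) v (alt_l2 u Hu) (fast_l2 v Hv)).
assert (E : (x - g ^ 2) * ip u v = g * ip (raise u) v + ip u (raise (lower v))
   + delta * ip (alt u) v + g * ip (lower u) v).
{ unfold ip. rewrite <- !Series_scal_l.
  rewrite <- Series_plus; [|exact (ex_series_scal_l g _ Er)|exact Hd].
  rewrite <- Series_plus;
    [|exact (ex_series_plus _ _ (ex_series_scal_l g _ Er) Hd)|exact (ex_series_scal_l delta _ Ha)].
  assert (Hl' : ex_series (fun k => lower u k * v k)).
  { apply ex_series_ext with (2 := Hl). intros k. apply Rmult_comm. }
  rewrite <- Series_plus;
    [|exact (ex_series_plus _ _ (ex_series_plus _ _ (ex_series_scal_l g _ Er) Hd)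
               (ex_series_scal_l delta _ Ha))
     |exact (ex_series_scal_l g _ Hl')].
  apply Series_ext. intros k. rewrite Ed. specialize (He k). unfold alt.
  transitivity ((x - g ^ 2) * u k * v k); [ring|]. rewrite <- He. ring. }
rewrite Hr', (ip_sym (lower u)), <- El, (ip_sym (raise v)) in E.
assert (E2 : (INR m - g ^ 2) * ip u v
   = g * ip u (lower v) + ip u (raise (lower v)) + g * ip u (raise v)).
{ assert (Hrv : ex_series (fun k => u k * raise v k)) by auto using l2_mul, fast_l2, fast_raise.
  unfold ip. rewrite <- !Series_scal_l.
  rewrite <- Series_plus; [|exact (ex_series_scal_l g _ Hr)|exact Hd].
  rewrite <- Series_plus;
    [|exact (ex_series_plus _ _ (ex_series_scal_l g _ Hr) Hd)|exact (ex_series_scal_l g _ Hrv)].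
  apply Series_ext. intros k. rewrite Ed.
  transitivity (u k * ((INR m - g ^ 2) * v k)); [ring|]. unfold v at 1.
  rewrite <- mode_eigen. fold v. ring. }
unfold coef. fold v. lra.
Qed.

Lemma alt_raise (a : nat -> R) (k : nat) : alt (raise a) k = - raise (alt a) k.
Proof.
unfold alt. destruct k as [|k]; rewrite ?raise_0, ?raise_S; [ring|].
simpl pow. ring.
Qed.

(** Since [alt] anticommutes with [raise], both terms on the left contain the same inner product,
    with opposite signs, and each of them contributes one [g * parity g m n] from the
    displacement. *)
Lemma parity_rec (g : R) (m n : nat) :
  raise (parity g m) n + sqrt (INR (S m)) * parity g (S m) n = 2 * g * parity g m n.
Proof.
assert (H1 : raise (parity g m) n = ip (alt (mode g m)) (lower (mode g n)) + g * parity g m n).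
{ unfold parity at 2. rewrite (ip_sym _ (lower _)), (ip_sym _ (mode g n)).
  rewrite <- ip_axpy; auto using fast_l2, fast_lower, mode_fast, alt_fast.
  destruct n as [|n]; rewrite ?raise_0, ?raise_S.
  - symmetry. unfold ip.
    rewrite (Series_ext _ (fun k => 0 * alt (mode g m) k)); [rewrite Series_scal_l; ring|].
    intros k. rewrite lower_mode, raise_0. ring.
  - unfold parity. rewrite ip_sym, <- ip_scal_l. apply ip_ext; auto.
    intros k. rewrite lower_mode, raise_S. ring. }
assert (H2 : sqrt (INR (S m)) * parity g (S m) n
   = - ip (alt (mode g m)) (lower (mode g n)) + g * parity g m n).
{ rewrite <- (proj1 (ip_raise_l2 (alt (mode g m)) (mode g n)
    (fast_l2 _ (fast_raise _ (alt_fast _ (mode_fast g m)))) (mode_l2 g n))).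
  replace (- ip (raise (alt (mode g m))) (mode g n))
    with (ip (alt (raise (mode g m))) (mode g n)).
  - unfold parity.
    rewrite <- ip_axpy; auto using fast_l2, fast_raise, mode_fast, alt_fast.
    rewrite <- ip_scal_l. apply ip_ext; auto.
    intros k. unfold alt. rewrite raise_mode. ring.
  - replace (- ip (raise (alt (mode g m))) (mode g n))
      with (-1 * ip (raise (alt (mode g m))) (mode g n)) by ring.
    rewrite <- ip_scal_l. apply ip_ext; auto. intros k. rewrite alt_raise. ring. }
lra.
Qed.

(* Conjugating the number operator by the displaced parity shifts it: this makes each row of
   [parity] an eigenvector of a Jacobi matrix. *)
Lemma parity_jacobi (g : R) (m n : nat) :
  2 * g * (sqrt (INR (S n)) * parity g (S m) n + sqrt (INR (S (S n))) * parity g (S m) (S (S n)))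
    = (4 * g ^ 2 + INR (S n) - INR (S m)) * parity g (S m) (S n).
Proof.
pose proof (parity_rec g m (S n)) as H1. rewrite raise_S in H1.
pose proof (parity_rec g (S n) (S m)) as H2. rewrite raise_S in H2.
pose proof (parity_rec g n (S m)) as H3. rewrite raise_S in H3.
rewrite (parity_sym g (S n) m), (parity_sym g (S (S n))), (parity_sym g (S n)) in H2.
rewrite (parity_sym g (S n)), (parity_sym g n m), (parity_sym g n (S m)) in H3.
pose proof (sqrt_INR_sqr (S n)) as En. pose proof (sqrt_INR_sqr (S m)) as Em.
set (sn := sqrt (INR (S n))) in *. set (sm := sqrt (INR (S m))) in *.
set (sn2 := sqrt (INR (S (S n)))) in *.
rewrite <- En, <- Em.
assert (E1 : sm * (sn * parity g m n + sm * parity g (S m) (S n))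
   = sm * (2 * g * parity g m (S n))) by now rewrite H1.
assert (E3 : sn * (sm * parity g m n + sn * parity g (S m) (S n))
   = sn * (2 * g * parity g (S m) n)) by now rewrite H3.
assert (E2 : 2 * g * (sm * parity g m (S n) + sn2 * parity g (S m) (S (S n)))
   = 2 * g * (2 * g * parity g (S m) (S n))) by now rewrite H2.
lra.
Qed.

(** * Bounds near the diagonal *)

Lemma sum_n_shift_le (a : nat -> R) (b m : nat) : (forall k, 0 <= a k) ->
  sum_n (fun i => a (b + i)%nat) m <= sum_n a (b + m).
Proof.
intros Ha. induction m as [|m IH].
- rewrite sum_O, Nat.add_0_r. destruct b as [|b]; [rewrite sum_O; lra|].
  rewrite sum_Sn. unfold plus; simpl.
  assert (0 <= sum_n a b); [|lra].
  clear -Ha. induction b as [|b IH]; [rewrite sum_O; apply Ha|].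
  rewrite sum_Sn. unfold plus; simpl. specialize (Ha (S b)). lra.
- rewrite Nat.add_succ_r, !sum_Sn, Nat.add_succ_r. unfold plus; simpl. lra.
Qed.

Lemma sum_n_Rle (a b : nat -> R) (N : nat) :
  (forall k, (k <= N)%nat -> a k <= b k) -> sum_n a N <= sum_n b N.
Proof.
intros H. induction N as [|N IH].
- rewrite !sum_O. auto.
- rewrite !sum_Sn. unfold plus; simpl. apply Rplus_le_compat; auto.
Qed.

Lemma one_plus_pow_le_exp (t : R) (d : nat) : 0 <= t -> (1 + t) ^ d <= exp (t * INR d).
Proof.
intros Ht.
assert (H : 1 + t <= exp t).
{ destruct (Req_dec t 0) as [->|E]; [rewrite exp_0; lra|]. left. now apply exp_ineq1. }
induction d as [|d IH]; [simpl; rewrite Rmult_0_r, exp_0; lra|].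
rewrite S_INR, Rmult_plus_distr_l, Rmult_1_r, exp_plus, Rmult_comm.
simpl pow. apply Rmult_le_compat; try lra. apply pow_le; lra.
Qed.

(** For [a <= 1/2] the ratio [(1 + a) / (1 - a)] is at most [1 + 4 a]. The step bound is symmetric
    in its two ends, so the comparison runs in both directions. *)
Lemma gronwall_window (f : nat -> R) (a : R) (b w : nat) :
  0 <= a <= 1 / 2 ->
  (forall i, (i <= w)%nat -> 0 <= f (b + i)%nat) ->
  (forall i, (i < w)%nat -> Rabs (f (b + S i)%nat - f (b + i)%nat)
      <= a * (f (b + i)%nat + f (b + S i)%nat)) ->
  forall i j, (i <= w)%nat -> (j <= w)%nat ->
    f (b + i)%nat <= exp (4 * a * INR w) * f (b + j)%nat.
Proof.
intros Ha Hf Hs.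
assert (Hd : forall d i, (i + d <= w)%nat ->
  f (b + (i + d))%nat <= (1 + 4 * a) ^ d * f (b + i)%nat /\
  f (b + i)%nat <= (1 + 4 * a) ^ d * f (b + (i + d))%nat).
{ induction d as [|d IH]; intros i Hi.
  - rewrite Nat.add_0_r. simpl. lra.
  - destruct (IH i) as [IH1 IH2]; [lia|].
    replace (i + S d)%nat with (S (i + d)) by lia.
    specialize (Hs (i + d)%nat ltac:(lia)).
    assert (H0 := Hf (i + d)%nat ltac:(lia)). assert (H1 := Hf (S (i + d))%nat ltac:(lia)).
    assert (H2 := Hf i ltac:(lia)).
    set (x := f (b + (i + d))%nat) in *. set (y := f (b + S (i + d))%nat) in *.
    set (z := f (b + i)%nat) in *.
    apply Rabs_le_between in Hs.
    assert (Hxy : y <= (1 + 4 * a) * x).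
    { assert (y * (1 - a) <= (1 + a) * x) by lra.
      assert (0 <= x * (a * (1 - 2 * a))) by (apply Rmult_le_pos; nra).
      apply Rmult_le_reg_r with (1 - a); lra. }
    assert (Hyx : x <= (1 + 4 * a) * y).
    { assert (x * (1 - a) <= (1 + a) * y) by lra.
      assert (0 <= y * (a * (1 - 2 * a))) by (apply Rmult_le_pos; nra).
      apply Rmult_le_reg_r with (1 - a); lra. }
    assert (Hp : 0 <= (1 + 4 * a) ^ d) by (apply pow_le; lra).
    rewrite <- tech_pow_Rmult. split; nra. }
assert (Hw : forall d, (d <= w)%nat -> (1 + 4 * a) ^ d <= exp (4 * a * INR w)).
{ intros d Hd'. apply Rle_trans with ((1 + 4 * a) ^ w).
  - apply Rle_pow; [lra|auto].
  - apply one_plus_pow_le_exp. lra. }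
intros i j Hi Hj.
assert (H0 := Hf j Hj).
destruct (le_lt_dec i j) as [Hij|Hij].
- destruct (Hd (j - i)%nat i) as [_ H]; [lia|].
  replace (i + (j - i))%nat with j in H by lia.
  apply Rle_trans with (1 := H). apply Rmult_le_compat_r; auto. apply Hw. lia.
- destruct (Hd (i - j)%nat j) as [H _]; [lia|].
  replace (j + (i - j))%nat with i in H by lia.
  apply Rle_trans with (1 := H). apply Rmult_le_compat_r; auto. apply Hw. lia.
Qed.

Lemma Rabs_mult_le_half (x y : R) : Rabs (x * y) <= (y ^ 2 + x ^ 2) / 2.
Proof.
pose proof (pow2_ge_0 (x + y)). pose proof (pow2_ge_0 (x - y)). apply Rabs_le. lra.
Qed.

(** * Energy of the three-term recurrence *)

Section Energy.

Variables (g : R) (l : nat) (u : nat -> R).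
Hypothesis g_pos : 0 < g.
Hypothesis u_rec : forall j,
  2 * g * (sqrt (INR (S j)) * u j + sqrt (INR (S (S j))) * u (S (S j)))
    = (4 * g ^ 2 + INR (S j) - INR l) * u (S j).

Definition slope (j : nat) : R := (4 * g ^ 2 + INR (S j) - INR l) / (2 * g).

(* The cross term makes the leading parts of the increment cancel: it has relative size
   [O(1 / sqrt l)] although [slope] is not small. *)
Definition energy (j : nat) : R :=
  INR (S j) * (u (S j) ^ 2 + u j ^ 2) - slope j * sqrt (INR (S j)) * (u j * u (S j)).

(** With [x], [y], [z] three consecutive values and [p x + q z = slope * y], both
    [q z (q z - slope * y)] and [p x (p x - slope * y)] equal [- p q x z]. They cancel, and only the
    drift of the weight and of [slope] survives. *)
Lemma energy_step (j : nat) :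
  energy (S j) - energy j
    = u (S j) ^ 2 - sqrt (INR (S (S j))) / (2 * g) * (u (S j) * u (S (S j))).
Proof.
assert (Hs : slope (S j) = slope j + 1 / (2 * g)).
{ unfold slope. rewrite (S_INR (S j)). field. lra. }
assert (Hr : sqrt (INR (S j)) * u j + sqrt (INR (S (S j))) * u (S (S j)) = slope j * u (S j)).
{ unfold slope. apply Rmult_eq_reg_l with (2 * g); [|lra]. rewrite u_rec. field. lra. }
unfold energy. rewrite Hs.
pose proof (sqrt_INR_sqr (S j)) as E1. pose proof (sqrt_INR_sqr (S (S j))) as E2.
assert (E3 : INR (S (S j)) = INR (S j) + 1) by apply S_INR.
set (p := sqrt (INR (S j))) in *. set (q := sqrt (INR (S (S j)))) in *.
set (sl := slope j) in *.
rewrite <- E1, <- E2 in *.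
set (x := u j) in *. set (y := u (S j)) in *. set (z := u (S (S j))) in *.
assert (Hz : q * z * (q * z - sl * y) = p * x * (p * x - sl * y)).
{ replace (q * z) with (sl * y - p * x) by lra. ring. }
replace (q / (2 * g)) with (q * (1 / (2 * g))) by (field; lra).
set (h := 1 / (2 * g)).
assert (Hy : q * q * y ^ 2 = (p * p + 1) * y ^ 2) by now rewrite E3.
lra.
Qed.

(** The recurrence oscillates while [slope] stays below about [2 sqrt j] in absolute value. At half
    of that threshold the cross term takes at most half of the squares. *)
Lemma energy_bounds (j : nat) :
  Rabs (4 * g ^ 2 + INR (S j) - INR l) <= 2 * g * sqrt (INR (S j)) ->
  INR (S j) * (u (S j) ^ 2 + u j ^ 2) <= 2 * energy j /\
  2 * energy j <= 3 * (INR (S j) * (u (S j) ^ 2 + u j ^ 2)).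
Proof.
intros H.
assert (Hs : Rabs (slope j * sqrt (INR (S j))) <= INR (S j)).
{ unfold slope. rewrite Rabs_mult, (Rabs_pos_eq (sqrt _)) by apply sqrt_pos.
  rewrite <- (sqrt_INR_sqr (S j)) at 3. apply Rmult_le_compat_r; [apply sqrt_pos|].
  unfold Rdiv. rewrite Rabs_mult, (Rabs_pos_eq (/ _)).
  - apply Rmult_le_reg_r with (2 * g); [lra|]. rewrite Rmult_assoc, Rinv_l by lra. lra.
  - left. apply Rinv_0_lt_compat. lra. }
unfold energy. set (t := slope j * sqrt (INR (S j))) in *. set (s := INR (S j)) in *.
apply Rabs_le_between in Hs.
assert (Hxy : Rabs (t * (u j * u (S j))) <= s * ((u (S j) ^ 2 + u j ^ 2) / 2)).
{ rewrite Rabs_mult. apply Rmult_le_compat; try apply Rabs_pos.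
  - apply Rabs_le; lra.
  - apply Rabs_mult_le_half. }
apply Rabs_le_between in Hxy. lra.
Qed.

End Energy.

Lemma parity_small (g : R) : 0 < g -> exists c C T, 0 < c /\ 0 < C /\ 0 < T /\
  forall l j : nat, T <= sqrt (INR l) -> Rabs (INR j - INR l) <= c * sqrt (INR l) ->
    parity g l j ^ 2 <= C / sqrt (INR l).
Proof.
intros Hg.
(* [c] keeps the window inside the range of [energy_bounds]; [A / s] bounds the relative step of the
   energy, 8 coming from the square and [1 / g] from the cross term; [D] is the resulting ratio over
   the whole window; [T] collects all requirements of largeness. *)
set (c := g / 2). set (A := 8 + 1 / g). set (D := exp (8 * A * c)).
set (T := 2 * A + (4 * g ^ 2 + 1) * (2 / g) + 2 / c + g + 2).
assert (Hc : 0 < c) by (unfold c; lra).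
assert (H1g : 0 < 1 / g) by (apply Rdiv_lt_0_compat; lra).
assert (HA : 8 < A) by (unfold A; lra).
assert (H2g : 0 < (4 * g ^ 2 + 1) * (2 / g)).
{ apply Rmult_lt_0_compat; [nra|]. apply Rdiv_lt_0_compat; lra. }
assert (H2c : 0 < 2 / c) by (apply Rdiv_lt_0_compat; lra).
assert (HD : 0 < D) by apply exp_pos.
assert (HCpos : 0 < 48 * D / c) by (apply Rdiv_lt_0_compat; lra).
exists c, (48 * D / c), T. repeat split; auto; [unfold T; lra|].
intros l j0 HT Hj0.
set (s := sqrt (INR l)) in *.
assert (Hs : INR l = s * s) by (symmetry; apply sqrt_INR_sqr).
assert (Hs1 : 2 * A <= s) by (unfold T in HT; lra).
assert (Hs2 : (4 * g ^ 2 + 1) <= g / 2 * s).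
{ apply Rle_trans with (g / 2 * ((4 * g ^ 2 + 1) * (2 / g))).
  - right. field. lra.
  - apply Rmult_le_compat_l; unfold T in HT; lra. }
assert (Hs3 : 2 <= c * s).
{ apply Rle_trans with (c * (2 / c)).
  - right. field. lra.
  - apply Rmult_le_compat_l; unfold T in HT; lra. }
assert (Hs4 : g + 2 <= s) by (unfold T in HT; lra).
assert (Hl0 : (0 < l)%nat) by (apply INR_lt; rewrite Hs; simpl; nra).
destruct l as [|l']; [lia|]. set (l := S l') in *.
set (u := parity g l).
assert (u_rec : forall j, 2 * g * (sqrt (INR (S j)) * u j + sqrt (INR (S (S j))) * u (S (S j)))
    = (4 * g ^ 2 + INR (S j) - INR l) * u (S j)) by (intros; apply parity_jacobi).
destruct (nfloor_ex (c * s)) as [W HW]; [nra|].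
assert (HWl : (W <= l)%nat).
{ apply INR_le. rewrite Hs. unfold c in *. nra. }
set (b := (l - W)%nat).
assert (Hb : INR b = INR l - INR W) by (apply minus_INR; auto).
assert (Hwin : forall i, (i <= 2 * W)%nat -> Rabs (INR (b + i) - INR l) <= c * s).
{ intros i Hi. rewrite plus_INR, Hb. apply le_INR in Hi. rewrite mult_INR in Hi. simpl in Hi.
  pose proof (pos_INR i). apply Rabs_le. lra. }
assert (Hlow : forall j, Rabs (INR j - INR l) <= c * s ->
   s * s / 4 <= INR j /\ INR (S j) <= 2 * (s * s)).
{ intros j Hj. apply Rabs_le_between in Hj. rewrite S_INR. unfold c in Hj. rewrite Hs in Hj. nra. }
assert (Hsqrt : forall j, Rabs (INR j - INR l) <= c * s -> s / 2 <= sqrt (INR (S j))).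
{ intros j Hj. rewrite <- (sqrt_square (s / 2)) by lra. apply sqrt_le_1_alt.
  destruct (Hlow j Hj). rewrite S_INR. lra. }
assert (Hslope : forall j, Rabs (INR j - INR l) <= c * s ->
   Rabs (4 * g ^ 2 + INR (S j) - INR l) <= 2 * g * sqrt (INR (S j))).
{ intros j Hj. specialize (Hsqrt j Hj).
  apply Rle_trans with (g * s); [|nra].
  rewrite S_INR. apply Rabs_le_between in Hj. unfold c in Hj. apply Rabs_le. nra. }
assert (Hbounds : forall j, Rabs (INR j - INR l) <= c * s ->
  INR (S j) * (u (S j) ^ 2 + u j ^ 2) <= 2 * energy g l u j /\
  2 * energy g l u j <= 3 * (INR (S j) * (u (S j) ^ 2 + u j ^ 2))).
{ intros j Hj. apply energy_bounds; auto. }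
assert (Hpos : forall j, Rabs (INR j - INR l) <= c * s -> 0 <= energy g l u j).
{ intros j Hj. destruct (Hbounds j Hj) as [H _]. pose proof (pos_INR (S j)). nra. }
assert (Hsq : forall j, Rabs (INR j - INR l) <= c * s ->
  u (S j) ^ 2 + u j ^ 2 <= 8 * energy g l u j / (s * s)).
{ intros j Hj. destruct (Hbounds j Hj) as [H _]. destruct (Hlow j Hj) as [H' _].
  apply Rmult_le_reg_r with (s * s); [nra|].
  unfold Rdiv. rewrite Rmult_assoc, Rinv_l, Rmult_1_r by nra.
  rewrite S_INR in H.
  assert (s * s / 4 * (u (S j) ^ 2 + u j ^ 2) <= (INR j + 1) * (u (S j) ^ 2 + u j ^ 2)).
  { apply Rmult_le_compat_r; nra. }
  lra. }
set (a := A / s).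
assert (Ha : 0 <= a <= 1 / 2).
{ unfold a. split; [apply Rdiv_le_0_compat; lra|].
  apply Rmult_le_reg_r with s; [lra|]. unfold Rdiv. rewrite Rmult_assoc, Rinv_l; lra. }
assert (Hstep : forall j, Rabs (INR j - INR l) <= c * s -> Rabs (INR (S j) - INR l) <= c * s ->
  Rabs (energy g l u (S j) - energy g l u j) <= a * (energy g l u j + energy g l u (S j))).
{ intros j Hj HSj. rewrite energy_step by auto.
  apply Rle_trans with (u (S j) ^ 2
     + Rabs (sqrt (INR (S (S j))) / (2 * g) * (u (S j) * u (S (S j))))).
  { apply Rle_trans with (1 := Rabs_triang _ _). rewrite Rabs_Ropp, (Rabs_pos_eq (u (S j) ^ 2)); nra. }
  assert (E1 : u (S j) ^ 2 <= A / s * energy g l u j - 1 / (g * s) * energy g l u j).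
  { apply Rle_trans with (8 / s * energy g l u j).
    - apply Rle_trans with (8 / (s * s) * energy g l u j).
      + specialize (Hsq j Hj).
        replace (8 / (s * s) * energy g l u j) with (8 * energy g l u j / (s * s)) by (field; lra).
        nra.
      + apply Rmult_le_compat_r; auto. unfold Rdiv. apply Rmult_le_compat_l; [lra|].
        apply Rinv_le_contravar; nra.
    - right. unfold A. field. lra. }
  assert (E2 : Rabs (sqrt (INR (S (S j))) / (2 * g) * (u (S j) * u (S (S j))))
     <= 1 / (g * s) * energy g l u (S j)).
  { destruct (Hbounds (S j) HSj) as [H _]. specialize (Hsqrt (S j) HSj).
    pose proof (sqrt_INR_sqr (S (S j))) as E.
    set (q := sqrt (INR (S (S j)))) in *. rewrite <- E in H.
    set (e := energy g l u (S j)) in *.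
    assert (Hq : 0 < q) by lra.
    rewrite Rabs_mult, Rabs_pos_eq by (apply Rdiv_le_0_compat; lra).
    apply Rle_trans with (q / (2 * g) * ((u (S (S j)) ^ 2 + u (S j) ^ 2) / 2)).
    { apply Rmult_le_compat_l; [apply Rdiv_le_0_compat; lra|]. apply Rabs_mult_le_half. }
    apply Rmult_le_reg_l with (4 * g * q); [nra|].
    apply Rle_trans with (2 * e).
    - replace (4 * g * q * (q / (2 * g) * ((u (S (S j)) ^ 2 + u (S j) ^ 2) / 2)))
        with (q * q * (u (S (S j)) ^ 2 + u (S j) ^ 2)) by (field; lra). auto.
    - replace (4 * g * q * (1 / (g * s) * e)) with (4 * (q / s) * e) by (field; lra).
      assert (1 / 2 <= q / s).
      { apply Rmult_le_reg_r with s; [lra|]. unfold Rdiv. rewrite (Rmult_assoc q), Rinv_l; lra. }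
      assert (0 <= e) by now apply Hpos. nra. }
  assert (E3 : 0 <= 1 / (g * s) * energy g l u j).
  { apply Rmult_le_pos; auto. apply Rdiv_le_0_compat; nra. }
  assert (E4 : 1 / (g * s) * energy g l u (S j) <= A / s * energy g l u (S j)).
  { apply Rmult_le_compat_r; auto.
    replace (A / s) with (8 / s + 1 / (g * s)) by (unfold A; field; lra).
    assert (0 <= 8 / s) by (apply Rdiv_le_0_compat; lra). lra. }
  unfold a. lra. }
assert (Hgr : forall i j, (i <= 2 * W)%nat -> (j <= 2 * W)%nat ->
  energy g l u (b + i)%nat <= D * energy g l u (b + j)%nat).
{ intros i j Hi Hj.
  apply Rle_trans with (exp (4 * a * INR (2 * W)) * energy g l u (b + j)%nat).
  - apply gronwall_window; auto.
    intros i' Hi'. replace (b + S i')%nat with (S (b + i')) by lia.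
    apply Hstep; [apply Hwin; lia|]. replace (S (b + i')) with (b + S i')%nat by lia.
    apply Hwin; lia.
  - apply Rmult_le_compat_r; auto.
    assert (Hle : 4 * a * INR (2 * W) <= 8 * A * c).
    { rewrite mult_INR. simpl (INR 2). unfold a.
      apply Rle_trans with (8 * (A / s) * (c * s)).
      - replace (4 * (A / s) * ((1 + 1) * INR W)) with (8 * (A / s) * INR W) by ring.
        apply Rmult_le_compat_l; [|lra]. unfold a in Ha. lra.
      - right. field. lra. }
    unfold D. destruct Hle as [Hle|Hle]; [left; now apply exp_increasing|rewrite Hle; lra]. }
(* The energy is comparable at all points of the window, while the norm of [u] bounds its mean. *)
assert (Hmean : forall i, (i <= 2 * W)%nat ->
   INR (S (2 * W)) * energy g l u (b + i)%nat <= D * (6 * (s * s))).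
{ intros i Hi.
  apply Rle_trans with (D * sum_n (fun j => energy g l u (b + j)%nat) (2 * W)).
  - rewrite <- (sum_n_const (2 * W) (energy g l u (b + i)%nat)).
    rewrite <- (sum_n_mult_l D (fun j => energy g l u (b + j)%nat)).
    apply sum_n_Rle. intros k Hk. now apply Hgr.
  - apply Rmult_le_compat_l; [lra|].
    apply Rle_trans with (sum_n (fun j => 3 * (s * s) * (u (S (b + j)) ^ 2 + u (b + j)%nat ^ 2)) (2 * W)).
    + apply sum_n_Rle. intros k Hk. specialize (Hwin k Hk).
      destruct (Hbounds _ Hwin) as [_ H]. destruct (Hlow _ Hwin) as [_ H'].
      assert (0 <= u (S (b + k)) ^ 2 + u (b + k)%nat ^ 2) by nra. nra.
    + assert (Hu : forall N, sum_n (fun j => u j ^ 2) N <= 1).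
      { intros N. rewrite <- (parity_norm g l). unfold ip.
        rewrite (Series_ext _ (fun k => u k ^ 2)) by (intros; unfold u; ring).
        apply sum_n_le_Series; [intros; nra|apply parity_l2]. }
      rewrite (sum_n_mult_l (3 * (s * s)) (fun j => u (S (b + j)) ^ 2 + u (b + j)%nat ^ 2)).
      unfold mult; simpl.
      replace (6 * (s * s)) with (3 * (s * s) * (1 + 1)) by ring.
      apply Rmult_le_compat_l; [nra|].
      rewrite (sum_n_plus (fun j => u (S (b + j)) ^ 2) (fun j => u (b + j)%nat ^ 2)).
      apply Rplus_le_compat.
      * apply Rle_trans with (2 := Hu (S b + (W + (W + 0)))%nat).
        apply (sum_n_shift_le (fun j => u j ^ 2) (S b)). intros; nra.
      * apply Rle_trans with (2 := Hu (b + (W + (W + 0)))%nat).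
        apply (sum_n_shift_le (fun j => u j ^ 2) b). intros; nra. }
assert (Hj : exists i, (i <= 2 * W)%nat /\ j0 = (b + i)%nat).
{ assert (Hj1 : (j0 <= l + W)%nat).
  { apply Nat.lt_succ_r, INR_lt. rewrite S_INR, plus_INR. apply Rabs_le_between in Hj0. lra. }
  assert (Hj2 : (l <= j0 + W)%nat).
  { apply Nat.lt_succ_r, INR_lt. rewrite S_INR, plus_INR. apply Rabs_le_between in Hj0. lra. }
  exists (j0 - b)%nat. unfold b. lia. }
destruct Hj as [i [Hi ->]].
specialize (Hmean i Hi). specialize (Hsq _ (Hwin i Hi)). specialize (Hpos _ (Hwin i Hi)).
fold u. set (e := energy g l u (b + i)%nat) in *.
assert (He : e <= 6 * D / c * s).
{ apply Rmult_le_reg_l with (c * s); [lra|].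
  replace (c * s * (6 * D / c * s)) with (D * (6 * (s * s))) by (field; lra).
  apply Rle_trans with (2 := Hmean). apply Rmult_le_compat_r; auto.
  rewrite S_INR, mult_INR. simpl (INR 2). pose proof (pos_INR W). lra. }
apply Rle_trans with (8 * e / (s * s)); [nra|].
apply Rle_trans with (8 * (6 * D / c * s) / (s * s)).
- unfold Rdiv at 1 2. apply Rmult_le_compat_r; [left; apply Rinv_0_lt_compat; nra|].
  fold (6 * D / c). lra.
- right. field. lra.
Qed.

(** * Localization of eigenvalues *)

Definition idist (n l : nat) : nat := ((l - n) + (n - l))%nat.

Lemma INR_idist (n l : nat) : INR (idist n l) = Rabs (INR l - INR n).
Proof.
unfold idist. rewrite plus_INR.
destruct (le_lt_dec n l) as [H|H].
- replace (n - l)%nat with O by lia. rewrite minus_INR by auto. apply le_INR in H.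
  simpl. rewrite Rabs_pos_eq; lra.
- replace (l - n)%nat with O by lia. rewrite minus_INR by lia. apply lt_INR in H.
  simpl. rewrite Rabs_left; lra.
Qed.

Lemma sum_n_idist_le (f : nat -> R) (n L : nat) (B : R) :
  (forall k, 0 <= f k) -> f O = 0 -> (forall N, sum_n f N <= B) ->
  sum_n (fun l => f (idist n l)) L <= 2 * B.
Proof.
intros Hf H0 HB.
set (F := fun m => match m with O => 0 | S k => sum_n f k end).
assert (HF : forall m, F (S m) = F m + f m).
{ intros [|m]; simpl; [rewrite sum_O; lra|]. now rewrite sum_Sn. }
assert (HF0 : forall m, 0 <= F m).
{ induction m as [|m IH]; [simpl; lra|]. rewrite HF. specialize (Hf m). lra. }
(* [F m] sums the first [m] values, and [F (n - L)] is the part to the left of [n] not yet reached.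
   Distance 0 appears twice on the right, which is harmless because [f O = 0]. *)
assert (H : sum_n (fun l => f (idist n l)) L + F (n - L)%nat <= F (S n) + F (S (L - n))).
{ induction L as [|L IH].
  - rewrite sum_O. replace (idist n 0) with n by (unfold idist; lia).
    rewrite Nat.sub_0_r, HF, HF. simpl (0 - n)%nat. simpl (F O). rewrite H0. lra.
  - rewrite sum_Sn.
    change (sum_n (fun l => f (idist n l)) L + f (idist n (S L)) + F (n - S L)%nat
      <= F (S n) + F (S (S L - n))).
    destruct (le_lt_dec n L) as [HnL|HnL].
    + replace (n - S L)%nat with O by lia. replace (n - L)%nat with O in IH by lia.
      replace (idist n (S L)) with (S (L - n)) by (unfold idist; lia).
      replace (S L - n)%nat with (S (L - n)) by lia.
      rewrite (HF (S (L - n))). lra.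
    + replace (S L - n)%nat with O by lia. replace (L - n)%nat with O in IH by lia.
      replace (idist n (S L)) with (n - S L)%nat by (unfold idist; lia).
      replace (n - L)%nat with (S (n - S L)) in IH by lia. rewrite (HF (n - S L)%nat) in IH. lra. }
specialize (HF0 (n - L)%nat).
pose proof (HB n). pose proof (HB (L - n)%nat). simpl F in H. lra.
Qed.

(** Away from [n] a coefficient is the inverse distance times a sequence of norm at most [2 Delta].
    The inverse distance is cut at [M]: up to [M] the entries of [parity] are small, beyond it the
    weight itself is. *)
Definition near_weight (M k : nat) : R :=
  if le_dec 1 k then if le_dec k M then / INR k else 0 else 0.

Definition far_weight (M k : nat) : R := if le_dec k M then 0 else / INR k.

Lemma near_weight_ge0 (M k : nat) : 0 <= near_weight M k.
Proof.
unfold near_weight. destruct (le_dec 1 k), (le_dec k M); try lra.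
left. apply Rinv_0_lt_compat, lt_0_INR. lia.
Qed.

Lemma far_weight_bounds (M k : nat) : (1 <= M)%nat -> 0 <= far_weight M k <= / INR M.
Proof.
intros HM. assert (0 < INR M) by (apply lt_0_INR; lia).
unfold far_weight. destruct (le_dec k M).
- assert (0 < / INR M) by now apply Rinv_0_lt_compat. lra.
- split; [left; apply Rinv_0_lt_compat, lt_0_INR; lia|].
  apply Rinv_le_contravar; auto. apply le_INR. lia.
Qed.

Lemma inv_S_le_ln (k : nat) : (1 <= k)%nat -> / INR (S k) <= ln (INR (S k)) - ln (INR k).
Proof.
intros Hk. assert (0 < INR k) by (apply lt_0_INR; lia).
rewrite S_INR. set (y := INR k) in *.
replace (ln (y + 1) - ln y) with (- ln (y / (y + 1))).
- assert (Hq : 0 < y / (y + 1)) by (apply Rdiv_lt_0_compat; lra).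
  pose proof (exp_ineq1_le (ln (y / (y + 1)))) as E. rewrite exp_ln in E by auto.
  replace (y / (y + 1)) with (1 - / (y + 1)) in E at 2 by (field; lra). lra.
- unfold Rdiv. rewrite ln_mult, ln_Rinv; try lra. apply Rinv_0_lt_compat. lra.
Qed.

(** The harmonic sum, source of the logarithm in the error term. *)
Lemma near_weight_sum (M N : nat) : (1 <= M)%nat -> sum_n (near_weight M) N <= 1 + ln (INR M).
Proof.
intros HM.
assert (H : forall N, sum_n (near_weight M) (S N) <= 1 + ln (INR (Nat.min (S N) M))).
{ induction N0 as [|k IH].
  - rewrite sum_Sn, sum_O. rewrite Nat.min_l by lia.
    change (near_weight M 0 + near_weight M 1 <= 1 + ln 1). rewrite ln_1.
    unfold near_weight. destruct (le_dec 1 0), (le_dec 1 1), (le_dec 1 M); try lia.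
    simpl (INR 1). rewrite Rinv_1. lra.
  - rewrite sum_Sn.
    change (sum_n (near_weight M) (S k) + near_weight M (S (S k))
      <= 1 + ln (INR (Nat.min (S (S k)) M))).
    unfold near_weight at 2. destruct (le_dec 1 (S (S k))); [|lia].
    destruct (le_dec (S (S k)) M).
    + rewrite Nat.min_l by lia. rewrite Nat.min_l in IH by lia.
      pose proof (inv_S_le_ln (S k) ltac:(lia)). lra.
    + rewrite Nat.min_r by lia. rewrite Nat.min_r in IH by lia. lra. }
assert (H1 : 0 <= ln (INR M)).
{ rewrite <- ln_1. apply le_INR in HM. simpl in HM.
  destruct HM as [HM|HM]; [left; apply ln_increasing; lra|rewrite <- HM; lra]. }
destruct N as [|N].
- rewrite sum_O. unfold near_weight. destruct (le_dec 1 0); [lia|lra].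
- apply Rle_trans with (1 := H N). apply Rplus_le_compat_l.
  assert (HN : (Nat.min (S N) M <= M)%nat) by lia.
  assert (HN' : (1 <= Nat.min (S N) M)%nat) by lia.
  apply le_INR in HN. apply le_INR in HN'. change (INR 1) with 1 in HN'.
  destruct HN as [HN|HN]; [left; apply ln_increasing; lra|rewrite HN; lra].
Qed.

Lemma near_weight_sqr_sum (M N : nat) : sum_n (fun k => near_weight M k ^ 2) N <= 2.
Proof.
assert (H : forall N, sum_n (fun k => near_weight M k ^ 2) (S N) <= 2 - / INR (S N)).
{ assert (Hw : forall k, (1 <= k)%nat -> near_weight M k ^ 2 <= / INR k * / INR k).
  { intros k Hk. assert (0 < / INR k) by (apply Rinv_0_lt_compat, lt_0_INR; lia).
    unfold near_weight. destruct (le_dec 1 k), (le_dec k M); nra. }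
  induction N0 as [|k IH].
  - rewrite sum_Sn, sum_O.
    change (near_weight M 0 ^ 2 + near_weight M 1 ^ 2 <= 2 - / INR 1).
    specialize (Hw 1%nat ltac:(lia)). unfold near_weight at 1.
    destruct (le_dec 1 0); [lia|]. simpl in Hw. simpl (INR 1). lra.
  - rewrite sum_Sn. change (sum_n (fun k => near_weight M k ^ 2) (S k) + near_weight M (S (S k)) ^ 2
       <= 2 - / INR (S (S k))).
    specialize (Hw (S (S k)) ltac:(lia)).
    assert (Hk : 0 < INR (S k)) by (apply lt_0_INR; lia).
    rewrite (S_INR (S k)) in *. set (y := INR (S k)) in *.
    assert (/ (y + 1) * / (y + 1) <= / y - / (y + 1)).
    { replace (/ y - / (y + 1)) with (/ y * / (y + 1)) by (field; lra).
      apply Rmult_le_compat_r; [left; apply Rinv_0_lt_compat; lra|].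
      apply Rinv_le_contravar; lra. }
    lra. }
destruct N as [|N].
- rewrite sum_O. unfold near_weight. destruct (le_dec 1 0); [lia|lra].
- specialize (H N). assert (0 < / INR (S N)) by (apply Rinv_0_lt_compat, lt_0_INR; lia). lra.
Qed.

Lemma ip_le_scale (a b : nat -> R) (t : R) : 0 <= t ->
  (forall k, Rabs (a k) <= t * Rabs (b k)) -> l2 b -> l2 a /\ ip a a <= t ^ 2 * ip b b.
Proof.
intros Ht H Hb.
assert (Ha : l2 a).
{ apply l2_le with (fun k => t * b k).
  - intros k. rewrite Rabs_mult, (Rabs_pos_eq t); auto.
  - apply ex_series_ext with (fun k => t ^ 2 * b k ^ 2).
    + intros k. change (@eq R (t ^ 2 * b k ^ 2) ((t * b k) ^ 2)). ring.
    + exact (ex_series_scal_l (t ^ 2) _ Hb). }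
split; auto. unfold ip. rewrite <- Series_scal_l. apply Series_le.
- intros k. split; [nra|]. specialize (H k).
  pose proof (pow_incr _ _ 2 (conj (Rabs_pos (a k)) H)) as H2.
  rewrite Rpow_mult_distr, !pow2_abs in H2. lra.
- exact (ex_series_scal_l (t ^ 2) _ (l2_mul b b Hb Hb)).
Qed.

(** * An eigenvector with eigenvalue close to an integer *)

Section Location.

Variables (g delta Delta x kappa : R) (n M : nat) (u : nat -> R).
Hypothesis u_l2 : l2 u.
Hypothesis u_norm : ip u u = 1.
Hypothesis u_eig : eigvec g delta (x - g ^ 2) u.
Hypothesis delta_le : Rabs delta <= Delta.
Hypothesis x_near : Rabs (x - INR n) <= 1 / 2.
Hypothesis kappa_ge0 : 0 <= kappa.
Hypothesis M_ge1 : (1 <= M)%nat.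
Hypothesis parity_le : forall j l, (idist n j <= M)%nat -> (idist n l <= M)%nat ->
  Rabs (parity g j l) <= kappa.

Let c := coef g u.
Let p := coef g (alt u).
Let q (l : nat) : R := INR (idist n l) * c l.
Let wn (l : nat) : R := near_weight M (idist n l).
Let wf (l : nat) : R := far_weight M (idist n l).

(** Bound for the coefficients of [alt u] up to distance [M]. The terms are the shares of the
    central coefficient (at most 1), of the near ones (weights of norm at most 2 against [2 Delta])
    and of the far ones. *)
Definition near_bound : R := kappa + 4 * Delta * kappa + 2 * Delta / INR M.

Lemma Delta_ge0 : 0 <= Delta.
Proof. apply Rle_trans with (2 := delta_le). apply Rabs_pos. Qed.

Lemma M_pos : 0 < INR M.
Proof. apply lt_0_INR. lia. Qed.

Lemma center_coef_l2 : l2 c. Proof. now apply coef_l2. Qed.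

Lemma alt_coef_l2 : l2 p. Proof. now apply coef_l2, alt_l2. Qed.

Lemma coef_norm : ip c c = 1.
Proof. unfold c. now rewrite coef_parseval. Qed.

Lemma alt_coef_norm : ip p p = 1.
Proof. unfold p. rewrite coef_parseval; auto using alt_l2. now rewrite ip_alt_alt. Qed.

(** As [x] is within 1/2 of [n], its distance to any other integer [l] is at least half of the
    distance from [n] to [l]; [eigvec_coef] then bounds the coefficient. *)
Lemma weighted_coef_le (l : nat) : Rabs (q l) <= 2 * Delta * Rabs (p l).
Proof.
pose proof Delta_ge0 as HD.
unfold q. rewrite Rabs_mult, (Rabs_pos_eq (INR _)) by apply pos_INR.
destruct (Nat.eq_dec (idist n l) 0) as [E|E].
- rewrite E. simpl. rewrite Rmult_0_l. pose proof (Rabs_pos (p l)). nra.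
- assert (H1 : 1 <= INR (idist n l)) by (apply (le_INR 1); lia).
  pose proof (eigvec_coef g delta x u l u_l2 u_eig) as H. fold c p in H.
  apply (f_equal Rabs) in H. rewrite !Rabs_mult in H.
  assert (H2 : INR (idist n l) <= 2 * Rabs (x - INR l)).
  { rewrite INR_idist in *.
    pose proof (Rabs_triang (INR l - x) (x - INR n)) as Ht.
    replace (INR l - x + (x - INR n)) with (INR l - INR n) in Ht by ring.
    rewrite (Rabs_minus_sym (INR l) x) in Ht. lra. }
  apply Rle_trans with (2 * (Rabs (x - INR l) * Rabs (c l))).
  + pose proof (Rabs_pos (c l)). nra.
  + rewrite H. pose proof (Rabs_pos (p l)). nra.
Qed.

Lemma weighted_coef_l2 : l2 q /\ ip q q <= (2 * Delta) ^ 2.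
Proof.
pose proof Delta_ge0.
destruct (ip_le_scale q p (2 * Delta)) as [H1 H2]; auto using weighted_coef_le, alt_coef_l2; [lra|].
rewrite alt_coef_norm in H2. split; auto. lra.
Qed.

Lemma coef_split (l : nat) : c l = c n * kron n l + wn l * q l + wf l * q l.
Proof.
unfold wn, wf, q, near_weight, far_weight.
destruct (Nat.eq_dec n l) as [<-|E].
- rewrite kron_same. replace (idist n n) with O by (unfold idist; lia). simpl. ring.
- rewrite kron_diff by auto.
  assert (Hd : (1 <= idist n l)%nat) by (unfold idist; lia).
  assert (0 < INR (idist n l)) by (apply lt_0_INR; lia).
  destruct (le_dec 1 (idist n l)); [|lia].
  destruct (le_dec (idist n l) M); field; lra.
Qed.

Lemma near_weights_sqr_sum (L : nat) : sum_n (fun l => wn l ^ 2) L <= 2 * 2.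
Proof.
apply (sum_n_idist_le (fun k => near_weight M k ^ 2)).
- intros k. apply pow2_ge_0.
- unfold near_weight. destruct (le_dec 1 0); [lia|]. ring.
- intros N. apply near_weight_sqr_sum.
Qed.

Lemma near_weights_sum (L : nat) : sum_n wn L <= 2 * (1 + ln (INR M)).
Proof.
apply (sum_n_idist_le (near_weight M)).
- apply near_weight_ge0.
- unfold near_weight. now destruct (le_dec 1 0); [lia|].
- intros N. now apply near_weight_sum.
Qed.

Lemma near_weights_l2 : l2 wn /\ ip wn wn <= 4.
Proof.
assert (H : l2 wn).
{ apply ex_series_bounded with (2 * 2); [intros; apply pow2_ge_0|apply near_weights_sqr_sum]. }
split; auto. unfold ip. rewrite (Series_ext _ (fun l => wn l ^ 2)) by (intros; ring).
apply Series_le_bound; auto. intros N. pose proof (near_weights_sqr_sum N). lra.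
Qed.

Lemma ip_kron (a : nat -> R) (k : nat) : l2 a -> ip a (kron k) = a k.
Proof.
intros Ha. unfold ip. apply is_series_unique.
change (is_lim_seq (sum_n (fun l => a l * kron k l)) (a k)).
apply is_lim_seq_ext_loc with (fun _ => a k); [|apply is_lim_seq_const].
exists k. intros N HN.
assert (Hz : forall m, (m < k)%nat -> sum_n (fun l => a l * kron k l) m = 0).
{ induction m as [|m IH]; intros Hm.
  - rewrite sum_O, kron_diff by lia. apply Rmult_0_r.
  - rewrite sum_Sn, IH, kron_diff by lia.
    change (@eq R (0 + a (S m) * 0) 0). ring. }
induction HN as [|N HN IH].
- destruct k as [|k]; [rewrite sum_O, kron_same; symmetry; apply Rmult_1_r|].
  rewrite sum_Sn, Hz, kron_same by lia. change (@eq R (a (S k)) (0 + a (S k) * 1)). ring.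
- rewrite sum_Sn, <- IH, kron_diff by lia. change (@eq R (a k) (a k + a (S N) * 0)). ring.
Qed.

Lemma kron_l2 (k : nat) : l2 (kron k).
Proof.
apply (ex_series_ext (V := R_NormedModule) (fun l => kron k l)).
{ intros l. unfold kron. change (@eq R (if Nat.eq_dec k l then 1 else 0) ((if Nat.eq_dec k l then 1 else 0) ^ 2)).
  destruct (Nat.eq_dec k l); ring. }
apply ex_series_bounded with 1.
- intros l. unfold kron. destruct (Nat.eq_dec k l); lra.
- intros N.
  assert (H : sum_n (kron k) N = if le_dec k N then 1 else 0).
  { induction N as [|N IH].
    - rewrite sum_O. unfold kron. destruct (Nat.eq_dec k 0), (le_dec k 0); lia || auto.
    - rewrite sum_Sn, IH. unfold plus; simpl. unfold kron.
      destruct (Nat.eq_dec k (S N)), (le_dec k N), (le_dec k (S N)); lia || ring. }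
  change (sum_n (kron k) N <= 1). rewrite H. destruct (le_dec k N); lra.
Qed.

Lemma near_weights_mul_l2 (a : nat -> R) (K : R) : 0 <= K ->
  (forall l, (idist n l <= M)%nat -> Rabs (a l) <= K) ->
  l2 (fun l => wn l * a l) /\ ip (fun l => wn l * a l) (fun l => wn l * a l) <= K ^ 2 * 4.
Proof.
intros HK Ha. destruct near_weights_l2 as [H1 H2].
destruct (ip_le_scale (fun l => wn l * a l) wn K) as [H3 H4]; auto.
- intros l. rewrite Rabs_mult, Rmult_comm.
  destruct (le_dec (idist n l) M) as [Hl|Hl].
  + apply Rmult_le_compat_r; auto using Rabs_pos.
  + unfold wn, near_weight. destruct (le_dec 1 (idist n l)), (le_dec (idist n l) M); try lia;
    rewrite Rabs_R0; lra.
- split; auto. apply Rle_trans with (1 := H4). apply Rmult_le_compat_l; [apply pow2_ge_0|auto].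
Qed.

Lemma far_weights_mul_l2 (a : nat -> R) : l2 a ->
  l2 (fun l => wf l * a l) /\ ip (fun l => wf l * a l) (fun l => wf l * a l) <= (/ INR M) ^ 2 * ip a a.
Proof.
intros Ha. apply ip_le_scale; auto.
- left. apply Rinv_0_lt_compat, M_pos.
- intros l. destruct (far_weight_bounds M (idist n l) M_ge1) as [H1 H2].
  rewrite Rabs_mult, (Rabs_pos_eq (wf l)) by exact H1.
  apply Rmult_le_compat_r; auto using Rabs_pos.
Qed.

Lemma ip_parity_split (j : nat) : (idist n j <= M)%nat ->
  p j = c n * parity g j n + ip (fun l => wn l * parity g j l) q
        + ip (fun l => wf l * parity g j l) q.
Proof.
intros Hj. unfold p. rewrite coef_alt by auto. fold c.
destruct weighted_coef_l2 as [Hq _].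
destruct (near_weights_mul_l2 (parity g j) kappa) as [H1 _]; auto.
destruct (far_weights_mul_l2 (parity g j) (parity_l2 g j)) as [H2 _].
rewrite <- (ip_kron (parity g j) n (parity_l2 g j)).
unfold ip. rewrite <- Series_scal_l.
pose proof (l2_mul _ _ (parity_l2 g j) (kron_l2 n)) as E1.
pose proof (l2_mul _ _ H1 Hq) as E2. pose proof (l2_mul _ _ H2 Hq) as E3.
rewrite <- Series_plus; [|exact (ex_series_scal_l (c n) _ E1)|exact E2].
rewrite <- Series_plus;
  [|exact (ex_series_plus _ _ (ex_series_scal_l (c n) _ E1) E2)|exact E3].
apply Series_ext. intros l. rewrite (coef_split l) at 1. ring.
Qed.

Lemma far_part_le (j : nat) : Rabs (ip (fun l => wf l * parity g j l) q) <= 2 * Delta / INR M.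
Proof.
pose proof Delta_ge0 as HD. pose proof M_pos as HM.
destruct weighted_coef_l2 as [Hq Hq2].
destruct (far_weights_mul_l2 (parity g j) (parity_l2 g j)) as [H2 H3].
rewrite parity_norm in H3.
replace (2 * Delta / INR M) with (/ INR M * (2 * Delta)) by (field; lra).
apply cauchy_schwarz_abs; auto; [left; now apply Rinv_0_lt_compat|lra|lra].
Qed.

(** First pass: the coefficients enter only through their norm, by Cauchy-Schwarz, and the small
    entries of [parity] give one factor [kappa]. *)
Lemma alt_coef_near_le (j : nat) : (idist n j <= M)%nat -> Rabs (p j) <= near_bound.
Proof.
intros Hj. rewrite ip_parity_split by auto.
pose proof Delta_ge0 as HD.
destruct weighted_coef_l2 as [Hq Hq2].
destruct (near_weights_mul_l2 (parity g j) kappa) as [H1 H2]; auto.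
assert (E1 : Rabs (c n * parity g j n) <= kappa).
{ rewrite Rabs_mult. rewrite <- (Rmult_1_l kappa).
  apply Rmult_le_compat; try apply Rabs_pos.
  - pose proof (sqr_le_ip c n center_coef_l2) as H. rewrite coef_norm in H.
    apply Rabs_le. nra.
  - apply parity_le; auto. unfold idist; lia. }
assert (E2 : Rabs (ip (fun l => wn l * parity g j l) q) <= 4 * Delta * kappa).
{ replace (4 * Delta * kappa) with (2 * kappa * (2 * Delta)) by ring.
  apply cauchy_schwarz_abs; auto; lra. }
pose proof (far_part_le j) as E3. unfold near_bound.
apply Rle_trans with (1 := Rabs_triang _ _).
pose proof (Rabs_triang (c n * parity g j n) (ip (fun l => wn l * parity g j l) q)). lra.
Qed.

Lemma near_bound_ge0 : 0 <= near_bound.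
Proof.
apply Rle_trans with (2 := alt_coef_near_le n ltac:(unfold idist; lia)). apply Rabs_pos.
Qed.

(** Second pass: the bound of the first pass now holds for each near coefficient, so the near sum is
    estimated term by term. This yields [kappa * near_bound] times the sum of the weights. *)
Lemma alt_coef_center : Rabs (p n - parity g n n * c n)
  <= 4 * Delta * kappa * near_bound * (1 + ln (INR M)) + 2 * Delta / INR M.
Proof.
assert (Hn : (idist n n <= M)%nat) by (unfold idist; lia).
rewrite ip_parity_split by auto.
pose proof Delta_ge0 as HD. pose proof near_bound_ge0 as Hb.
replace (c n * parity g n n + ip (fun l => wn l * parity g n l) q
  + ip (fun l => wf l * parity g n l) q - parity g n n * c n)
  with (ip (fun l => wn l * parity g n l) q + ip (fun l => wf l * parity g n l) q) by ring.
apply Rle_trans with (1 := Rabs_triang _ _).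
apply Rplus_le_compat; [|apply far_part_le].
set (K := 2 * Delta * kappa * near_bound).
assert (HK : 0 <= K) by (unfold K; repeat apply Rmult_le_pos; lra).
assert (Hex : ex_series wn).
{ apply ex_series_bounded with (2 * (1 + ln (INR M))).
  - intros l. apply near_weight_ge0.
  - apply near_weights_sum. }
assert (Hterm : forall l, Rabs (wn l * parity g n l * q l) <= K * wn l).
{ intros l. rewrite !Rabs_mult.
  assert (Hw : 0 <= wn l) by apply near_weight_ge0.
  rewrite (Rabs_pos_eq (wn l)) by auto.
  destruct (le_dec (idist n l) M) as [Hl|Hl].
  - rewrite Rmult_assoc, (Rmult_comm K). apply Rmult_le_compat_l; auto.
    unfold K. replace (2 * Delta * kappa * near_bound) with (kappa * (2 * Delta * near_bound)) by ring.
    apply Rmult_le_compat; auto using Rabs_pos.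
    apply Rle_trans with (1 := weighted_coef_le l). apply Rmult_le_compat_l; [lra|]. now apply alt_coef_near_le.
  - unfold wn, near_weight. destruct (le_dec 1 (idist n l)), (le_dec (idist n l) M); try lia; lra. }
assert (Habs : ex_series (fun l => Rabs (wn l * parity g n l * q l))).
{ apply (ex_series_le (K := R_AbsRing) (V := R_CompleteNormedModule) _ (fun l => K * wn l)).
  - intros l. change (Rabs (Rabs (wn l * parity g n l * q l)) <= K * wn l).
    rewrite Rabs_Rabsolu. apply Hterm.
  - exact (ex_series_scal_l K _ Hex). }
unfold ip. apply Rle_trans with (1 := Series_Rabs _ Habs).
apply Rle_trans with (Series (fun l => K * wn l)).
- apply Series_le; [intros l; split; [apply Rabs_pos|apply Hterm]|].
  exact (ex_series_scal_l K _ Hex).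
- rewrite Series_scal_l.
  replace (4 * Delta * kappa * near_bound * (1 + ln (INR M)))
    with (K * (2 * (1 + ln (INR M)))) by (unfold K; ring).
  apply Rmult_le_compat_l; auto. apply Series_le_bound; auto. apply near_weights_sum.
Qed.

(** The three pieces of [coef_split] have disjoint supports, so their squared norms add up to 1; the
    near piece is bounded by the first pass, the far piece by [1 / M]. *)
Lemma coef_center_large : 1 - c n ^ 2 <= 16 * Delta ^ 2 * near_bound ^ 2 + 4 * Delta ^ 2 / INR M ^ 2.
Proof.
pose proof Delta_ge0 as HD. pose proof near_bound_ge0 as Hb. pose proof M_pos as HM.
destruct weighted_coef_l2 as [Hq Hq2].
destruct (near_weights_mul_l2 q (2 * Delta * near_bound)) as [H1 H2].
{ apply Rmult_le_pos; lra. }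
{ intros l Hl. apply Rle_trans with (1 := weighted_coef_le l). apply Rmult_le_compat_l; [lra|]. now apply alt_coef_near_le. }
destruct (far_weights_mul_l2 q Hq) as [H3 H4].
assert (E : ip c c = c n ^ 2 * ip (kron n) (kron n) + ip (fun l => wn l * q l) (fun l => wn l * q l)
   + ip (fun l => wf l * q l) (fun l => wf l * q l)).
{ unfold ip. rewrite <- Series_scal_l.
  pose proof (l2_mul _ _ (kron_l2 n) (kron_l2 n)) as E1.
  pose proof (l2_mul _ _ H1 H1) as E2. pose proof (l2_mul _ _ H3 H3) as E3.
  rewrite <- Series_plus; [|exact (ex_series_scal_l (c n ^ 2) _ E1)|exact E2].
  rewrite <- Series_plus;
    [|exact (ex_series_plus _ _ (ex_series_scal_l (c n ^ 2) _ E1) E2)|exact E3].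
  apply Series_ext. intros l. rewrite (coef_split l).
  assert (Z1 : kron n l * q l = 0).
  { destruct (Nat.eq_dec n l) as [<-|El]; [|rewrite kron_diff by auto; ring].
    unfold q. replace (idist n n) with O by (unfold idist; lia). simpl. ring. }
  assert (Z2 : wn l * wf l = 0).
  { unfold wn, wf, near_weight, far_weight.
    destruct (le_dec 1 (idist n l)), (le_dec (idist n l) M); ring. }
  transitivity (c n ^ 2 * (kron n l * kron n l) + wn l * q l * (wn l * q l) + wf l * q l * (wf l * q l)
    + 2 * c n * (wn l + wf l) * (kron n l * q l) + 2 * (wn l * wf l) * q l ^ 2); [ring|].
  rewrite Z1, Z2. ring. }
rewrite coef_norm, (ip_kron (kron n) n (kron_l2 n)), kron_same in E.
assert (E5 : (/ INR M) ^ 2 * ip q q <= 4 * Delta ^ 2 / INR M ^ 2).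
{ replace (4 * Delta ^ 2 / INR M ^ 2) with ((/ INR M) ^ 2 * (2 * Delta) ^ 2) by (field; lra).
  apply Rmult_le_compat_l; auto. apply pow2_ge_0. }
nra.
Qed.

Lemma location : Rabs ((x - INR n - delta * parity g n n) * c n)
  <= Delta * (4 * Delta * kappa * near_bound * (1 + ln (INR M)) + 2 * Delta / INR M).
Proof.
pose proof (eigvec_coef g delta x u n u_l2 u_eig) as H. fold c p in H.
replace ((x - INR n - delta * parity g n n) * c n) with (delta * (p n - parity g n n * c n)) by lra.
rewrite Rabs_mult. apply Rmult_le_compat; auto using Rabs_pos, alt_coef_center.
Qed.

End Location.

(** [delta] carries a sign: the two parity classes are [delta = Delta] and [delta = - Delta], and
    the values in between serve the homotopy. *)
Definition spec (g delta x : R) : Prop :=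
  exists u, l2 u /\ ip u u = 1 /\ eigvec g delta (x - g ^ 2) u.

Lemma spec_intro (g delta x : R) (u : nat -> R) (k : nat) :
  l2 u -> u k <> 0 -> eigvec g delta (x - g ^ 2) u -> spec g delta x.
Proof.
intros Hu Hk He.
assert (Hpos : 0 < ip u u).
{ apply Rlt_le_trans with (2 := sqr_le_ip u k Hu). nra. }
set (t := / sqrt (ip u u)).
assert (Ht : t * t * ip u u = 1).
{ unfold t. rewrite <- (sqrt_sqrt (ip u u)) at 3 by lra. field.
  apply Rgt_not_eq. now apply sqrt_lt_R0. }
exists (fun k => t * u k). split; [|split].
- apply (ip_le_scale (fun k => t * u k) u (Rabs t)); auto using Rabs_pos.
  intros i. rewrite Rabs_mult. lra.
- rewrite ip_scal_l, ip_sym, ip_scal_l. lra.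
- intros i. specialize (He i).
  replace (raise (fun k => t * u k) i) with (t * raise u i)
    by (destruct i; rewrite ?raise_0, ?raise_S; ring).
  unfold lower in *. transitivity (t * ((x - g ^ 2) * u i)); [rewrite <- He|]; ring.
Qed.

Lemma shifted_spec_iff (Delta g : R) (s : bool) (x : R) :
  shifted_spec Delta g s x <-> spec g (sgn s * Delta) x.
Proof.
assert (Hrec : forall u k,
  (match k with S k' => rabi_off g k * u k' | O => 0 end) + rabi_diag Delta s k * u k
     + rabi_off g (S k) * u (S k)
   = g * raise u k + (INR k + (-1) ^ k * (sgn s * Delta)) * u k + g * lower u k).
{ intros u k. unfold rabi_off, rabi_diag, lower.
  destruct k as [|k]; rewrite ?raise_0, ?raise_S; ring. }
split.
- intros [u [[k Hk] [Hu He]]]. apply spec_intro with u k; auto.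
  intros i. rewrite <- Hrec. apply He.
- intros [u [Hu [H1 He]]]. exists u. split; [|split; auto].
  + apply not_all_not_ex. intros Hz.
    assert (Hz' : forall k, u k = 0) by (intros k; apply NNPP, Hz).
    unfold ip in H1. rewrite (Series_ext _ (fun k => 0 * u k)) in H1.
    * rewrite Series_scal_l in H1. lra.
    * intros k. rewrite Hz'. ring.
  + intros k. rewrite Hrec. apply He.
Qed.

(** If [x] is not a natural number, [eigvec_coef] makes all coefficients vanish, against
    Parseval. *)
Lemma spec_zero (g x : R) : spec g 0 x -> exists m : nat, x = INR m.
Proof.
intros [u [Hu [H1 He]]].
apply NNPP. intros Hn.
assert (Hz : forall m, coef g u m = 0).
{ intros m. pose proof (eigvec_coef g 0 x u m Hu He) as H. rewrite Rmult_0_l in H.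
  apply Rmult_integral in H. destruct H as [H|H]; auto.
  exfalso. apply Hn. exists m. lra. }
rewrite <- (coef_parseval g u u Hu Hu) in H1. unfold ip in H1.
rewrite (Series_ext _ (fun k => 0 * coef g u k)) in H1.
- rewrite Series_scal_l in H1. lra.
- intros k. rewrite Hz. ring.
Qed.

(** The usual symmetry argument, carried out on coefficients: there the unperturbed operator is
    diagonal and only the bounded symmetric [alt] has to be moved across. *)
Lemma eigvec_orth (g delta x y : R) (u w : nat -> R) : x <> y ->
  l2 u -> l2 w -> eigvec g delta (x - g ^ 2) u -> eigvec g delta (y - g ^ 2) w ->
  ip (coef g u) (coef g w) = 0.
Proof.
intros Hxy Hu Hw Heu Hew.
pose proof (coef_l2 g u Hu) as Cu. pose proof (coef_l2 g w Hw) as Cw.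
pose proof (coef_l2 g _ (alt_l2 u Hu)) as Pu. pose proof (coef_l2 g _ (alt_l2 w Hw)) as Pw.
apply Rmult_eq_reg_l with (x - y); [|lra]. rewrite Rmult_0_r.
transitivity (delta * ip (coef g (alt u)) (coef g w) - delta * ip (coef g u) (coef g (alt w))).
- unfold ip. rewrite <- !Series_scal_l, <- Series_minus.
  + apply Series_ext. intros m.
    pose proof (eigvec_coef g delta x u m Hu Heu) as E1.
    pose proof (eigvec_coef g delta y w m Hw Hew) as E2.
    transitivity ((x - INR m) * coef g u m * coef g w m - coef g u m * ((y - INR m) * coef g w m));
      [ring|].
    rewrite E1, E2. ring.
  + exact (ex_series_scal_l delta _ (l2_mul _ _ Pu Cw)).
  + exact (ex_series_scal_l delta _ (l2_mul _ _ Cu Pw)).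
- rewrite !coef_parseval; auto using alt_l2. rewrite ip_alt. ring.
Qed.

(** Both [a + b] and [a - b] have squared norm 2, which forces [a n * b n] to be at most 1/4 in
    absolute value, whereas the hypotheses make it at least 3/4. *)
Lemma ip_orth_impossible (a b : nat -> R) (n : nat) :
  l2 a -> l2 b -> ip a a = 1 -> ip b b = 1 -> ip a b = 0 ->
  3 / 4 <= a n ^ 2 -> 3 / 4 <= b n ^ 2 -> False.
Proof.
intros Ha Hb Naa Nbb Nab Han Hbn.
assert (H : forall t, t ^ 2 = 1 -> (a n + t * b n) ^ 2 <= 2).
{ intros t Ht.
  apply Rle_trans with (1 := sqr_le_ip (fun k => a k + t * b k) n (l2_axpy t a b Ha Hb)).
  rewrite ip_axpy2 by auto. rewrite Naa, Nbb, Nab. lra. }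
pose proof (H 1 ltac:(ring)) as Hp. pose proof (H (-1) ltac:(ring)) as Hm.
assert (Hab : (a n * b n) ^ 2 <= 1 / 16).
{ assert (-1 / 4 <= a n * b n <= 1 / 4) by nra. nra. }
assert (9 / 16 <= (a n * b n) ^ 2); [|lra].
rewrite Rpow_mult_distr. nra.
Qed.

(** With [M] of order [sqrt n] and [kappa] of order [n^(-1/4)], the near error [kappa^2 ln n] and
    the far error [1 / M] balance up to the logarithm. The central coefficient is bounded below, so
    it can be divided out of [location]. *)
Lemma localization (g Delta : R) : 0 < g -> 0 <= Delta -> exists B T, 0 < B /\ 0 < T /\
  forall n : nat, T <= sqrt (INR n) ->
  forall delta x u, Rabs delta <= Delta -> Rabs (x - INR n) <= 1 / 2 ->
    l2 u -> ip u u = 1 -> eigvec g delta (x - g ^ 2) u ->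
    3 / 4 <= coef g u n ^ 2 /\
    Rabs (x - INR n - delta * parity g n n) <= B * (1 + ln (INR n)) / sqrt (INR n).
Proof.
intros Hg HD.
destruct (parity_small g Hg) as [c [C [T0 [Hc [HC [HT0 Hsmall]]]]]].
set (P := 1 + 4 * Delta + 8 * Delta / (c * C)).
assert (HP : 1 <= P).
{ unfold P. assert (0 <= 8 * Delta / (c * C)) by (apply Rdiv_le_0_compat; nra). lra. }
set (Q := 32 * C * Delta ^ 2 * P ^ 2 + 256 * Delta ^ 2 / c ^ 2).
assert (HQ : 0 <= Q).
{ unfold Q. assert (0 <= 256 * Delta ^ 2 / c ^ 2) by (apply Rdiv_le_0_compat; nra).
  assert (0 <= C * Delta ^ 2 * P ^ 2) by (repeat apply Rmult_le_pos; nra). lra. }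
set (B := 2 * (Delta ^ 2 * (8 * C * P + 16 / c)) + 1).
assert (H16 : 0 < 16 / c) by (apply Rdiv_lt_0_compat; lra).
assert (HB0 : 0 <= Delta ^ 2 * (8 * C * P + 16 / c)) by (apply Rmult_le_pos; nra).
set (T := 2 * T0 + c + 8 / c + 2 * C + 4 * Q + 1).
assert (H8 : 0 < 8 / c) by (apply Rdiv_lt_0_compat; lra).
exists B, T. split; [unfold B; lra|]. split; [unfold T; lra|].
intros n HT delta x u Hdelta Hx Hu Hn He.
set (s := sqrt (INR n)) in *.
assert (Hs : INR n = s * s) by (symmetry; apply sqrt_INR_sqr).
assert (Hs1 : 1 <= s) by (unfold T in HT; lra).
assert (Hs2 : c <= s) by (unfold T in HT; lra).
(* Two indices within [M] of [n] differ by at most [c * s / 2], and the square root of each is at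
   least [s / 2]: hence [c / 4] here, and the factor 2 in [kappa] when [parity_small] is applied. *)
destruct (nfloor_ex (c / 4 * s)) as [M HM]; [nra|].
assert (Hcs : 8 <= c * s).
{ apply Rle_trans with (c * (8 / c)); [right; field; lra|].
  apply Rmult_le_compat_l; unfold T in HT; lra. }
assert (HM8 : c / 8 * s <= INR M) by lra.
assert (HM1 : (1 <= M)%nat) by (apply INR_le; simpl; lra).
assert (HM0 : 0 < INR M) by lra.
assert (HMn : INR M <= INR n) by (rewrite Hs; nra).
set (kappa := sqrt (2 * C / s)).
assert (Hk2 : kappa * kappa = 2 * C / s).
{ apply sqrt_sqrt. apply Rdiv_le_0_compat; lra. }
assert (Hk0 : 0 <= kappa) by apply sqrt_pos.
assert (Hk1 : kappa <= 1).
{ rewrite <- sqrt_1. apply sqrt_le_1_alt. apply Rmult_le_reg_r with s; [lra|].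
  unfold Rdiv. rewrite Rmult_assoc, Rinv_l by lra. unfold T in HT; lra. }
assert (Hsk : 1 / s <= kappa / (2 * C)).
{ replace (1 / s) with (kappa * kappa / (2 * C)) by (rewrite Hk2; field; lra).
  unfold Rdiv. apply Rmult_le_compat_r; [left; apply Rinv_0_lt_compat; lra|nra]. }
assert (HMinv : / INR M <= 8 / c * (1 / s)).
{ replace (8 / c * (1 / s)) with (/ (c / 8 * s)) by (field; lra).
  apply Rinv_le_contravar; [nra|auto]. }
assert (Hpar : forall j l, (idist n j <= M)%nat -> (idist n l <= M)%nat -> Rabs (parity g j l) <= kappa).
{ intros j l Hj Hl. apply le_INR in Hj. apply le_INR in Hl. rewrite INR_idist in Hj, Hl.
  apply Rabs_le_between in Hj. apply Rabs_le_between in Hl.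
  assert (Hj4 : s / 2 <= sqrt (INR j)).
  { rewrite <- (sqrt_square (s / 2)) by lra. apply sqrt_le_1_alt. nra. }
  assert (H : parity g j l ^ 2 <= C / sqrt (INR j)).
  { apply Hsmall; [unfold T in HT; lra|]. apply Rabs_le. nra. }
  apply Rsqr_incr_0_var; auto. rewrite <- Rsqr_abs. unfold Rsqr. rewrite Hk2.
  apply Rle_trans with (C / sqrt (INR j)); [nra|].
  replace (2 * C / s) with (C * / (s / 2)) by (field; lra).
  apply Rmult_le_compat_l; [lra|]. apply Rinv_le_contravar; lra. }
assert (Hnb : 0 <= near_bound Delta kappa M <= kappa * P).
{ split; [eapply near_bound_ge0; eauto|].
  unfold near_bound, P.
  assert (2 * Delta / INR M <= kappa * (8 * Delta / (c * C))); [|lra].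
  apply Rle_trans with (2 * Delta * (8 / c * (kappa / (2 * C)))).
  - apply Rmult_le_compat_l; [lra|]. apply Rle_trans with (1 := HMinv).
    apply Rmult_le_compat_l; lra.
  - right. field. lra. }
set (nb := near_bound Delta kappa M) in *.
assert (Hcm : 1 - coef g u n ^ 2 <= 16 * Delta ^ 2 * nb ^ 2 + 4 * Delta ^ 2 / INR M ^ 2)
  by (eapply coef_center_large; eauto).
assert (Hloc : Rabs ((x - INR n - delta * parity g n n) * coef g u n)
  <= Delta * (4 * Delta * kappa * nb * (1 + ln (INR M)) + 2 * Delta / INR M))
  by (eapply location; eauto).
assert (Hnb2 : nb ^ 2 <= 2 * C / s * P ^ 2).
{ rewrite <- Hk2. replace (kappa * kappa * P ^ 2) with ((kappa * P) ^ 2) by ring.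
  apply pow_incr. auto. }
assert (HM2 : / INR M ^ 2 <= 64 / c ^ 2 * (1 / s)).
{ apply Rle_trans with ((8 / c * (1 / s)) ^ 2).
  - rewrite <- pow_inv. apply pow_incr. split; auto. left. now apply Rinv_0_lt_compat.
  - replace ((8 / c * (1 / s)) ^ 2) with (64 / c ^ 2 * (1 / s * (1 / s))) by (field; lra).
    apply Rmult_le_compat_l; [apply Rdiv_le_0_compat; nra|].
    assert (0 < 1 / s <= 1).
    { split; [apply Rdiv_lt_0_compat; lra|]. unfold Rdiv. rewrite Rmult_1_l, <- Rinv_1.
      apply Rinv_le_contravar; lra. }
    nra. }
assert (Hc34 : 3 / 4 <= coef g u n ^ 2).
{ assert (1 - coef g u n ^ 2 <= Q / s).
  { apply Rle_trans with (1 := Hcm).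
    replace (Q / s) with (16 * Delta ^ 2 * (2 * C / s * P ^ 2) + 4 * Delta ^ 2 * (64 / c ^ 2 * (1 / s)))
      by (unfold Q; field; lra).
    apply Rplus_le_compat; apply Rmult_le_compat_l; nra. }
  assert (Q / s <= 1 / 4).
  { apply Rmult_le_reg_r with s; [lra|]. unfold Rdiv at 1. rewrite Rmult_assoc, Rinv_l by lra.
    unfold T in HT. lra. }
  lra. }
split; auto.
assert (HlnM : 0 <= ln (INR M) <= ln (INR n)).
{ assert (1 <= INR M) by (apply (le_INR 1); auto).
  split.
  - rewrite <- ln_1. apply ln_le; lra.
  - apply ln_le; lra. }
set (y := x - INR n - delta * parity g n n) in *.
assert (Hy : Rabs y <= 2 * Rabs (y * coef g u n)).
{ rewrite Rabs_mult. assert (1 / 2 <= Rabs (coef g u n)).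
  { apply Rsqr_incr_0_var; [|apply Rabs_pos]. rewrite <- Rsqr_abs. unfold Rsqr. nra. }
  pose proof (Rabs_pos y). nra. }
apply Rle_trans with (1 := Hy).
apply Rle_trans with (2 * (Delta ^ 2 * (8 * C * P + 16 / c)) * (1 + ln (INR n)) / s).
- apply Rle_trans with (2 * (Delta * (4 * Delta * kappa * nb * (1 + ln (INR M)) + 2 * Delta / INR M))).
  { lra. }
  assert (E1 : kappa * nb * (1 + ln (INR M)) <= 2 * C / s * P * (1 + ln (INR n))).
  { apply Rmult_le_compat; try lra; [apply Rmult_le_pos; lra|].
    rewrite <- Hk2. replace (kappa * kappa * P) with (kappa * (kappa * P)) by ring.
    apply Rmult_le_compat_l; lra. }
  assert (E2 : / INR M <= 8 / c * (1 / s) * (1 + ln (INR n))).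
  { apply Rle_trans with (1 := HMinv).
    rewrite <- (Rmult_1_r (8 / c * (1 / s))) at 1. apply Rmult_le_compat_l; [|lra].
    apply Rmult_le_pos; [lra|]. apply Rdiv_le_0_compat; lra. }
  replace (2 * (Delta ^ 2 * (8 * C * P + 16 / c)) * (1 + ln (INR n)) / s)
    with (2 * (Delta * (4 * Delta * (2 * C / s * P * (1 + ln (INR n)))
            + 2 * Delta * (8 / c * (1 / s) * (1 + ln (INR n)))))) by (field; lra).
  apply Rmult_le_compat_l; [lra|]. apply Rmult_le_compat_l; [lra|].
  apply Rplus_le_compat.
  + replace (4 * Delta * kappa * nb * (1 + ln (INR M)))
      with (4 * Delta * (kappa * nb * (1 + ln (INR M)))) by ring.
    apply Rmult_le_compat_l; lra.
  + apply Rmult_le_compat_l; lra.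
- unfold Rdiv. apply Rmult_le_compat_r; [left; apply Rinv_0_lt_compat; lra|].
  apply Rmult_le_compat_r; unfold B; lra.
Qed.

Lemma spec_unique (g Delta : R) : 0 < g -> 0 <= Delta -> exists T, 0 < T /\
  forall n : nat, T <= sqrt (INR n) ->
  forall delta x y, Rabs delta <= Delta -> Rabs (x - INR n) <= 1 / 2 -> Rabs (y - INR n) <= 1 / 2 ->
    spec g delta x -> spec g delta y -> x = y.
Proof.
intros Hg HD.
destruct (localization g Delta Hg HD) as [B [T [_ [HT H]]]].
exists T. split; auto. intros n Hn delta x y Hd Hx Hy [u [Hu [Nu Eu]]] [w [Hw [Nw Ew]]].
apply NNPP. intros Hxy.
apply (ip_orth_impossible (coef g u) (coef g w) n); auto using coef_l2.
- now rewrite coef_parseval.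
- now rewrite coef_parseval.
- now apply (eigvec_orth g delta x y).
- now apply (H n Hn delta x u).
- now apply (H n Hn delta y w).
Qed.

(** * Existence of eigenvalues *)

(* With [gamma = g^2], the formal eigenvector has Bargmann transform
   [sum_k sol k * (- z / g)^k]; unlike the eigenvector it makes sense at [g = 0]. *)
Fixpoint sol (gamma delta x : R) (k : nat) : R :=
  match k with
  | O => 1
  | S k1 =>
    match k1 with
    | O => gamma - x + delta
    | S k0 => ((INR k1 - x + gamma + (-1) ^ k1 * delta) * sol gamma delta x k1
               - gamma * sol gamma delta x k0) / INR (S k1)
    end
  end.

Lemma sol_SS (gamma delta x : R) (k : nat) :
  INR (S (S k)) * sol gamma delta x (S (S k))
    = (INR (S k) - x + gamma + (-1) ^ (S k) * delta) * sol gamma delta x (S k)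
      - gamma * sol gamma delta x k.
Proof.
change (sol gamma delta x (S (S k)))
  with (((INR (S k) - x + gamma + (-1) ^ (S k) * delta) * sol gamma delta x (S k)
         - gamma * sol gamma delta x k) / INR (S (S k))).
field. apply not_0_INR. lia.
Qed.

Lemma sol_continuous (gamma delta x : R -> R) (k : nat) :
  continuity gamma -> continuity delta -> continuity x ->
  continuity (fun t => sol (gamma t) (delta t) (x t) k).
Proof.
intros Hg Hd Hx.
assert (H : continuity (fun t => sol (gamma t) (delta t) (x t) k) /\
            continuity (fun t => sol (gamma t) (delta t) (x t) (S k))); [|apply H].
induction k as [|k [IH1 IH2]].
- split; [apply continuity_const; now intros ? ?|].
  apply (continuity_plus (fun t => gamma t - x t) delta); auto. now apply continuity_minus.
- split; auto.
  apply (continuity_mult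
    (fun t => (INR (S k) - x t + gamma t + (-1) ^ (S k) * delta t) * sol (gamma t) (delta t) (x t) (S k)
         - gamma t * sol (gamma t) (delta t) (x t) k) (fun _ => / INR (S (S k)))).
  + apply (continuity_minus
      (fun t => (INR (S k) - x t + gamma t + (-1) ^ (S k) * delta t) * sol (gamma t) (delta t) (x t) (S k))
      (fun t => gamma t * sol (gamma t) (delta t) (x t) k)).
    * apply (continuity_mult (fun t => INR (S k) - x t + gamma t + (-1) ^ (S k) * delta t)
        (fun t => sol (gamma t) (delta t) (x t) (S k))); auto.
      apply (continuity_plus (fun t => INR (S k) - x t + gamma t) (fun t => (-1) ^ (S k) * delta t)).
      -- apply (continuity_plus (fun t => INR (S k) - x t) gamma); auto.
         apply (continuity_minus (fun _ => INR (S k)) x); auto.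
         apply continuity_const. now intros ? ?.
      -- apply (continuity_mult (fun _ => (-1) ^ (S k)) delta); auto.
         apply continuity_const. now intros ? ?.
    * now apply (continuity_mult gamma).
  + apply continuity_const. now intros ? ?.
Qed.

(** The monomial [z^k] has norm [sqrt (k!)] in Bargmann space; the factor passes from monomials in
    [- z / g] to normalised number states. *)
Definition eigen_of_sol (g delta x : R) (k : nat) : R :=
  (-1) ^ k * (sqrt (INR (fact k)) / g ^ k) * sol (g ^ 2) delta x k.

Lemma sqrt_fact_S (k : nat) : sqrt (INR (fact (S k))) = sqrt (INR (S k)) * sqrt (INR (fact k)).
Proof. rewrite fact_simpl, mult_INR. apply sqrt_mult; apply pos_INR. Qed.

Lemma eigen_of_sol_spec (g delta x : R) : 0 < g ->
  eigvec g delta (x - g ^ 2) (eigen_of_sol g delta x).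
Proof.
intros Hg k.
assert (Hgk : forall k, 0 < g ^ k) by (intros; now apply pow_lt).
assert (Hl : forall k, g * lower (eigen_of_sol g delta x) k
  = - ((-1) ^ k * (sqrt (INR (fact k)) / g ^ k)) * (INR (S k) * sol (g ^ 2) delta x (S k))).
{ intros i. unfold lower, eigen_of_sol. rewrite sqrt_fact_S, <- !tech_pow_Rmult.
  rewrite <- (sqrt_INR_sqr (S i)) at 3. specialize (Hgk i). field. lra. }
rewrite Hl. destruct k as [|k].
- rewrite raise_0. unfold eigen_of_sol. simpl. field.
- rewrite raise_S, sol_SS.
  assert (Hr : g * (sqrt (INR (S k)) * eigen_of_sol g delta x k)
    = - ((-1) ^ S k * (sqrt (INR (fact (S k))) / g ^ S k)) * (g ^ 2 * sol (g ^ 2) delta x k)).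
  { unfold eigen_of_sol. rewrite sqrt_fact_S, <- !tech_pow_Rmult. specialize (Hgk k). field. lra. }
  rewrite Hr. unfold eigen_of_sol. ring.
Qed.

Lemma l2_of_ratio (u : nat -> R) (k0 : nat) :
  (forall k, (k0 <= k)%nat -> Rabs (u (S k)) <= 1 / 2 * Rabs (u k)) -> l2 u.
Proof.
intros H.
apply (ex_series_incr_n _ k0).
assert (Hb : forall i, Rabs (u (k0 + i)%nat) <= Rabs (u k0) * (1 / 2) ^ i).
{ induction i as [|i IH]; [rewrite Nat.add_0_r; simpl; lra|].
  rewrite Nat.add_succ_r, <- tech_pow_Rmult.
  apply Rle_trans with (1 := H (k0 + i)%nat ltac:(lia)). lra. }
apply (ex_series_le (K := R_AbsRing) (V := R_CompleteNormedModule) _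
  (fun m => Rabs (u k0) ^ 2 * (1 / 4) ^ m)).
- intros m. change (Rabs (u (k0 + m)%nat ^ 2) <= Rabs (u k0) ^ 2 * (1 / 4) ^ m).
  rewrite <- RPow_abs.
  replace (Rabs (u k0) ^ 2 * (1 / 4) ^ m) with ((Rabs (u k0) * (1 / 2) ^ m) ^ 2).
  + apply pow_incr. split; auto using Rabs_pos.
  + rewrite Rpow_mult_distr, <- (pow_mult (1 / 2)), Nat.mul_comm, pow_mult.
    do 2 f_equal. field.
- apply (ex_series_scal_l (Rabs (u k0) ^ 2) (fun m => (1 / 4) ^ m)), ex_series_geom.
  rewrite Rabs_pos_eq; lra.
Qed.

(** * Growing solutions against eigenvectors *)

Section Cone.

Variables (G D X : R) (k0 : nat).
Hypothesis k0_large : 4 * (X + D) + 16 * G + 4 <= INR k0.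

(** A bounded box of parameters, so that a single [k0] serves along a whole path. *)
Definition admissible (gamma delta x : R) : Prop :=
  0 <= gamma <= G /\ Rabs delta <= D /\ Rabs x <= X.

(** [e] is the sign 1 or -1. For large [k] a growing solution has ratio near 1 and a decaying one
    has ratio near 0; the threshold 1/4 separates them. Two strict inequalities on finitely many
    terms also make the condition open in the parameters. *)
Definition cone (e gamma delta x : R) (k : nat) : Prop :=
  0 < e * sol gamma delta x k < 4 * (e * sol gamma delta x (S k)).

Definition dominant (e gamma delta x : R) : Prop :=
  exists k, (k0 <= k)%nat /\ cone e gamma delta x k.

(** The terms [4 (X + D)] and [16 G] of [k0_large] give the constants 3/4 and 1/16. The exact value
    of [r * (k + 2)] is recorded because the decay of [r] in [k] is used for recessive solutions. *)
Lemma sol_rec_bounds (gamma delta x : R) (k : nat) :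
  admissible gamma delta x -> (k0 <= k)%nat ->
  exists B r, 3 / 4 <= B /\ 0 <= r <= 1 / 16 /\ r * (INR k + 2) = gamma /\
    sol gamma delta x (S (S k)) = B * sol gamma delta x (S k) - r * sol gamma delta x k.
Proof.
intros [H1 [H2 H3]] Hk. apply le_INR in Hk.
pose proof (sol_SS gamma delta x k) as E.
assert (Hd : Rabs ((-1) ^ S k * delta) <= D) by (rewrite Rabs_mult, Rabs_pow_m1; lra).
rewrite (S_INR (S k)), S_INR in E.
set (d := (-1) ^ S k * delta) in *.
assert (HD := Rle_trans _ _ _ (Rabs_pos _) H2). assert (HX := Rle_trans _ _ _ (Rabs_pos _) H3).
apply Rabs_le_between in Hd. apply Rabs_le_between in H3.
assert (Hk2 : 0 < INR k + 2) by lra.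
exists ((INR k + 1 - x + gamma + d) / (INR k + 2)), (gamma / (INR k + 2)).
repeat split.
- apply Rmult_le_reg_r with (INR k + 2); auto. unfold Rdiv at 2. rewrite Rmult_assoc, Rinv_l; lra.
- apply Rdiv_le_0_compat; lra.
- apply Rmult_le_reg_r with (INR k + 2); auto. unfold Rdiv at 1. rewrite Rmult_assoc, Rinv_l; lra.
- field. lra.
- apply Rmult_eq_reg_l with (INR k + 2); [|lra].
  replace (INR k + 2) with (INR k + 1 + 1) at 1 by ring. rewrite E. field. lra.
Qed.

Lemma cone_S (e gamma delta x : R) (k : nat) :
  admissible gamma delta x -> (k0 <= k)%nat -> cone e gamma delta x k -> cone e gamma delta x (S k).
Proof.
intros Ha Hk [H1 H2]. unfold cone.
destruct (sol_rec_bounds gamma delta x k Ha Hk) as [B [r [HB [Hr [_ ->]]]]].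
set (a := sol gamma delta x k) in *. set (b := sol gamma delta x (S k)) in *.
replace (e * (B * b - r * a)) with (B * (e * b) - r * (e * a)) by ring. nra.
Qed.

Lemma cone_later (e gamma delta x : R) (k m : nat) :
  admissible gamma delta x -> (k0 <= k)%nat -> (k <= m)%nat ->
  cone e gamma delta x k -> cone e gamma delta x m.
Proof.
intros Ha Hk Hm Hc. induction Hm as [|m Hm IH]; auto. apply cone_S; auto. lia.
Qed.

Lemma dominant_excl (gamma delta x : R) : admissible gamma delta x ->
  dominant 1 gamma delta x -> dominant (-1) gamma delta x -> False.
Proof.
intros Ha [k [Hk Ck]] [m [Hm Cm]].
destruct (cone_later 1 gamma delta x k (Nat.max k m) Ha Hk ltac:(lia) Ck) as [H1 _].
destruct (cone_later (-1) gamma delta x m (Nat.max k m) Ha Hm ltac:(lia) Cm) as [H2 _].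
lra.
Qed.

(** If consecutive terms had opposite signs, or the ratio exceeded [2 r], the recurrence would put
    the next pair into one of the cones. *)
Lemma recessive_ratio (gamma delta x : R) : admissible gamma delta x ->
  ~ dominant 1 gamma delta x -> ~ dominant (-1) gamma delta x ->
  forall k, (k0 <= k)%nat ->
    Rabs (sol gamma delta x (S k)) * (INR k + 2) <= 2 * gamma * Rabs (sol gamma delta x k).
Proof.
intros Ha N1 N2 k Hk.
assert (Nk : forall m, (k0 <= m)%nat -> ~ cone 1 gamma delta x m /\ ~ cone (-1) gamma delta x m).
{ intros m Hm. split; intros C; [apply N1|apply N2]; now exists m. }
destruct (Nk k Hk) as [Np Nn]. destruct (Nk (S k) ltac:(lia)) as [Np' Nn'].
destruct (sol_rec_bounds gamma delta x k Ha Hk) as [B [r [HB [Hr [Hg E]]]]].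
unfold cone in *. rewrite E in *.
assert (Hk2 : 0 < INR k + 2) by (pose proof (pos_INR k); lra).
set (a := sol gamma delta x k) in *. set (b := sol gamma delta x (S k)) in *.
assert (Hab : Rabs b <= 2 * r * Rabs a); [|rewrite <- Hg; pose proof (Rabs_pos a); nra].
assert (Hpos : forall a b, 0 <= a ->
   ~ (0 < a < 4 * b) -> ~ (0 < b < 4 * (B * b - r * a)) -> ~ (0 < - b < 4 * - (B * b - r * a)) ->
   Rabs b <= 2 * r * a).
{ clear - HB Hr. intros a b Ha H1 H2 H3.
  destruct (Rlt_le_dec b 0) as [Hb|Hb].
  - exfalso. apply H3. nra.
  - rewrite Rabs_pos_eq by auto.
    destruct (Req_dec b 0) as [->|Hb0]; [nra|].
    apply Rnot_lt_le. intros Hlt. apply H2. nra. }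
destruct (Rle_lt_dec 0 a) as [H0|H0].
- rewrite (Rabs_pos_eq a) by auto. apply Hpos; auto; lra.
- rewrite (Rabs_left a) by auto. rewrite <- (Rabs_Ropp b).
  apply Hpos; lra.
Qed.

(** The factor in [eigen_of_sol] grows by [sqrt (k + 1) / g] per step, while [sol] shrinks by
    [2 g^2 / (k + 2)]. The product is at most 1/2 once [sqrt (k + 1) >= 4 g], which the term [16 G]
    of [k0_large] ensures. *)
Lemma recessive_spec (g delta x : R) : 0 < g -> admissible (g ^ 2) delta x ->
  ~ dominant 1 (g ^ 2) delta x -> ~ dominant (-1) (g ^ 2) delta x -> spec g delta x.
Proof.
intros Hg Ha N1 N2.
apply spec_intro with (eigen_of_sol g delta x) O.
- apply l2_of_ratio with k0. intros k Hk.
  pose proof (recessive_ratio (g ^ 2) delta x Ha N1 N2 k Hk) as H.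
  unfold eigen_of_sol. rewrite sqrt_fact_S, <- (tech_pow_Rmult g).
  assert (Hgk : 0 < g ^ k) by now apply pow_lt.
  assert (Hf : 0 <= sqrt (INR (fact k)) / g ^ k).
  { apply Rdiv_le_0_compat; auto. apply sqrt_pos. }
  set (w := sqrt (INR (fact k)) / g ^ k) in *.
  replace (sqrt (INR (S k)) * sqrt (INR (fact k)) / (g * g ^ k)) with (sqrt (INR (S k)) / g * w)
    by (unfold w; field; lra).
  assert (Hs : 0 <= sqrt (INR (S k)) / g).
  { apply Rdiv_le_0_compat; auto. apply sqrt_pos. }
  rewrite !Rabs_mult, !Rabs_pow_m1, (Rabs_pos_eq w), (Rabs_pos_eq (_ / _)) by auto.
  set (A := Rabs (sol (g ^ 2) delta x k)) in *. set (B := Rabs (sol (g ^ 2) delta x (S k))) in *.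
  assert (HA : 0 <= A) by apply Rabs_pos. assert (HB : 0 <= B) by apply Rabs_pos.
  assert (Hkey : sqrt (INR (S k)) / g * B <= 1 / 2 * A).
  { destruct Ha as [[_ Ha] [H2 H3]].
    assert (HD := Rle_trans _ _ _ (Rabs_pos _) H2). assert (HX := Rle_trans _ _ _ (Rabs_pos _) H3).
    apply le_INR in Hk.
    assert (Hq : 4 * g <= sqrt (INR (S k))).
    { rewrite <- (sqrt_square (4 * g)) by lra. apply sqrt_le_1_alt. rewrite S_INR. nra. }
    pose proof (sqrt_INR_sqr (S k)) as Es. pose proof (sqrt_INR_S_pos k) as Hp.
    rewrite S_INR in Es. rewrite S_INR in Hq, Hp. rewrite S_INR.
    set (q := sqrt (INR k + 1)) in *.
    assert (E1 : B * (q * q) <= 2 * g ^ 2 * A) by (rewrite Es; nra).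
    apply Rmult_le_reg_r with (g * q); [nra|].
    replace (q / g * B * (g * q)) with (B * (q * q)) by (field; lra).
    apply Rle_trans with (1 := E1).
    replace (1 / 2 * A * (g * q)) with (A * g / 2 * q) by field.
    replace (2 * g ^ 2 * A) with (A * g / 2 * (4 * g)) by field.
    apply Rmult_le_compat_l; auto. nra. }
  nra.
- unfold eigen_of_sol. simpl. rewrite sqrt_1. lra.
- now apply eigen_of_sol_spec.
Qed.

Lemma cone_open (gamma delta x : R -> R) (e t : R) (k : nat) :
  continuity gamma -> continuity delta -> continuity x ->
  cone e (gamma t) (delta t) (x t) k ->
  locally t (fun t => cone e (gamma t) (delta t) (x t) k).
Proof.
intros Hg Hd Hx [H1 H2].
assert (Hpos : forall f, continuity f -> 0 < f t -> locally t (fun t => 0 < f t)).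
{ intros f Hf Hft. specialize (Hf t). apply continuity_pt_filterlim in Hf.
  apply Hf. now apply (open_gt 0). }
pose proof (sol_continuous gamma delta x k Hg Hd Hx) as C0.
pose proof (sol_continuous gamma delta x (S k) Hg Hd Hx) as C1.
assert (Cs : forall f, continuity f -> forall r, continuity (fun t => r * f t)).
{ intros f Hf r. now apply (continuity_scal f). }
assert (L1 := Hpos _ (Cs _ C0 e) H1).
assert (L2 : locally t (fun t => 0 < 4 * e * sol (gamma t) (delta t) (x t) (S k)
    - e * sol (gamma t) (delta t) (x t) k)).
{ apply Hpos; [|lra].
  apply (continuity_minus (fun t => 4 * e * sol (gamma t) (delta t) (x t) (S k))
    (fun t => e * sol (gamma t) (delta t) (x t) k)); auto. }
generalize (filter_and _ _ L1 L2). apply filter_imp. intros y [Hy1 Hy2]. split; auto. lra.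
Qed.

(** Connectedness through the intermediate value theorem: the sign of dominance, as a function with
    values 1 and -1, is locally constant by [cone_open], hence continuous. *)
Lemma dominant_path (gamma delta x : R -> R) (a b : R) :
  continuity gamma -> continuity delta -> continuity x ->
  (forall t, admissible (gamma t) (delta t) (x t)) ->
  (forall t, dominant 1 (gamma t) (delta t) (x t) \/ dominant (-1) (gamma t) (delta t) (x t)) ->
  dominant 1 (gamma a) (delta a) (x a) -> dominant 1 (gamma b) (delta b) (x b).
Proof.
intros Hg Hd Hx Ha Hdom H0.
destruct (Hdom b) as [Hb|Hb]; auto. exfalso.
set (P := fun t => dominant 1 (gamma t) (delta t) (x t)).
set (f := fun t => if excluded_middle_informative (P t) then 1 else -1).
assert (Hf1 : forall t, P t -> f t = 1).
{ intros t Ht. unfold f. now destruct (excluded_middle_informative (P t)). }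
assert (Hf2 : forall t, dominant (-1) (gamma t) (delta t) (x t) -> f t = -1).
{ intros t Ht. unfold f. destruct (excluded_middle_informative (P t)) as [H|H]; auto.
  exfalso. now apply (dominant_excl _ _ _ (Ha t) H Ht). }
assert (Hloc : forall e t, dominant e (gamma t) (delta t) (x t) ->
  locally t (fun t => dominant e (gamma t) (delta t) (x t))).
{ intros e t [k [Hk C]]. generalize (cone_open gamma delta x e t k Hg Hd Hx C).
  apply filter_imp. intros y Hy. now exists k. }
assert (Hc : continuity f).
{ intros t. apply continuity_pt_filterlim.
  assert (Hl : locally t (fun s => f t = f s)).
  { destruct (Hdom t) as [Ht|Ht].
    - generalize (Hloc 1 t Ht). apply filter_imp. intros s Hs. now rewrite (Hf1 t), (Hf1 s).
    - generalize (Hloc (-1) t Ht). apply filter_imp. intros s Hs. now rewrite (Hf2 t), (Hf2 s). }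
  apply filterlim_ext_loc with (fun _ => f t); auto. apply filterlim_const. }
destruct (IVT_gen f a b 0 Hc) as [t [_ Ht]].
- rewrite (Hf1 a H0), (Hf2 b Hb). unfold Rmin, Rmax. destruct (Rle_dec 1 (-1)); lra.
- unfold f in Ht. destruct (excluded_middle_informative (P t)); lra.
Qed.

(** Continues a segment by constants to all real parameters, as [dominant_path] asks for continuity
    and admissibility on the whole line. *)
Definition clamp (t : R) : R := (1 + Rabs t - Rabs (t - 1)) / 2.

Lemma clamp_bounds (t : R) : 0 <= clamp t <= 1.
Proof. unfold clamp, Rabs. destruct (Rcase_abs t), (Rcase_abs (t - 1)); lra. Qed.

Lemma clamp_0 : clamp 0 = 0.
Proof. unfold clamp, Rabs. destruct (Rcase_abs 0), (Rcase_abs (0 - 1)); lra. Qed.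

Lemma clamp_1 : clamp 1 = 1.
Proof. unfold clamp, Rabs. destruct (Rcase_abs 1), (Rcase_abs (1 - 1)); lra. Qed.

Lemma clamp_continuous (a b : R) : continuity (fun t => a + clamp t * (b - a)).
Proof.
apply (continuity_plus (fun _ => a) (fun t => clamp t * (b - a))).
- apply continuity_const. now intros ? ?.
- apply (continuity_mult clamp (fun _ => b - a)).
  + apply (continuity_mult (fun t => 1 + Rabs t - Rabs (t - 1)) (fun _ => / 2)).
    * apply (continuity_minus (fun t => 1 + Rabs t) (fun t => Rabs (t - 1))).
      -- apply (continuity_plus (fun _ => 1) Rabs); [apply continuity_const; now intros ? ?|].
         apply Rcontinuity_abs.
      -- apply (continuity_comp (fun t => t - 1) Rabs); [|apply Rcontinuity_abs].
         apply (continuity_minus id (fun _ => 1)).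
         ++ apply derivable_continuous, derivable_id.
         ++ apply continuity_const. now intros ? ?.
    * apply continuity_const. now intros ? ?.
  + apply continuity_const. now intros ? ?.
Qed.

Lemma dominant_segment (ga gb da db xa xb : R) :
  (forall t, 0 <= t <= 1 ->
     admissible (ga + t * (gb - ga)) (da + t * (db - da)) (xa + t * (xb - xa)) /\
     (dominant 1 (ga + t * (gb - ga)) (da + t * (db - da)) (xa + t * (xb - xa)) \/
      dominant (-1) (ga + t * (gb - ga)) (da + t * (db - da)) (xa + t * (xb - xa)))) ->
  dominant 1 ga da xa <-> dominant 1 gb db xb.
Proof.
intros H.
assert (Hp : forall s t : R, dominant 1 (ga + clamp s * (gb - ga)) (da + clamp s * (db - da)) (xa + clamp s * (xb - xa))
  -> dominant 1 (ga + clamp t * (gb - ga)) (da + clamp t * (db - da)) (xa + clamp t * (xb - xa))).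
{ intros s t.
  apply (dominant_path (fun t => ga + clamp t * (gb - ga)) (fun t => da + clamp t * (db - da))
    (fun t => xa + clamp t * (xb - xa)));
  auto using clamp_continuous; intros r; apply H, clamp_bounds. }
pose proof (Hp 0 1) as H01. pose proof (Hp 1 0) as H10.
rewrite clamp_0, clamp_1, !Rmult_0_l, !Rmult_1_l, !Rplus_0_r in H01, H10.
replace (ga + (gb - ga)) with gb in * by ring. replace (da + (db - da)) with db in * by ring.
replace (xa + (xb - xa)) with xb in * by ring. tauto.
Qed.

End Cone.

(** * Opposite signs at consecutive half-integers, and existence *)

Lemma sol_zero (x : R) (k : nat) : INR (S k) * sol 0 0 x (S k) = (INR k - x) * sol 0 0 x k.
Proof.
destruct k as [|k]; [simpl; ring|]. rewrite sol_SS. ring.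
Qed.

(** For vanishing parameters [sol] lists the Taylor coefficients of [(1 - z)^x], and this is the
    derivative rule for the exponent [x + 1]. The factor [- (x + 1)] is the source of the sign
    flip. *)
Lemma sol_zero_shift (x : R) (k : nat) :
  INR (S k) * sol 0 0 (x + 1) (S k) = - (x + 1) * sol 0 0 x k.
Proof.
induction k as [|k IH]; [simpl; ring|].
rewrite sol_zero.
assert (Hk : INR (S k) <> 0) by (apply not_0_INR; lia).
apply Rmult_eq_reg_l with (INR (S k)); auto.
transitivity ((INR (S k) - (x + 1)) * (INR (S k) * sol 0 0 (x + 1) (S k))); [ring|].
rewrite IH.
transitivity (- (x + 1) * (INR (S k) * sol 0 0 x (S k))); [|ring].
rewrite sol_zero, S_INR. ring.
Qed.

Lemma half_not_nat (n m : nat) : INR n + 1 / 2 <> INR m.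
Proof.
intros H. assert (E : INR (2 * n + 1) = INR (2 * m)).
{ rewrite plus_INR, !mult_INR. simpl (INR 2). simpl (INR 1). lra. }
apply INR_eq in E. lia.
Qed.

Lemma sol_zero_neq0 (x : R) (k : nat) : (forall m : nat, x <> INR m) -> sol 0 0 x k <> 0.
Proof.
intros Hx. induction k as [|k IH]; [simpl; lra|].
intros H. pose proof (sol_zero x k) as E. rewrite H, Rmult_0_r in E. symmetry in E.
apply Rmult_integral in E. destruct E as [E|E]; auto. apply (Hx k). lra.
Qed.

Lemma spec_exists (g delta : R) (n : nat) : 0 < g ->
  (forall t, 0 <= t <= 1 -> ~ spec g (t * delta) (INR n + 1 / 2) /\
                            ~ spec g (t * delta) (INR n + 1 + 1 / 2)) ->
  exists x, INR n + 1 / 2 <= x <= INR n + 1 + 1 / 2 /\ spec g delta x.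
Proof.
intros Hg Hno. apply NNPP. intros Hne.
set (y := INR n + 1 / 2) in *. replace (INR n + 1 + 1 / 2) with (y + 1) in * by (unfold y; ring).
assert (Hy : 0 < y) by (unfold y; pose proof (pos_INR n); lra).
destruct (nfloor_ex (4 * (y + 1 + Rabs delta) + 16 * g ^ 2 + 5)) as [k0 [_ Hk0]].
{ pose proof (Rabs_pos delta). nra. }
assert (Hk : 4 * (y + 1 + Rabs delta) + 16 * g ^ 2 + 4 <= INR k0) by lra.
set (adm := admissible (g ^ 2) (Rabs delta) (y + 1)).
assert (Hadm : forall s t x, 0 <= s <= 1 -> 0 <= t <= 1 -> y <= x <= y + 1 ->
   adm (s * g ^ 2) (t * delta) x).
{ intros s t x Hs Ht Hx. repeat split.
  - nra.
  - nra.
  - rewrite Rabs_mult, (Rabs_pos_eq t) by lra. pose proof (Rabs_pos delta). nra.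
  - rewrite Rabs_pos_eq; lra. }
assert (Hgen : forall g' d x, 0 < g' -> adm (g' ^ 2) d x -> ~ spec g' d x ->
  dominant k0 1 (g' ^ 2) d x \/ dominant k0 (-1) (g' ^ 2) d x).
{ intros g' d x Hg' Ha Hs. apply NNPP. intros N. apply Hs.
  apply (recessive_spec (g ^ 2) (Rabs delta) (y + 1) k0 Hk g' d x Hg' Ha); tauto. }
assert (Hhalf : forall x, x = y \/ x = y + 1 -> forall m : nat, x <> INR m).
{ intros x [-> | ->] m; unfold y; [apply half_not_nat|].
  replace (INR n + 1 / 2 + 1) with (INR (S n) + 1 / 2) by (rewrite S_INR; ring).
  apply half_not_nat. }
assert (Hbase : forall x k, x = y \/ x = y + 1 -> (k0 <= k)%nat ->
   forall e, 0 < e * sol 0 0 x k -> cone e 0 0 x k).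
{ intros x k Hx Hkk e He. unfold cone. split; auto.
  pose proof (sol_zero x k) as E. rewrite S_INR in E. apply le_INR in Hkk.
  pose proof (Rabs_pos delta).
  assert (Hxk : 4 * x + 4 <= INR k) by (destruct Hx; subst x; nra).
  assert (E' : (INR k + 1) * (e * sol 0 0 x (S k)) = (INR k - x) * (e * sol 0 0 x k)).
  { transitivity (e * ((INR k + 1) * sol 0 0 x (S k))); [ring|]. rewrite E. ring. }
  apply Rmult_lt_reg_l with (INR k + 1); [lra|].
  replace ((INR k + 1) * (4 * (e * sol 0 0 x (S k))))
    with (4 * ((INR k + 1) * (e * sol 0 0 x (S k)))) by ring.
  rewrite E'. nra. }
assert (Hdom0 : forall x, x = y \/ x = y + 1 -> dominant k0 1 0 0 x \/ dominant k0 (-1) 0 0 x).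
{ intros x Hx. pose proof (sol_zero_neq0 x k0 (Hhalf x Hx)).
  destruct (Rlt_le_dec 0 (sol 0 0 x k0)).
  - left. exists k0. split; auto. apply Hbase; auto. lra.
  - right. exists k0. split; auto. apply Hbase; auto. lra. }
(* A vertical side in two segments: first [g^2] grows at [delta = 0], where [spec_zero] excludes
   half-integers, then [delta] grows at fixed [g], where the hypothesis does. *)
assert (Hvert : forall x, x = y \/ x = y + 1 ->
  dominant k0 1 0 0 x <-> dominant k0 1 (g ^ 2) delta x).
{ intros x Hx. assert (Hx' : y <= x <= y + 1) by lra.
  transitivity (dominant k0 1 (g ^ 2) 0 x).
  - apply (dominant_segment (g ^ 2) (Rabs delta) (y + 1) k0 Hk).
    intros t Ht.
    replace (0 + t * (g ^ 2 - 0)) with (t * g ^ 2) by ring.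
    replace (0 + t * (0 - 0)) with (0 * delta) by ring.
    replace (x + t * (x - x)) with x by ring.
    split; [apply Hadm; lra|].
    destruct (Req_dec t 0) as [->|Ht0].
    + rewrite !Rmult_0_l. auto.
    (* [gamma] is linear along the segment, so the coupling is [sqrt t * g]. At [t = 0], where no
       eigenvector is available, the explicit solution has been used instead. *)
    + assert (Hst : 0 < sqrt t) by (apply sqrt_lt_R0; lra).
      replace (t * g ^ 2) with ((sqrt t * g) ^ 2)
        by (rewrite Rpow_mult_distr, pow2_sqrt; lra).
      apply Hgen; [nra| |].
      * rewrite Rpow_mult_distr, pow2_sqrt by lra. apply Hadm; lra.
      * rewrite Rmult_0_l. intros Hs. apply spec_zero in Hs. destruct Hs as [m Hm].
        now apply (Hhalf x Hx m).
  - apply (dominant_segment (g ^ 2) (Rabs delta) (y + 1) k0 Hk).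
    intros t Ht.
    replace (g ^ 2 + t * (g ^ 2 - g ^ 2)) with (1 * g ^ 2) by ring.
    replace (0 + t * (delta - 0)) with (t * delta) by ring.
    replace (x + t * (x - x)) with x by ring.
    split; [apply Hadm; lra|]. rewrite Rmult_1_l.
    apply Hgen; auto.
    + rewrite <- (Rmult_1_l (g ^ 2)). apply Hadm; lra.
    + destruct (Hno t Ht). destruct Hx; subst x; auto. }
assert (Hhor : dominant k0 1 (g ^ 2) delta y <-> dominant k0 1 (g ^ 2) delta (y + 1)).
{ apply (dominant_segment (g ^ 2) (Rabs delta) (y + 1) k0 Hk).
  intros t Ht.
  replace (g ^ 2 + t * (g ^ 2 - g ^ 2)) with (1 * g ^ 2) by ring.
  replace (delta + t * (delta - delta)) with (1 * delta) by ring.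
  replace (y + t * (y + 1 - y)) with (y + t) by ring.
  split; [apply Hadm; lra|]. rewrite !Rmult_1_l.
  apply Hgen; auto.
  + rewrite <- (Rmult_1_l (g ^ 2)), <- (Rmult_1_l delta). apply Hadm; lra.
  + intros Hs. apply Hne. exists (y + t). split; auto. lra. }
assert (Hflip : forall e, dominant k0 e 0 0 y -> dominant k0 (- e) 0 0 (y + 1)).
{ intros e [k [Hkk [He _]]]. exists (S k). split; [lia|].
  apply Hbase; auto. pose proof (sol_zero_shift y k) as E.
  assert (0 < INR (S k)) by (apply lt_0_INR; lia).
  apply Rmult_lt_reg_l with (INR (S k)); auto. rewrite Rmult_0_r.
  replace (INR (S k) * (- e * sol 0 0 (y + 1) (S k)))
    with (- e * (INR (S k) * sol 0 0 (y + 1) (S k))) by ring.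
  rewrite E. nra. }
assert (Hiff : dominant k0 1 0 0 y <-> dominant k0 1 0 0 (y + 1)).
{ rewrite (Hvert y), (Hvert (y + 1)); auto. }
assert (Ha0 : forall x, y <= x <= y + 1 -> adm 0 0 x).
{ intros x Hx. rewrite <- (Rmult_0_l (g ^ 2)) at 1. rewrite <- (Rmult_0_l delta). apply Hadm; lra. }
destruct (Hdom0 y) as [H|H]; auto.
- apply (dominant_excl (g ^ 2) (Rabs delta) (y + 1) k0 Hk 0 0 (y + 1)); [apply Ha0; lra| |].
  + now apply Hiff.
  + replace (-1) with (- (1)) by ring. now apply Hflip.
- apply (dominant_excl (g ^ 2) (Rabs delta) (y + 1) k0 Hk 0 0 y); [apply Ha0; lra| |auto].
  apply Hiff. apply Hflip in H. now replace (- (-1)) with 1 in H by ring.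
Qed.

(** * Oscillation of the diagonal entries *)

(* [exp (-2 g^2) * L_n (4 g^2)] with [L_n] the Laguerre polynomial. *)
Definition lag (g : R) (n : nat) : R := (-1) ^ n * parity g n n.

(** With this scaled difference the recurrence of order two becomes the first-order system [lag_S],
    [lagd_S]; by [lagd_parity] it is also an entry of [parity] next to the diagonal, so it obeys the
    same upper bounds. *)
Definition lagd (g : R) (n : nat) : R := INR (S n) * (lag g (S n) - lag g n).

Lemma lagd_parity (g : R) (n : nat) :
  lagd g n = (-1) ^ S n * (2 * g * (sqrt (INR (S n)) * parity g n (S n))).
Proof.
pose proof (parity_rec g n (S n)) as H. rewrite raise_S in H.
unfold lagd, lag. pose proof (sqrt_INR_sqr (S n)) as E.
set (q := sqrt (INR (S n))) in *. rewrite <- E.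
transitivity ((-1) ^ S n * (q * (2 * g * parity g n (S n)))); [|ring].
rewrite <- H. simpl pow. ring.
Qed.

Lemma lag_S (g : R) (n : nat) : lag g (S n) = lag g n + lagd g n / INR (S n).
Proof. unfold lagd. field. apply not_0_INR. lia. Qed.

Lemma lagd_S (g : R) (n : nat) : lagd g (S n) = lagd g n - 4 * g ^ 2 * lag g (S n).
Proof.
rewrite !lagd_parity. unfold lag.
pose proof (parity_rec g (S n) (S n)) as H. rewrite raise_S in H.
rewrite (parity_sym g (S n) n), (parity_sym g (S (S n))) in H.
transitivity ((-1) ^ S n * (2 * g * (sqrt (INR (S n)) * parity g n (S n)
   - (sqrt (INR (S n)) * parity g n (S n) + sqrt (INR (S (S n))) * parity g (S n) (S (S n)))))).
- simpl pow. ring.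
- rewrite H. ring.
Qed.

Lemma lag_0_neq0 (g : R) : lag g 0 <> 0.
Proof.
unfold lag. simpl pow. rewrite Rmult_1_l. intros H.
assert (Hz : forall m, parity g m 0 = 0).
{ induction m as [|m IH]; auto.
  pose proof (parity_rec g m 0) as E. rewrite raise_0, IH in E.
  pose proof (sqrt_INR_S_pos m). apply Rmult_eq_reg_l with (sqrt (INR (S m))); lra. }
pose proof (parity_norm g 0) as N. unfold ip in N.
rewrite (Series_ext _ (fun k => 0 * parity g 0 k)) in N.
- rewrite Series_scal_l in N. lra.
- intros k. rewrite (parity_sym g 0 k), Hz. ring.
Qed.

(** The first-order system can be run backwards, so a common zero would descend to [lag g 0 = 0],
    and then the whole row 0 of [parity] would vanish. *)
Lemma lag_lagd_neq0 (g : R) (n : nat) : lag g (S n) <> 0 \/ lagd g n <> 0.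
Proof.
apply NNPP. intros H. apply not_or_and in H. destruct H as [H1 H2].
apply NNPP in H1. apply NNPP in H2.
assert (Hn : lag g n = 0).
{ rewrite lag_S, H2 in H1. lra. }
clear H1. induction n as [|n IH]; [now apply lag_0_neq0 in Hn|].
assert (H3 : lagd g n = 0) by (rewrite lagd_S, Hn in H2; lra).
apply IH; auto. rewrite lag_S, H3 in Hn. lra.
Qed.

(* The cross term makes the increment of this energy a sum of squares, so that its growth
   rate is seen at every step and not only on average. *)
Definition lag_energy (g : R) (n : nat) : R :=
  4 * g ^ 2 * INR (S n) * lag g (S n) ^ 2 + lagd g n ^ 2
  + (1 / 2 - 4 * g ^ 2) * (lag g (S n) * lagd g n).

(** The products of [lag] and [lagd] cancel for every coefficient of the cross term; the value
    [1/2 - 4 g^2] gives both remaining squares the weight 1/2. The relative growth is thus about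
    [1 / (2 n)], that of [sqrt n]. *)
Lemma lag_energy_step (g : R) (n : nat) :
  lag_energy g (S n) - lag_energy g n
    = (4 * g ^ 2 * lag g (S n) ^ 2 + lagd g (S n) ^ 2 / INR (S (S n))) / 2.
Proof.
unfold lag_energy. rewrite (lag_S g (S n)).
assert (E : lagd g n = lagd g (S n) + 4 * g ^ 2 * lag g (S n)) by (rewrite lagd_S; ring).
rewrite E. rewrite !(S_INR (S n)).
assert (INR (S n) + 1 <> 0) by (pose proof (pos_INR (S n)); lra).
field. auto.
Qed.

Lemma sqrt_succ_le (y : R) : 0 < y -> sqrt (y + 1) <= sqrt y + 1 / (2 * sqrt y).
Proof.
intros Hy. assert (Hs : 0 < sqrt y) by now apply sqrt_lt_R0.
assert (H0 : 0 <= 1 / (2 * sqrt y)) by (apply Rdiv_le_0_compat; lra).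
rewrite <- (sqrt_square (sqrt y + 1 / (2 * sqrt y))) by lra.
apply sqrt_le_1_alt.
replace ((sqrt y + 1 / (2 * sqrt y)) * (sqrt y + 1 / (2 * sqrt y)))
  with (sqrt y * sqrt y + 1 + 1 / (2 * sqrt y) * (1 / (2 * sqrt y))) by (field; lra).
rewrite sqrt_sqrt by lra. nra.
Qed.

Lemma lag_energy_lower (g : R) : 0 < g -> exists c T, 0 < c /\ 0 < T /\
  forall n : nat, T <= sqrt (INR (S n)) ->
    c * sqrt (INR (S n)) <= 4 * g ^ 2 * INR (S n) * lag g (S n) ^ 2 + lagd g n ^ 2.
Proof.
intros Hg.
(* [a / sqrt n] is the relative size of the cross term. In [b], the summand [2 g] pays for replacing
   [lagd] at [n + 1] by its value at [n], [a] for comparing the two energies, and 1 for the shift of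
   the denominator by one. *)
set (a := (1 / 2 + 4 * g ^ 2) / (4 * g)).
assert (Ha : 0 < a) by (apply Rdiv_lt_0_compat; nra).
set (b := 2 * g + a + 1). set (T := 2 * a + 2 * b + 2).
assert (Hb : 0 < b) by (unfold b; lra).
set (E0 := fun n => 4 * g ^ 2 * INR (S n) * lag g (S n) ^ 2 + lagd g n ^ 2).
assert (HE0 : forall n, 0 <= E0 n).
{ intros n. unfold E0. pose proof (pos_INR (S n)). pose proof (pow2_ge_0 (lagd g n)).
  assert (0 <= 4 * g ^ 2 * INR (S n) * lag g (S n) ^ 2) by
    (apply Rmult_le_pos; [apply Rmult_le_pos; [nra|auto]|apply pow2_ge_0]). lra. }
assert (Hcross : forall n, Rabs (lag g (S n) * lagd g n) <= E0 n / (4 * g * sqrt (INR (S n)))).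
{ intros n. pose proof (sqrt_INR_S_pos n) as Hs. pose proof (sqrt_INR_sqr (S n)) as Es.
  unfold E0. set (s := sqrt (INR (S n))) in *. rewrite <- Es.
  assert (Hd : 0 < 4 * g * s) by nra.
  pose proof (pow2_ge_0 (2 * g * s * lag g (S n) - lagd g n)).
  pose proof (pow2_ge_0 (2 * g * s * lag g (S n) + lagd g n)).
  apply Rmult_le_reg_r with (4 * g * s); auto.
  match goal with |- _ <= ?X / _ * _ => replace (X / (4 * g * s) * (4 * g * s)) with X by (field; lra) end.
  rewrite <- (Rabs_pos_eq (4 * g * s)) by lra. rewrite <- Rabs_mult. apply Rabs_le. lra. }
assert (Hcomp : forall n, Rabs (lag_energy g n - E0 n) <= a / sqrt (INR (S n)) * E0 n).
{ intros n. pose proof (sqrt_INR_S_pos n) as Hs. unfold lag_energy. fold (E0 n).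
  replace (E0 n + (1 / 2 - 4 * g ^ 2) * (lag g (S n) * lagd g n) - E0 n)
    with ((1 / 2 - 4 * g ^ 2) * (lag g (S n) * lagd g n)) by ring.
  rewrite Rabs_mult.
  replace (a / sqrt (INR (S n)) * E0 n)
    with ((1 / 2 + 4 * g ^ 2) * (E0 n / (4 * g * sqrt (INR (S n))))) by (unfold a; field; lra).
  apply Rmult_le_compat; try apply Rabs_pos; auto. apply Rabs_le. nra. }
assert (Hgrow : forall n, T <= sqrt (INR (S n)) ->
  E0 n / 2 <= lag_energy g n <= 2 * E0 n /\
  lag_energy g n * (1 + (1 - b / sqrt (INR (S n))) / (2 * INR (S n))) <= lag_energy g (S n)).
{ intros n Hn. pose proof (sqrt_INR_sqr (S n)) as Es. specialize (Hcomp n). specialize (Hcross n).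
  specialize (HE0 n). pose proof (lag_energy_step g n) as Hst. rewrite (S_INR (S n)) in Hst.
  pose proof (lagd_S g n) as Hd.
  set (s := sqrt (INR (S n))) in *.
  assert (Hs : 0 < s) by (unfold T in Hn; lra).
  set (t := 1 / s).
  assert (Ht : 0 < t) by (apply Rdiv_lt_0_compat; lra).
  assert (Hts : t * s = 1) by (unfold t; field; lra).
  assert (Hat : a * t <= 1 / 2).
  { apply Rmult_le_reg_r with s; auto. rewrite Rmult_assoc, Hts. unfold T in Hn; lra. }
  assert (Hbt : b * t <= 1 / 2).
  { apply Rmult_le_reg_r with s; auto. rewrite Rmult_assoc, Hts. unfold T in Hn; lra. }
  assert (Ht1 : t <= 1).
  { apply Rmult_le_reg_r with s; auto. rewrite Hts. unfold T in Hn; lra. }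
  replace (a / s) with (a * t) in Hcomp by (unfold t; field; lra).
  apply Rabs_le_between in Hcomp.
  assert (Hlow : E0 n / 2 <= lag_energy g n <= 2 * E0 n) by nra.
  split; auto.
  assert (Hup : lag_energy g n * (1 - a * t) <= E0 n).
  { assert (lag_energy g n <= (1 + a * t) * E0 n) by lra.
    assert (0 < a * t) by nra. nra. }
  assert (Hd2 : lagd g n ^ 2 - 2 * g * t * E0 n <= lagd g (S n) ^ 2).
  { assert (Hx : 8 * g ^ 2 * Rabs (lag g (S n) * lagd g n) <= 2 * g * t * E0 n).
    { replace (2 * g * t * E0 n) with (8 * g ^ 2 * (E0 n / (4 * g * s))) by (unfold t; field; lra).
      apply Rmult_le_compat_l; nra. }
    rewrite Hd. pose proof (Rle_abs (lag g (S n) * lagd g n)).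
    assert (8 * g ^ 2 * (lag g (S n) * lagd g n) <= 2 * g * t * E0 n) by nra.
    pose proof (pow2_ge_0 (4 * g ^ 2 * lag g (S n))). nra. }
  assert (HN : 0 < INR (S n)) by (apply lt_0_INR; lia).
  assert (Hinc : E0 n * (1 - 2 * g * t) / (2 * (INR (S n) + 1)) <= lag_energy g (S n) - lag_energy g n).
  { rewrite Hst. apply Rmult_le_reg_r with (2 * (INR (S n) + 1)); [lra|].
    replace (E0 n * (1 - 2 * g * t) / (2 * (INR (S n) + 1)) * (2 * (INR (S n) + 1)))
      with (E0 n * (1 - 2 * g * t)) by (field; lra).
    replace ((4 * g ^ 2 * lag g (S n) ^ 2 + lagd g (S n) ^ 2 / (INR (S n) + 1)) / 2 * (2 * (INR (S n) + 1)))
      with (4 * g ^ 2 * (INR (S n) + 1) * lag g (S n) ^ 2 + lagd g (S n) ^ 2) by (field; lra).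
    assert (0 <= 4 * g ^ 2 * lag g (S n) ^ 2) by (apply Rmult_le_pos; nra).
    unfold E0 at 1. unfold E0 in Hd2.
    replace ((4 * g ^ 2 * INR (S n) * lag g (S n) ^ 2 + lagd g n ^ 2) * (1 - 2 * g * t))
      with (4 * g ^ 2 * INR (S n) * lag g (S n) ^ 2 + lagd g n ^ 2
        - 2 * g * t * (4 * g ^ 2 * INR (S n) * lag g (S n) ^ 2 + lagd g n ^ 2)) by ring.
    lra. }
  assert (Hgt : 2 * g * t <= 1 / 2) by (unfold b in Hbt; nra).
  assert (HeE : 0 <= lag_energy g n) by lra.
  apply Rle_trans with (lag_energy g n + lag_energy g n * (1 - a * t) * (1 - 2 * g * t) / (2 * (INR (S n) + 1))).
  - rewrite Rmult_plus_distr_l, Rmult_1_r. apply Rplus_le_compat_l.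
    replace (b / s) with (b * t) by (unfold t; field; lra).
    replace (lag_energy g n * (1 - a * t) * (1 - 2 * g * t) / (2 * (INR (S n) + 1)))
      with (lag_energy g n * ((1 - a * t) * (1 - 2 * g * t) / (2 * (INR (S n) + 1)))) by (field; lra).
    apply Rmult_le_compat_l; auto.
    apply Rmult_le_reg_r with (2 * INR (S n) * (INR (S n) + 1)); [nra|].
    replace ((1 - b * t) / (2 * INR (S n)) * (2 * INR (S n) * (INR (S n) + 1)))
      with ((1 - b * t) * (INR (S n) + 1)) by (field; lra).
    replace ((1 - a * t) * (1 - 2 * g * t) / (2 * (INR (S n) + 1)) * (2 * INR (S n) * (INR (S n) + 1)))
      with ((1 - a * t) * (1 - 2 * g * t) * INR (S n)) by (field; lra).
    rewrite <- Es.
    assert (0 <= (a * t) * (g * t)) by (apply Rmult_le_pos; nra).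
    assert (1 - b * t + t <= (1 - a * t) * (1 - 2 * g * t)) by (unfold b; lra).
    apply Rle_trans with ((1 - b * t + t) * (s * s)); [|apply Rmult_le_compat_r; nra].
    assert (t * (s * s) = s) by (rewrite <- Rmult_assoc, Hts; ring).
    assert (1 <= s) by (unfold T in Hn; lra).
    assert (0 <= b * t) by nra. lra.
  - apply Rle_trans with (lag_energy g n + E0 n * (1 - 2 * g * t) / (2 * (INR (S n) + 1))); [|lra].
    apply Rplus_le_compat_l. unfold Rdiv. apply Rmult_le_compat_r.
    + left. apply Rinv_0_lt_compat. lra.
    + apply Rmult_le_compat_r; lra. }
destruct (nfloor_ex (T * T)) as [n0 [_ Hn0]]; [unfold T; nra|].
assert (HT0 : 0 < T) by (unfold T; lra).
assert (Hbig : forall n, (n0 <= n)%nat -> T <= sqrt (INR (S n))).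
{ intros n Hn. rewrite <- (sqrt_square T) by lra. apply sqrt_le_1_alt.
  apply le_INR in Hn. rewrite S_INR. lra. }
assert (Hpos0 : 0 < lag_energy g n0).
{ destruct (Hgrow n0 (Hbig n0 (Nat.le_refl _))) as [[H _] _].
  apply Rlt_le_trans with (2 := H). apply Rdiv_lt_0_compat; [|lra]. unfold E0.
  pose proof (lt_0_INR (S n0) ltac:(lia)) as HS.
  assert (Hc4 : 0 < 4 * g ^ 2 * INR (S n0)) by (apply Rmult_lt_0_compat; nra).
  pose proof (pow2_ge_0 (lag g (S n0))). pose proof (pow2_ge_0 (lagd g n0)).
  destruct (lag_lagd_neq0 g n0) as [Hne|Hne]; apply pow2_gt_0 in Hne.
  - pose proof (Rmult_lt_0_compat _ _ Hc4 Hne). lra.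
  - assert (0 <= 4 * g ^ 2 * INR (S n0) * lag g (S n0) ^ 2) by (apply Rmult_le_pos; lra). lra. }
(* A comparison function equivalent to [sqrt n]; its constant [2 b] compensates the loss
   [b / sqrt n] in the growth rate, since [(1 + 2 w) (1 - w) >= 1] for [w] between 0 and 1/2. *)
set (phi := fun n => sqrt (INR (S n)) + 2 * b).
assert (Hphi : forall n, 0 < phi n).
{ intros n. unfold phi. pose proof (sqrt_pos (INR (S n))). lra. }
set (c0 := lag_energy g n0 / phi n0).
assert (Hc0 : 0 < c0) by (apply Rdiv_lt_0_compat; auto).
assert (Hind : forall n, (n0 <= n)%nat -> c0 * phi n <= lag_energy g n).
{ intros n Hn. induction Hn as [|n Hn IH].
  - unfold c0. right. field. apply Rgt_not_eq, Hphi.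
  - destruct (Hgrow n (Hbig n Hn)) as [_ H]. apply Rle_trans with (2 := H).
    specialize (Hbig n Hn). pose proof (sqrt_INR_sqr (S n)) as Es.
    pose proof (sqrt_succ_le (INR (S n)) (lt_0_INR (S n) ltac:(lia))) as Hsq.
    rewrite <- S_INR in Hsq. fold (phi n) in *.
    assert (Hp1 : phi (S n) <= phi n + 1 / (2 * sqrt (INR (S n)))) by (unfold phi; lra).
    assert (Hphin : phi n = sqrt (INR (S n)) + 2 * b) by reflexivity.
    set (s := sqrt (INR (S n))) in *. rewrite <- Es.
    assert (Hs : 0 < s) by lra.
    set (t := 1 / s) in *.
    assert (Ht : 0 < t) by (apply Rdiv_lt_0_compat; lra).
    assert (Hts : t * s = 1) by (unfold t; field; lra).
    replace (1 / (2 * s)) with (t / 2) in Hp1 by (unfold t; field; lra).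
    replace ((1 - b / s) / (2 * (s * s))) with ((1 - b * t) * (t * t) / 2) by (unfold t; field; lra).
    assert (Hbt : b * t <= 1 / 2).
    { apply Rmult_le_reg_r with s; auto. rewrite Rmult_assoc, Hts. unfold T in Hbig; lra. }
    apply Rle_trans with (c0 * phi n * (1 + (1 - b * t) * (t * t) / 2)).
    + rewrite Rmult_assoc. apply Rmult_le_compat_l; [lra|]. apply Rle_trans with (1 := Hp1).
      rewrite Rmult_plus_distr_l, Rmult_1_r. apply Rplus_le_compat_l.
      rewrite Hphin.
      replace ((s + 2 * b) * ((1 - b * t) * (t * t) / 2))
        with (t * ((t * s + 2 * (b * t)) * (1 - b * t)) / 2) by field.
      rewrite Hts. assert (0 < b * t) by nra.
      assert (1 <= (1 + 2 * (b * t)) * (1 - b * t)) by nra. nra.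
    + apply Rmult_le_compat_r; auto. assert (0 <= (1 - b * t) * (t * t)) by nra. lra. }
exists (c0 / 2), (sqrt (INR (S n0))). split; [lra|]. split; [apply sqrt_INR_S_pos|].
intros n Hn.
assert (Hnn : (n0 <= n)%nat).
{ apply sqrt_le_0 in Hn; try apply pos_INR. apply INR_le in Hn. lia. }
destruct (Hgrow n (Hbig n Hnn)) as [[_ H] _]. specialize (Hind n Hnn).
fold (E0 n). unfold phi in Hind.
assert (0 <= c0 * (2 * b)) by nra. lra.
Qed.

(** The threshold has the form of the error in [localization]; [B] will be the constant found there
    divided by [Delta]. *)
Definition small (g B : R) (j : nat) : Prop :=
  Rabs (lag g j) <= B * (1 + ln (INR j)) / sqrt (INR j).

Lemma ln_le_minus_1 (y : R) : 0 < y -> ln y <= y - 1.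
Proof. intros Hy. pose proof (exp_ineq1_le (ln y)) as H. rewrite exp_ln in H; lra. Qed.

(** With [w] the eighth root of [y], [1 + ln y = 1 + 8 ln w] is at most [9 w]. *)
Lemma one_plus_ln_sqr_le (y : R) : 1 <= y -> (1 + ln y) ^ 2 <= 81 * sqrt (sqrt y).
Proof.
intros Hy.
assert (H1 : forall z, 1 <= z -> 1 <= sqrt z).
{ intros z Hz. rewrite <- sqrt_1. now apply sqrt_le_1_alt. }
assert (Hsq : forall z, 1 <= z -> ln z = 2 * ln (sqrt z)).
{ intros z Hz. rewrite <- (sqrt_sqrt z) at 1 by lra.
  rewrite ln_mult by (apply sqrt_lt_R0; lra). ring. }
set (s := sqrt y). assert (Hs : 1 <= s) by now apply H1.
set (r := sqrt s). assert (Hr : 1 <= r) by now apply H1.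
set (w := sqrt r). assert (Hw : 1 <= w) by now apply H1.
rewrite (Hsq y Hy). fold s. rewrite (Hsq s Hs). fold r. rewrite (Hsq r Hr). fold w.
pose proof (ln_le_minus_1 w ltac:(lra)).
assert (Hl : 0 <= ln w) by (rewrite <- ln_1; apply ln_le; lra).
rewrite <- (sqrt_sqrt r) by lra. fold w.
apply Rle_trans with ((9 * w) ^ 2); [apply pow_incr; lra|]. right. ring.
Qed.

Lemma lag_small (g : R) : 0 < g -> exists A T, 0 < A /\ 0 < T /\
  forall j : nat, T <= sqrt (INR j) ->
    Rabs (lag g j) <= A / sqrt (sqrt (INR j)) /\
    Rabs (lagd g j) <= A * sqrt (INR (S j)) / sqrt (sqrt (INR j)).
Proof.
intros Hg.
destruct (parity_small g Hg) as [c [C [T [Hc [HC [HT H]]]]]].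
assert (HsC : 0 < sqrt C) by now apply sqrt_lt_R0.
assert (H1c : 0 < 1 / c) by (apply Rdiv_lt_0_compat; lra).
exists ((1 + 2 * g) * sqrt C), (T + 1 / c). split; [nra|]. split; [lra|].
intros j Hj.
set (s := sqrt (INR j)) in *. assert (Hs : 0 < s) by lra.
assert (Hr : 0 < sqrt s) by now apply sqrt_lt_R0.
assert (Hcs : 1 <= c * s).
{ apply Rle_trans with (c * (1 / c)); [right; field; lra|]. apply Rmult_le_compat_l; lra. }
assert (Hp : forall k, Rabs (INR k - INR j) <= 1 -> Rabs (parity g j k) <= sqrt C / sqrt s).
{ intros k Hk. apply Rsqr_incr_0_var; [|apply Rdiv_le_0_compat; lra].
  rewrite <- Rsqr_abs. unfold Rsqr.
  replace (sqrt C / sqrt s * (sqrt C / sqrt s)) with (C / s).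
  - specialize (H j k). fold s in H. assert (Hk' : Rabs (INR k - INR j) <= c * s) by lra.
    specialize (H ltac:(lra) Hk'). lra.
  - transitivity (sqrt C * sqrt C / (sqrt s * sqrt s)); [|field; lra].
    rewrite !sqrt_sqrt; lra. }
assert (HA : sqrt C / sqrt s <= (1 + 2 * g) * sqrt C / sqrt s).
{ unfold Rdiv. apply Rmult_le_compat_r; [left; now apply Rinv_0_lt_compat|nra]. }
split.
- apply Rle_trans with (2 := HA). unfold lag. rewrite Rabs_mult, Rabs_pow_m1, Rmult_1_l.
  apply Hp. rewrite Rminus_diag_eq, Rabs_R0; lra.
- rewrite lagd_parity, Rabs_mult, Rabs_pow_m1, Rmult_1_l, !Rabs_mult.
  rewrite (Rabs_pos_eq 2), (Rabs_pos_eq g), (Rabs_pos_eq (sqrt _)) by (lra || apply sqrt_pos).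
  specialize (Hp (S j)). rewrite S_INR in Hp.
  replace (INR j + 1 - INR j) with 1 in Hp by ring. rewrite Rabs_R1 in Hp.
  specialize (Hp ltac:(lra)). pose proof (sqrt_pos (INR (S j))) as Hq.
  pose proof (Rabs_pos (parity g j (S j))).
  apply Rle_trans with (2 * g * (sqrt (INR (S j)) * (sqrt C / sqrt s))).
  + apply Rmult_le_compat_l; [lra|]. now apply Rmult_le_compat_l.
  + replace ((1 + 2 * g) * sqrt C * sqrt (INR (S j)) / sqrt s)
      with ((1 + 2 * g) * (sqrt (INR (S j)) * (sqrt C / sqrt s))) by (field; lra).
    apply Rmult_le_compat_r; [|lra]. apply Rmult_le_pos; auto. apply Rdiv_le_0_compat; lra.
Qed.

(** A change of sign bounds [lag g j] by the step [lagd g j / (j + 1)], of order [j^(-3/4)], which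
    is below the threshold of [small]. *)
Lemma lag_same_sign (g B : R) : 0 < g -> 0 < B -> exists T, 0 < T /\
  forall j : nat, T <= sqrt (INR j) -> ~ small g B j -> 0 < lag g j * lag g (S j).
Proof.
intros Hg HB. destruct (lag_small g Hg) as [A [T [HA [HT H]]]].
assert (HAB : 0 < A / B) by (apply Rdiv_lt_0_compat; lra).
exists (T + (A / B) ^ 2 + 1). split; [nra|]. intros j Hj Hn.
destruct (H j ltac:(nra)) as [_ Hd].
apply Rnot_le_lt. intros Hle. apply Hn. unfold small.
set (s := sqrt (INR j)) in *.
assert (Hs : 1 <= s) by nra.
assert (HN : INR j = s * s) by (symmetry; apply sqrt_INR_sqr).
assert (Hlt : Rabs (lag g j) <= Rabs (lagd g j) / INR (S j)).
{ assert (E : lag g (S j) - lag g j = lagd g j / INR (S j)) by (rewrite lag_S; ring).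
  assert (HS : 0 < INR (S j)) by (apply lt_0_INR; lia).
  rewrite <- (Rabs_pos_eq (INR (S j))) by lra. rewrite <- Rabs_div by lra. rewrite <- E.
  unfold Rabs. destruct (Rcase_abs (lag g j)), (Rcase_abs (lag g (S j) - lag g j)); nra. }
assert (Hr : 0 < sqrt s) by (apply sqrt_lt_R0; lra).
assert (Hrr : sqrt s * sqrt s = s) by (apply sqrt_sqrt; lra).
assert (HrAB : A / B <= sqrt s).
{ rewrite <- (sqrt_square (A / B)) by lra. apply sqrt_le_1_alt. nra. }
assert (Hln : 0 <= ln (INR j)) by (rewrite <- ln_1; apply ln_le; nra).
apply Rle_trans with (1 := Hlt).
pose proof (sqrt_INR_sqr (S j)) as Eq. pose proof (sqrt_INR_S_pos j) as Hq.
set (q := sqrt (INR (S j))) in *. rewrite <- Eq.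
assert (Hqs : s <= q) by (apply sqrt_le_1_alt; rewrite S_INR; lra).
apply Rle_trans with (A * q / sqrt s / (q * q)).
{ unfold Rdiv at 1 2. apply Rmult_le_compat_r; auto. left. apply Rinv_0_lt_compat. nra. }
replace (A * q / sqrt s / (q * q)) with (A / sqrt s * / q) by (field; lra).
unfold Rdiv at 2. apply Rmult_le_compat.
- apply Rdiv_le_0_compat; lra.
- left. now apply Rinv_0_lt_compat.
- apply Rle_trans with B; [|nra].
  apply Rmult_le_reg_r with (sqrt s); auto.
  replace (A / sqrt s * sqrt s) with (A / B * B) by (field; lra). nra.
- apply Rinv_le_contravar; lra.
Qed.

(* Where [lag] is small its derivative is not, and stays so over a window of length of order
   [sqrt m], on which [lag] is therefore strictly monotone. *)
Lemma small_cluster (g B : R) : 0 < g -> 0 < B ->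
  exists c1 C1 T, 0 < c1 /\ 0 < C1 /\ 0 < T /\
  forall m d : nat, T <= sqrt (INR m) -> small g B m -> small g B (m + d) ->
    INR d <= c1 * sqrt (INR m) -> INR d <= C1 * sqrt (sqrt (INR m)) * (1 + ln (INR m)).
Proof.
intros Hg HB.
destruct (lag_energy_lower g Hg) as [c [T0 [Hc [HT0 Hen]]]].
destruct (lag_small g Hg) as [A [T1 [HA [HT1 Hsm]]]].
set (h := sqrt (c / 2)).
assert (Hh : 0 < h) by (apply sqrt_lt_R0; lra).
assert (Hhh : h * h = c / 2) by (apply sqrt_sqrt; lra).
(* [lagd] starts with size at least [h * r], where [r] is the fourth root of [m], and within
   [c1 * sqrt m] steps loses at most half of it. [C1] divides a total change of three thresholds by
   the least step [h * r / (4 m)]; [R0] makes the share of [lag] in the energy at most half. *)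
set (c1 := h / (8 * g ^ 2 * A)).
assert (H8 : 0 < 8 * g ^ 2 * A) by (apply Rmult_lt_0_compat; nra).
assert (Hc1 : 0 < c1) by now apply Rdiv_lt_0_compat.
set (C1 := 12 * B / h).
assert (HC1 : 0 < C1) by (apply Rdiv_lt_0_compat; lra).
set (R0 := 648 * g ^ 2 * B ^ 2 / c).
assert (HR0 : 0 < R0) by (apply Rdiv_lt_0_compat; [apply Rmult_lt_0_compat; nra|lra]).
exists c1, C1, (T0 + T1 + R0 ^ 2 + c1 + 1). repeat split; auto; [nra|].
intros m d HT Hm Hmd Hd.
set (N := INR m) in *. set (s := sqrt N) in *.
assert (HR2 : 0 <= R0 ^ 2) by apply pow2_ge_0.
assert (Hs : 1 <= s) by lra.
assert (HN : N = s * s) by (symmetry; apply sqrt_INR_sqr).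
set (r := sqrt s). assert (Hr : 0 < r) by (apply sqrt_lt_R0; lra).
assert (Hrr : r * r = s) by (apply sqrt_sqrt; lra).
assert (HN1 : 1 <= N) by nra.
assert (Hln : 0 <= ln N) by (rewrite <- ln_1; apply ln_le; lra).
assert (Hm0 : (1 <= m)%nat) by (apply INR_le; exact HN1).
(* [lag_energy_lower] at [m0] pairs [lagd g m0] with [lag g (S m0)], hence the predecessor. *)
destruct m as [|m0]; [lia|]. clear Hm0.
assert (Hrb : 4 * g ^ 2 * B ^ 2 * (1 + ln N) ^ 2 <= c / 2 * s).
{ pose proof (one_plus_ln_sqr_le N HN1) as H. fold s in H. fold r in H.
  assert (R0 <= r).
  { rewrite <- (sqrt_square R0) by lra. apply sqrt_le_1_alt. lra. }
  apply Rle_trans with (4 * g ^ 2 * B ^ 2 * (81 * r)).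
  - apply Rmult_le_compat_l; auto. nra.
  - rewrite <- Hrr. replace (4 * g ^ 2 * B ^ 2 * (81 * r)) with (c / 2 * (R0 * r))
      by (unfold R0; field; lra).
    apply Rmult_le_compat_l; nra. }
assert (Hh0 : (h * r) ^ 2 <= lagd g m0 ^ 2).
{ specialize (Hen m0). change (INR (S m0)) with N in Hen. fold s in Hen.
  specialize (Hen ltac:(lra)).
  replace ((h * r) ^ 2) with (c / 2 * s) by (rewrite <- Hhh, <- Hrr; ring).
  assert (4 * g ^ 2 * N * lag g (S m0) ^ 2 <= 4 * g ^ 2 * B ^ 2 * (1 + ln N) ^ 2); [|lra].
  unfold small in Hm. change (INR (S m0)) with N in Hm. fold s in Hm.
  pose proof (pow_incr _ _ 2 (conj (Rabs_pos _) Hm)) as H2. rewrite pow2_abs in H2.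
  replace (4 * g ^ 2 * B ^ 2 * (1 + ln N) ^ 2)
    with (4 * g ^ 2 * N * (B * (1 + ln N) / s) ^ 2) by (rewrite HN at 1; field; lra).
  apply Rmult_le_compat_l; auto. nra. }
assert (Hsig : exists e, (e = 1 \/ e = -1) /\ h * r <= e * lagd g m0).
{ destruct (Rle_lt_dec 0 (lagd g m0)) as [Hp|Hp]; [exists 1|exists (-1)];
  (split; [auto|]); apply Rsqr_incr_0_var; unfold Rsqr; nra. }
destruct Hsig as [e [He Hsig]].
assert (Hlag : forall i, Rabs (lag g (S m0 + i)) <= A / r).
{ intros i. assert (Hsi : s <= sqrt (INR (S m0 + i))).
  { apply sqrt_le_1_alt. rewrite plus_INR. change (INR (S m0)) with N. pose proof (pos_INR i). lra. }
  destruct (Hsm (S m0 + i)%nat ltac:(lra)) as [H _]. apply Rle_trans with (1 := H).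
  unfold Rdiv. apply Rmult_le_compat_l; [lra|]. apply Rinv_le_contravar; auto.
  now apply sqrt_le_1_alt. }
assert (Hdh : forall i, (i <= d)%nat -> h * r - INR i * (4 * g ^ 2 * (A / r)) <= e * lagd g (m0 + i)).
{ induction i as [|i IH]; intros Hi.
  - rewrite Nat.add_0_r. simpl (INR 0). lra.
  - specialize (IH ltac:(lia)). rewrite Nat.add_succ_r, lagd_S, S_INR.
    specialize (Hlag i). replace (S m0 + i)%nat with (S (m0 + i)) in Hlag by lia.
    apply Rabs_le_between in Hlag.
    assert (e * lag g (S (m0 + i)) <= A / r) by (destruct He; subst e; lra).
    nra. }
assert (Hdh2 : forall i, (i <= d)%nat -> h * r / 2 <= e * lagd g (m0 + i)).
{ intros i Hi. apply Rle_trans with (2 := Hdh i Hi). apply le_INR in Hi.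
  assert (INR i * (4 * g ^ 2 * (A / r)) <= h * r / 2); [|lra].
  apply Rle_trans with (c1 * s * (4 * g ^ 2 * (A / r))).
  - apply Rmult_le_compat_r; [|lra]. apply Rmult_le_pos; [nra|]. apply Rdiv_le_0_compat; lra.
  - right. rewrite <- Hrr. unfold c1. field. lra. }
assert (Hd2 : N + INR d <= 2 * N) by (rewrite HN in *; nra).
assert (Hinc : forall i, (i <= d)%nat ->
  INR i * (h * r / (4 * N)) <= e * (lag g (S m0 + i) - lag g (S m0))).
{ induction i as [|i IH]; intros Hi.
  - rewrite Nat.add_0_r. simpl (INR 0). lra.
  - specialize (IH ltac:(lia)). rewrite Nat.add_succ_r, lag_S, S_INR.
    specialize (Hdh2 (S i) Hi). replace (m0 + S i)%nat with (S m0 + i)%nat in Hdh2 by lia.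
    assert (HS : INR (S (S m0 + i)) <= 2 * N).
    { replace (S (S m0 + i)) with (S m0 + S i)%nat by lia. rewrite plus_INR.
      change (INR (S m0)) with N. apply le_INR in Hi. lra. }
    assert (HS0 : 0 < INR (S (S m0 + i))) by (apply lt_0_INR; lia).
    set (M := INR (S (S m0 + i))) in *.
    assert (h * r / (4 * N) <= e * lagd g (S m0 + i) / M).
    { apply Rle_trans with (h * r / 2 * / (2 * N)); [right; field; lra|].
      apply Rmult_le_compat; auto.
      - apply Rdiv_le_0_compat; [nra|lra].
      - left. apply Rinv_0_lt_compat. lra.
      - apply Rinv_le_contravar; lra. }
    replace (e * (lag g (S m0 + i) + lagd g (S m0 + i) / M - lag g (S m0)))
      with (e * (lag g (S m0 + i) - lag g (S m0)) + e * lagd g (S m0 + i) / M) by (field; lra).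
    lra. }
specialize (Hinc d (Nat.le_refl d)).
(* One threshold for the left end and two for the right end, where [1 + ln (m + d)] is at most twice
   [1 + ln m]. *)
assert (Htot : e * (lag g (S m0 + d) - lag g (S m0)) <= 3 * (B * (1 + ln N) / s)).
{ unfold small in Hm, Hmd. change (INR (S m0)) with N in Hm. fold s in Hm.
  rewrite plus_INR in Hmd. change (INR (S m0)) with N in Hmd.
  pose proof (pos_INR d) as Hd0.
  assert (Hs' : s <= sqrt (N + INR d)) by (apply sqrt_le_1_alt; lra).
  assert (Hl2 : ln (N + INR d) <= 1 + ln N).
  { apply Rle_trans with (ln (2 * N)); [apply ln_le; lra|]. rewrite ln_mult by lra.
    pose proof (ln_le_minus_1 2). lra. }
  assert (Hmd' : B * (1 + ln (N + INR d)) / sqrt (N + INR d) <= 2 * (B * (1 + ln N) / s)).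
  { replace (2 * (B * (1 + ln N) / s)) with (B * (2 * (1 + ln N)) * / s) by (field; lra).
    apply Rmult_le_compat.
    - apply Rmult_le_pos; [lra|].
      assert (0 <= ln (N + INR d)) by (rewrite <- ln_1; apply ln_le; lra). lra.
    - left. apply Rinv_0_lt_compat. lra.
    - apply Rmult_le_compat_l; lra.
    - apply Rinv_le_contravar; lra. }
  apply Rabs_le_between in Hm.
  assert (Hmd2 := Rle_trans _ _ _ Hmd Hmd'). apply Rabs_le_between in Hmd2.
  destruct He; subst e; lra. }
apply Rmult_le_reg_r with (h * r / (4 * N)); [apply Rdiv_lt_0_compat; nra|].
apply Rle_trans with (3 * (B * (1 + ln N) / s)); [lra|]. right.
clearbody h c1 r. unfold C1.
set (L := 1 + ln N). clearbody L. clear - HN Hrr Hh Hr Hs.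
clearbody s. clearbody N. subst N s. field. lra.
Qed.

(** * Counting *)

Lemma count_upto_S (P : nat -> Prop) (N : nat) :
  count_upto P (S N) = (count_upto P N + if excluded_middle_informative (P (S N)) then 1 else 0)%nat.
Proof.
unfold count_upto. rewrite seq_S, filter_app, length_app. simpl.
now destruct (excluded_middle_informative (P (S N))).
Qed.

Lemma count_upto_0 (P : nat -> Prop) : count_upto P 0 = O.
Proof. reflexivity. Qed.

Lemma count_upto_le_self (P : nat -> Prop) (N : nat) : (count_upto P N <= N)%nat.
Proof.
induction N as [|N IH]; [auto|]. rewrite count_upto_S.
destruct (excluded_middle_informative (P (S N))); lia.
Qed.

Lemma count_upto_incr (P : nat -> Prop) (M N : nat) :
  (M <= N)%nat -> (count_upto P M <= count_upto P N)%nat.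
Proof.
intros H. induction H as [|N H IH]; auto. rewrite count_upto_S. lia.
Qed.

Lemma count_upto_or (P Q : nat -> Prop) (N : nat) :
  (count_upto (fun n => P n \/ Q n) N <= count_upto P N + count_upto Q N)%nat.
Proof.
induction N as [|N IH]; [auto|]. rewrite !count_upto_S.
destruct (excluded_middle_informative (P (S N) \/ Q (S N))),
  (excluded_middle_informative (P (S N))), (excluded_middle_informative (Q (S N))); try lia.
exfalso. tauto.
Qed.

Lemma count_upto_lt (M N : nat) : (count_upto (fun n => (n < M)%nat) N <= M)%nat.
Proof.
assert (H : (count_upto (fun n => (n < M)%nat) N <= Nat.min N M)%nat); [|lia].
induction N as [|N IH]; [rewrite count_upto_0; lia|]. rewrite count_upto_S.
destruct (excluded_middle_informative (S N < M)%nat); lia.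
Qed.

Lemma count_upto_shift (P : nat -> Prop) (k N : nat) :
  (count_upto (fun n => P (n + k)%nat) N <= count_upto P (N + k))%nat.
Proof.
induction N as [|N IH]; [rewrite count_upto_0; lia|].
change (S N + k)%nat with (S (N + k)). rewrite !count_upto_S. cbv beta.
change (S N + k)%nat with (S (N + k)). destruct (excluded_middle_informative (P (S (N + k)))); lia.
Qed.

(** For [n = 1] the predicate is read at 0, an index that [count_upto] never visits: hence the extra
    one. *)
Lemma count_upto_pred (P : nat -> Prop) (N : nat) :
  (count_upto (fun n => P (n - 1)%nat) N <= S (count_upto P N))%nat.
Proof.
destruct N as [|N]; [rewrite count_upto_0; lia|].
assert (H : (count_upto (fun n => P (n - 1)%nat) (S N) <= S (count_upto P N))%nat).
{ induction N as [|N IH].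
  - rewrite count_upto_S, !count_upto_0. destruct (excluded_middle_informative _); lia.
  - rewrite count_upto_S, (count_upto_S P).
    replace (S (S N) - 1)%nat with (S N) by lia.
    destruct (excluded_middle_informative (P (S N))); lia. }
rewrite (count_upto_S P). lia.
Qed.

(** [m] and [m + d] are the first and the last element of [P] in the window, so the span between
    them bounds the count. *)
Lemma count_upto_window (P : nat -> Prop) (a L : nat) :
  (count_upto P (a + L) <= count_upto P a)%nat \/
  exists m d, (a < m)%nat /\ (m + d <= a + L)%nat /\ P m /\ P (m + d)%nat /\
    (count_upto P (a + L) <= count_upto P a + d + 1)%nat.
Proof.
induction L as [|L IH]; [left; rewrite Nat.add_0_r; auto|].
rewrite Nat.add_succ_r, count_upto_S.
destruct (excluded_middle_informative (P (S (a + L)))) as [Hp|Hp].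
- right. destruct IH as [IH|[m [d [H1 [H2 [H3 [H4 H5]]]]]]].
  + exists (S (a + L)), O. rewrite Nat.add_0_r. repeat split; auto; lia.
  + exists m, (S (a + L) - m)%nat. replace (m + (S (a + L) - m))%nat with (S (a + L)) by lia.
    repeat split; auto; lia.
- rewrite Nat.add_0_r. destruct IH as [IH|[m [d [H1 [H2 [H3 [H4 H5]]]]]]]; auto.
  right. exists m, d. repeat split; auto; lia.
Qed.

Lemma exp_neg_le (z : R) : 0 <= z <= 1 -> exp (- z) <= 1 - z / 2.
Proof.
intros Hz. rewrite exp_Ropp. pose proof (exp_ineq1_le z) as H.
apply Rle_trans with (/ (1 + z)); [apply Rinv_le_contravar; lra|].
apply Rmult_le_reg_r with (1 + z); [lra|]. rewrite Rinv_l by lra. nra.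
Qed.

(** [(1 - l / y)^p] is at most [exp (- p l / y)], and the exponential lies below a chord of half
    slope on [[0, 1]]. *)
Lemma Rpower_sub_le (p y l : R) : 0 < p -> 0 <= l < y -> p * l <= y ->
  Rpower (y - l) p <= Rpower y p * (1 - p * l / (2 * y)).
Proof.
intros Hp Hl Hpl.
assert (Hz : 0 <= p * (l / y) <= 1).
{ assert (Hd : p * (l / y) * y = p * l) by (field; lra).
  split; [apply Rmult_le_pos; [lra|apply Rdiv_le_0_compat; lra]|].
  apply Rmult_le_reg_r with y; lra. }
replace (1 - p * l / (2 * y)) with (1 - p * (l / y) / 2) by (field; lra).
apply Rle_trans with (Rpower y p * exp (- (p * (l / y)))).
- unfold Rpower. rewrite <- exp_plus.
  assert (Hln : ln (y - l) <= ln y - l / y).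
  { replace (y - l) with (y * ((y - l) / y)) by (field; lra).
    assert (0 < (y - l) / y) by (apply Rdiv_lt_0_compat; lra).
    rewrite ln_mult by lra. pose proof (ln_le_minus_1 ((y - l) / y) ltac:(lra)).
    replace ((y - l) / y - 1) with (- (l / y)) in * by (field; lra). lra. }
  assert (Hle : p * ln (y - l) <= p * ln y + - (p * (l / y))) by nra.
  destruct Hle as [Hle| ->]; [left; now apply exp_increasing|lra].
- apply Rmult_le_compat_l; [left; apply exp_pos|]. now apply exp_neg_le.
Qed.

Lemma one_plus_ln_le_Rpower (e y : R) : 0 < e -> 1 <= y ->
  1 + ln y <= (1 + 1 / e) * Rpower y e.
Proof.
intros He Hy.
assert (Hl : 0 <= ln y) by (rewrite <- ln_1; apply ln_le; lra).
assert (H : 1 + e * ln y <= Rpower y e) by apply exp_ineq1_le.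
assert (E : (1 + 1 / e) * (1 + e * ln y) = 1 + ln y + e * ln y + 1 / e) by (field; lra).
assert (0 < 1 / e) by (apply Rdiv_lt_0_compat; lra).
assert (0 <= e * ln y) by nra. nra.
Qed.

Lemma Rpower_ge1 (p y : R) : 0 <= p -> 1 <= y -> 1 <= Rpower y p.
Proof.
intros Hp Hy. rewrite <- (Rpower_O y) by lra. apply Rle_Rpower; lra.
Qed.

(** Strong induction from [N - L] to [N] with [L] of order [sqrt N]: the drop of [N^(3/4 + eps)]
    over the window is of order [N^(1/4 + eps)], enough to pay for one cluster, and [N^eps] absorbs
    the logarithm. *)
Lemma count_clustered (P : nat -> Prop) (c1 C1 T : R) :
  0 < c1 -> 0 < C1 -> 0 < T ->
  (forall m d : nat, T <= sqrt (INR m) -> P m -> P (m + d)%nat ->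
    INR d <= c1 * sqrt (INR m) -> INR d <= C1 * sqrt (sqrt (INR m)) * (1 + ln (INR m))) ->
  forall eps, 0 < eps -> exists C, 0 < C /\ forall N : nat, (1 <= N)%nat ->
    INR (count_upto P N) <= C * Rpower (INR N) (3 / 4 + eps).
Proof.
intros Hc1 HC1 HT Hcl eps Heps.
(* [c1 / 2] keeps the window within [c1 * sqrt m] of any of its points [m], [1 / 2] leaves at least
   [N / 2] below it, and [1 / p] meets the hypothesis of [Rpower_sub_le]. *)
set (p := 3 / 4 + eps). set (c := Rmin (c1 / 2) (Rmin (1 / 2) (1 / p))).
assert (Hp : 0 < p) by (unfold p; lra).
assert (Hc : 0 < c).
{ unfold c. repeat apply Rmin_glb_lt; try lra. apply Rdiv_lt_0_compat; lra. }
assert (Hcc1 : c <= c1 / 2) by apply Rmin_l.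
assert (Hch : c <= 1 / 2) by (eapply Rle_trans; [apply Rmin_r|apply Rmin_l]).
assert (Hcp : p * c <= 1).
{ apply Rle_trans with (p * (1 / p)); [|right; field; lra].
  apply Rmult_le_compat_l; [lra|]. eapply Rle_trans; [apply Rmin_r|apply Rmin_r]. }
set (C2 := 1 + C1 * (1 + 1 / eps)).
assert (H1e : 0 < 1 / eps) by (apply Rdiv_lt_0_compat; lra).
assert (HC2 : 1 <= C2) by (unfold C2; nra).
set (s0 := 2 * T + 2 / c + 1).
assert (H2c : 0 < 2 / c) by (apply Rdiv_lt_0_compat; lra).
assert (Hs0 : 1 <= s0) by (unfold s0; lra).
assert (H4 : 0 < 4 * C2 / (p * c)) by (apply Rdiv_lt_0_compat; nra).
(* The first summand covers [N < s0^2] by the trivial count. The second pays for a window: the bound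
   drops by at least [A * p * c / 4] times [N^(1/4 + eps)]. *)
set (A := s0 * s0 + 4 * C2 / (p * c)).
assert (HA : 0 < A) by (unfold A; nra).
exists A. split; auto.
intros N. induction N as [N IH] using (well_founded_induction lt_wf). intros HN.
assert (HN1 : 1 <= INR N) by (apply (le_INR 1); auto).
destruct (Rlt_le_dec (INR N) (s0 * s0)) as [Hsm|Hbig].
{ apply Rle_trans with (INR N); [apply le_INR, count_upto_le_self|].
  pose proof (Rpower_ge1 p (INR N) ltac:(lra) HN1). unfold A. nra. }
set (s := sqrt (INR N)).
assert (Hs : s0 <= s) by (unfold s; rewrite <- (sqrt_square s0) by lra; now apply sqrt_le_1_alt).
assert (Hss : INR N = s * s) by (symmetry; apply sqrt_INR_sqr).
destruct (nfloor_ex (c * s)) as [L HL]; [nra|].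
assert (Hcs : 2 <= c * s).
{ apply Rle_trans with (c * (2 / c)); [right; field; lra|].
  apply Rmult_le_compat_l; unfold s0 in Hs; lra. }
assert (HL1 : 1 < INR L) by lra.
assert (HLN : INR L <= INR N / 2) by (rewrite Hss; nra).
assert (HLN' : (L < N)%nat) by (apply INR_lt; lra).
set (a := (N - L)%nat). assert (Ha : INR a = INR N - INR L) by (apply minus_INR; lia).
assert (HaN : (a + L)%nat = N) by (unfold a; lia).
assert (Ha1 : (1 <= a)%nat) by (unfold a; lia).
assert (HLpos : (0 < L)%nat) by (apply INR_lt; simpl; lra).
specialize (IH a ltac:(unfold a; lia) Ha1).
assert (Hstep : INR (count_upto P N) <= INR (count_upto P a) + C2 * Rpower (INR N) (1 / 4 + eps)).
{ pose proof (Rpower_ge1 (1 / 4 + eps) (INR N) ltac:(lra) HN1) as Hpow.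
  destruct (count_upto_window P a L) as [H|[m [d [H1 [H2 [H3 [H4' H5]]]]]]]; rewrite HaN in *.
  - apply le_INR in H. nra.
  - apply le_INR in H5. rewrite !plus_INR in H5. simpl (INR 1) in H5.
    apply lt_INR in H1. assert (HmN : (m <= N)%nat) by lia. apply le_INR in HmN.
    assert (Hdl : (d <= L)%nat) by (apply INR_lt in H1; lia). apply le_INR in Hdl.
    assert (Hsm : s / 2 <= sqrt (INR m)).
    { rewrite <- (sqrt_square (s / 2)) by lra. apply sqrt_le_1_alt. nra. }
    specialize (Hcl m d ltac:(unfold s0 in Hs; lra) H3 H4' ltac:(nra)).
    assert (Hm1 : 1 <= INR m) by (rewrite Ha in H1; apply le_INR in Ha1; simpl in Ha1; lra).
    assert (Hq : sqrt (sqrt (INR m)) <= Rpower (INR N) (1 / 4)).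
    { apply Rle_trans with (sqrt (sqrt (INR N))); [now do 2 apply sqrt_le_1_alt|].
      right. rewrite <- !Rpower_sqrt by (try apply sqrt_lt_R0; lra).
      rewrite Rpower_mult. f_equal. field. }
    assert (Hl : 1 + ln (INR m) <= (1 + 1 / eps) * Rpower (INR N) eps).
    { apply Rle_trans with (2 := one_plus_ln_le_Rpower eps (INR N) Heps HN1).
      apply Rplus_le_compat_l, ln_le; lra. }
    assert (Hl0 : 0 <= ln (INR m)) by (rewrite <- ln_1; apply ln_le; lra).
    assert (Hprod : sqrt (sqrt (INR m)) * (1 + ln (INR m))
      <= (1 + 1 / eps) * Rpower (INR N) (1 / 4 + eps)).
    { rewrite Rpower_plus.
      replace ((1 + 1 / eps) * (Rpower (INR N) (1 / 4) * Rpower (INR N) eps))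
        with (Rpower (INR N) (1 / 4) * ((1 + 1 / eps) * Rpower (INR N) eps)) by ring.
      apply Rmult_le_compat; auto using sqrt_pos. lra. }
    assert (INR d <= C1 * ((1 + 1 / eps) * Rpower (INR N) (1 / 4 + eps))).
    { apply Rle_trans with (1 := Hcl). rewrite Rmult_assoc. apply Rmult_le_compat_l; lra. }
    unfold C2. lra. }
apply Rle_trans with (1 := Hstep).
assert (Hsub : Rpower (INR a) p <= Rpower (INR N) p * (1 - p * INR L / (2 * INR N))).
{ rewrite Ha. apply Rpower_sub_le; auto; [lra|].
  apply Rle_trans with (p * (c * s)); [apply Rmult_le_compat_l; lra|]. rewrite Hss. nra. }
assert (Hsplit : Rpower (INR N) p = s * Rpower (INR N) (1 / 4 + eps)).
{ unfold s. rewrite <- Rpower_sqrt by lra. rewrite <- Rpower_plus. f_equal. unfold p. field. }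
set (W := Rpower (INR N) (1 / 4 + eps)) in *.
assert (HW : 0 < W) by apply exp_pos.
apply Rle_trans with (A * (s * W * (1 - p * INR L / (2 * INR N))) + C2 * W).
{ apply Rplus_le_compat_r. apply Rle_trans with (1 := IH). apply Rmult_le_compat_l; [lra|].
  rewrite <- Hsplit. exact Hsub. }
rewrite Hsplit.
assert (Hkey : C2 <= A * (s * (p * INR L / (2 * INR N)))); [|nra].
apply Rle_trans with (4 * C2 / (p * c) * (p * c / 4)); [right; field; lra|].
apply Rmult_le_compat.
- lra.
- nra.
- unfold A. nra.
- rewrite Hss. replace (s * (p * INR L / (2 * (s * s)))) with (p * (INR L / (2 * s))) by (field; lra).
  replace (p * c / 4) with (p * (c / 4)) by field. apply Rmult_le_compat_l; [lra|].
  apply Rmult_le_reg_r with (2 * s); [lra|].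
  replace (INR L / (2 * s) * (2 * s)) with (INR L) by (field; lra). lra.
Qed.

(** * The alternation pattern *)

(** Levels are located in intervals centred at integers, while the theorem counts between integers.
    Uniqueness on the closed interval of radius 1/2 makes the two neighbouring halves cover all of
    [(a, a + 1)]. *)
Definition above (X : R -> Prop) (a : R) : Prop :=
  exists x, a < x < a + 1 / 2 /\ X x /\ forall y, Rabs (y - a) <= 1 / 2 -> X y -> y = x.

Definition below (X : R -> Prop) (a : R) : Prop :=
  exists x, a - 1 / 2 < x < a /\ X x /\ forall y, Rabs (y - a) <= 1 / 2 -> X y -> y = x.

Lemma exactly_two_between (X : R -> Prop) (a b : R) :
  b = a + 1 -> above X a -> below X b -> exactly_two_in X a b.
Proof.
intros -> [x1 [H1 [S1 U1]]] [x2 [H2 [S2 U2]]].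
exists x1, x2. repeat split; auto; try lra.
intros y Hy Sy. destruct (Rle_lt_dec y (a + 1 / 2)).
- left. apply U1; auto. apply Rabs_le. lra.
- right. apply U2; auto. apply Rabs_le. lra.
Qed.

Lemma none_between (X : R -> Prop) (a b : R) :
  b = a + 1 -> below X a -> above X b -> none_in X a b.
Proof.
intros -> [x1 [H1 [S1 U1]]] [x2 [H2 [S2 U2]]] y Hy Sy.
destruct (Rle_lt_dec y (a + 1 / 2)).
- assert (y = x1) by (apply U1; auto; apply Rabs_le; lra). lra.
- assert (y = x2) by (apply U2; auto; apply Rabs_le; lra). lra.
Qed.

Lemma not_at_center (X : R -> Prop) (a : R) : above X a \/ below X a -> ~ X a.
Proof.
intros H Sa. assert (Ha : Rabs (a - a) <= 1 / 2) by (rewrite Rminus_diag_eq, Rabs_R0; lra).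
destruct H as [[x [H [_ U]]]|[x [H [_ U]]]]; specialize (U a Ha Sa); lra.
Qed.

Lemma sgn_sqr (s : bool) : sgn s * sgn s = 1.
Proof. destruct s; simpl; ring. Qed.

Lemma sgn_negb (s : bool) : sgn (negb s) = - sgn s.
Proof. destruct s; simpl; ring. Qed.

(** Outside [small] the displacement exceeds the error, so its sign decides the side. Displacement
    and error together stay below 1/2, which keeps half-integers free of levels for all [t * delta]
    and so supplies the hypothesis of [spec_exists]. *)
Lemma level_position (g Delta : R) : 0 < g -> 0 < Delta -> exists B T, 0 < B /\ 0 < T /\
  forall n : nat, T <= sqrt (INR n) -> ~ small g B n -> forall s : bool,
    (0 < sgn s * (-1) ^ n * lag g n -> above (shifted_spec Delta g s) (INR n)) /\
    (sgn s * (-1) ^ n * lag g n < 0 -> below (shifted_spec Delta g s) (INR n)).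
Proof.
intros Hg HD.
destruct (localization g Delta Hg ltac:(lra)) as [B [T1 [HB [HT1 Hloc]]]].
destruct (spec_unique g Delta Hg ltac:(lra)) as [T2 [HT2 Huni]].
destruct (lag_small g Hg) as [A [T3 [HA [HT3 Hlag]]]].
assert (HBD : 0 < B / Delta) by (apply Rdiv_lt_0_compat; lra).
(* With [r] the fourth root of [n], [4 Delta A <= r] bounds the displacement by 1/4, and [36 B < r]
   the error, through [1 + ln n <= 9 r]. *)
set (Q := 4 * Delta * A + 36 * B + 4).
assert (HQ : 4 < Q) by (unfold Q; nra).
exists (B / Delta), (T1 + T2 + T3 + Q ^ 2). split; auto. split; [nra|].
intros n Hn Hsmall s.
set (q := sqrt (INR n)) in *.
assert (Hq : 1 <= q) by nra.
assert (HN : INR n = q * q) by (symmetry; apply sqrt_INR_sqr).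
assert (HN1 : 1 <= INR n) by nra.
assert (Hn1 : (1 <= n)%nat) by (apply INR_le; exact HN1).
set (r := sqrt q). assert (Hrr : r * r = q) by (apply sqrt_sqrt; lra).
assert (HQr : Q <= r).
{ unfold r. rewrite <- (sqrt_square Q) by lra. apply sqrt_le_1_alt. nra. }
assert (Hln : 0 <= ln (INR n)) by (rewrite <- ln_1; apply ln_le; lra).
set (err := B * (1 + ln (INR n)) / q).
assert (Herr : err < 1 / 4).
{ pose proof (one_plus_ln_sqr_le (INR n) HN1) as H. fold q in H. fold r in H.
  assert (H9 : 1 + ln (INR n) <= 9 * r).
  { apply Rsqr_incr_0_var; [|lra]. unfold Rsqr. nra. }
  unfold err. rewrite <- Hrr. apply Rmult_lt_reg_r with (r * r); [nra|].
  replace (B * (1 + ln (INR n)) / (r * r) * (r * r)) with (B * (1 + ln (INR n))) by (field; lra).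
  apply Rle_lt_trans with (B * (9 * r)); [apply Rmult_le_compat_l; lra|].
  assert (36 * B < r) by (unfold Q in HQr; nra). nra. }
assert (Hdiag : Rabs (parity g n n) = Rabs (lag g n)).
{ unfold lag. rewrite Rabs_mult, Rabs_pow_m1. ring. }
assert (HDlag : Delta * Rabs (lag g n) <= 1 / 4).
{ destruct (Hlag n ltac:(fold q; nra)) as [H _]. fold q in H. fold r in H.
  apply Rle_trans with (Delta * (A / r)); [apply Rmult_le_compat_l; lra|].
  apply Rmult_le_reg_r with r; [lra|].
  replace (Delta * (A / r) * r) with (Delta * A) by (field; lra). unfold Q in HQr. lra. }
assert (Hin : forall delta x, Rabs delta <= Delta -> Rabs (x - INR n) <= 1 / 2 -> spec g delta x ->
  Rabs (x - INR n - delta * parity g n n) <= err /\ Rabs (x - INR n) < 1 / 2).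
{ intros delta x Hd Hx [u [Hu [Nu Eu]]].
  destruct (Hloc n ltac:(fold q; nra) delta x u Hd Hx Hu Nu Eu) as [_ H].
  fold q in H. fold err in H. split; auto.
  assert (Rabs (delta * parity g n n) <= 1 / 4).
  { rewrite Rabs_mult, Hdiag. pose proof (Rabs_pos (lag g n)). nra. }
  apply Rabs_def1; apply Rabs_le_between in H; apply Rabs_le_between in H0; lra. }
set (delta := sgn s * Delta).
assert (Hdelta : Rabs delta = Delta).
{ unfold delta. rewrite Rabs_mult, (Rabs_pos_eq Delta) by lra.
  destruct s; simpl; [rewrite Rabs_R1|rewrite Rabs_m1]; ring. }
(* The index is [n - 1] because [spec_exists] searches from its index plus 1/2 to its index plus
   3/2, that is, around [n]. *)
destruct (spec_exists g delta (n - 1) Hg) as [x [Hx Sx]].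
{ intros t Ht. rewrite minus_INR by auto. simpl (INR 1).
  assert (Htd : Rabs (t * delta) <= Delta).
  { rewrite Rabs_mult, Hdelta, Rabs_pos_eq by lra. nra. }
  split; intros Hs; apply (Hin _ _ Htd) in Hs.
  - destruct Hs as [_ Hs]. apply Rabs_def2 in Hs. lra.
  - apply Rabs_le. lra.
  - destruct Hs as [_ Hs]. apply Rabs_def2 in Hs. lra.
  - apply Rabs_le. lra. }
rewrite minus_INR in Hx by auto. simpl (INR 1) in Hx.
assert (Hxn : Rabs (x - INR n) <= 1 / 2) by (apply Rabs_le; lra).
destruct (Hin delta x ltac:(lra) Hxn Sx) as [Hx1 Hx2].
apply Rabs_le_between in Hx1. apply Rabs_def2 in Hx2.
assert (Hun : forall y, Rabs (y - INR n) <= 1 / 2 -> shifted_spec Delta g s y -> y = x).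
{ intros y Hy Sy. apply shifted_spec_iff in Sy.
  apply (Huni n ltac:(fold q; nra) delta y x); auto. lra. }
apply <- shifted_spec_iff in Sx.
assert (Hbig : err < Delta * Rabs (lag g n)).
{ apply Rnot_le_lt. intros H. apply Hsmall. unfold small. fold q.
  apply Rmult_le_reg_l with Delta; auto. apply Rle_trans with (1 := H).
  right. unfold err. field. lra. }
assert (Hpar : delta * parity g n n = Delta * (sgn s * (-1) ^ n * lag g n)).
{ unfold delta, lag.
  transitivity (Delta * sgn s * parity g n n * ((-1) ^ n * (-1) ^ n)); [rewrite pow_m1_sqr|]; ring. }
assert (Habs : Rabs (lag g n) = Rabs (sgn s * (-1) ^ n * lag g n)).
{ rewrite !Rabs_mult, Rabs_pow_m1. destruct s; simpl; [rewrite Rabs_R1|rewrite Rabs_m1]; ring. }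
rewrite Hpar in Hx1. rewrite Habs in Hbig.
split; intros Hsign.
- rewrite Rabs_pos_eq in Hbig by lra. exists x. repeat split; auto; lra.
- rewrite Rabs_left in Hbig by lra. exists x. repeat split; auto; lra.
Qed.

Theorem theorem1p1 (Delta g : R) (hDelta : 0 < Delta) (hg : 0 < g) :
  exists S : nat -> Prop,
    (* |S ∩ [1,N]| = O(N^{3/4 + o(1)}) *)
    (forall eps : R, 0 < eps ->
       exists C : R, forall N : nat, (1 <= N)%nat ->
         INR (count_upto S N) <= C * Rpower (INR N) (3 / 4 + eps)) /\
    (forall n : nat, (1 <= n)%nat -> ~ S n ->
       (exists s : bool,
          exactly_two_in (shifted_spec Delta g s) (INR n) (INR n + 1) /\
          none_in (shifted_spec Delta g (negb s)) (INR n) (INR n + 1) /\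
          exactly_two_in (shifted_spec Delta g (negb s)) (INR n - 1) (INR n) /\
          none_in (shifted_spec Delta g s) (INR n - 1) (INR n) /\
          exactly_two_in (shifted_spec Delta g (negb s)) (INR n + 1) (INR n + 2) /\
          none_in (shifted_spec Delta g s) (INR n + 1) (INR n + 2)) /\
       (forall s : bool, forall j : nat, (j <= 2)%nat ->
          ~ shifted_spec Delta g s (INR n - 1 + INR j)) /\
       (* in particular: [n, n+1] contains exactly two elements of X^+ ∪ X^- *)
       (exists x1 x2, INR n <= x1 <= INR n + 1 /\ INR n <= x2 <= INR n + 1 /\
          x1 <> x2 /\
          (shifted_spec Delta g true x1 \/ shifted_spec Delta g false x1) /\
          (shifted_spec Delta g true x2 \/ shifted_spec Delta g false x2) /\
          forall y, INR n <= y <= INR n + 1 ->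
            (shifted_spec Delta g true y \/ shifted_spec Delta g false y) ->
            y = x1 \/ y = x2)).
Proof.
destruct (level_position g Delta hg hDelta) as [B [T1 [HB [HT1 Hlev]]]].
destruct (lag_same_sign g B hg HB) as [T2 [HT2 Hsame]].
destruct (small_cluster g B hg HB) as [c1 [C1 [T3 [Hc1 [HC1 [HT3 Hcl]]]]]].
set (T := T1 + T2).
destruct (nfloor_ex (T * T + 2)) as [N0 [_ HN0]]; [unfold T; nra|].
set (bad := small g B).
(* The three intervals of the statement have the four endpoints [n - 1] to [n + 2], and each must be
   good; [N0 + 1] makes even [n - 1] large. *)
exists (fun n => (n < N0 + 1)%nat \/ bad (n - 1)%nat \/ bad n \/ bad (n + 1)%nat \/ bad (n + 2)%nat).
split.
- intros eps Heps.
  destruct (count_clustered bad c1 C1 T3 Hc1 HC1 HT3 Hcl eps Heps) as [C [HC Hcount]].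
  set (p := 3 / 4 + eps) in *.
  exists (INR N0 + 2 + 4 * (C * Rpower 3 p)).
  intros N HN.
  assert (HN1 : 1 <= INR N) by (apply (le_INR 1); auto).
  assert (Hp1 : 1 <= Rpower (INR N) p) by (apply Rpower_ge1; unfold p; lra).
  (* The constant [Rpower 3 p] comes from [N + 2 <= 3 N]. *)
  assert (Hmono : forall M, (M <= N + 2)%nat -> INR (count_upto bad M) <= C * Rpower 3 p * Rpower (INR N) p).
  { intros M HM. apply Rle_trans with (INR (count_upto bad (N + 2))).
    - now apply le_INR, count_upto_incr.
    - apply Rle_trans with (1 := Hcount (N + 2)%nat ltac:(lia)).
      rewrite Rmult_assoc. apply Rmult_le_compat_l; [lra|].
      rewrite Rpower_mult_distr by lra. apply Rle_Rpower_l; [unfold p; lra|].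
      rewrite plus_INR. simpl (INR 2). lra. }
  assert (Hall : (count_upto (fun n => (n < N0 + 1)%nat \/ bad (n - 1)%nat \/ bad n \/
      bad (n + 1)%nat \/ bad (n + 2)%nat) N
    <= (N0 + 1) + (1 + count_upto bad N + (count_upto bad N +
         (count_upto bad (N + 1) + count_upto bad (N + 2)))))%nat).
  { eapply Nat.le_trans; [apply count_upto_or|]. apply Nat.add_le_mono; [apply count_upto_lt|].
    eapply Nat.le_trans; [apply count_upto_or|]. apply Nat.add_le_mono; [apply count_upto_pred|].
    eapply Nat.le_trans; [apply count_upto_or|]. apply Nat.add_le_mono; [auto|].
    eapply Nat.le_trans; [apply count_upto_or|].
    apply Nat.add_le_mono; apply count_upto_shift. }
  apply le_INR in Hall. apply Rle_trans with (1 := Hall).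
  rewrite !plus_INR. simpl (INR 1).
  pose proof (Hmono N ltac:(lia)). pose proof (Hmono (N + 1)%nat ltac:(lia)).
  pose proof (Hmono (N + 2)%nat ltac:(lia)). pose proof (pos_INR N0). nra.
- intros n Hn HS.
  assert (Hn0 : (N0 + 1 <= n)%nat) by (apply Nat.nlt_ge; tauto).
  assert (HT : forall j, (n - 1 <= j)%nat -> T <= sqrt (INR j)).
  { intros j Hj. rewrite <- (sqrt_square T) by (unfold T; lra). apply sqrt_le_1_alt.
    assert (H : (N0 <= j)%nat) by lia. apply le_INR in H. lra. }
  assert (Hb : forall j, (n - 1 <= j <= n + 2)%nat -> ~ bad j).
  { intros j Hj.
    assert (Hc : (j = n - 1 \/ j = n \/ j = n + 1 \/ j = n + 2)%nat) by lia.
    destruct Hc as [-> |[-> |[-> | ->]]]; tauto. }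
  (* From here on the integer of the statement is [S n], and the four endpoints are [n] to
     [n + 3]. *)
  destruct n as [|n]; [lia|]. simpl (S n - 1)%nat in *. rewrite Nat.sub_0_r in *.
  assert (Hs : forall j, (n <= j <= n + 2)%nat -> 0 < lag g j * lag g (S j)).
  { intros j Hj. apply Hsame; [|apply Hb; lia]. specialize (HT j ltac:(lia)). unfold T in HT. lra. }
  assert (Hl : forall j, (n <= j <= n + 3)%nat -> forall s,
    (0 < sgn s * (-1) ^ j * lag g j -> above (shifted_spec Delta g s) (INR j)) /\
    (sgn s * (-1) ^ j * lag g j < 0 -> below (shifted_spec Delta g s) (INR j))).
  { intros j Hj s. apply Hlev; [|apply Hb; lia]. specialize (HT j ltac:(lia)). unfold T in HT. lra. }
  assert (Hss : exists s, 0 < sgn s * (-1) ^ S n * lag g (S n)).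
  { specialize (Hs (S n) ltac:(lia)).
    assert (Hne : (-1) ^ S n * lag g (S n) <> 0).
    { apply Rmult_integral_contrapositive_currified.
      - apply pow_nonzero. lra.
      - intros E. rewrite E in Hs. lra. }
    destruct (Rlt_le_dec 0 ((-1) ^ S n * lag g (S n))); [exists true|exists false]; simpl sgn; lra. }
  destruct Hss as [s0 Hs0].
  (* [lag] keeps its sign from [j] to [j + 1] while [(-1) ^ j] changes, so the displacement within
     one parity class changes side. *)
  assert (Halt : forall s j, (n <= j <= n + 2)%nat ->
    (0 < sgn s * (-1) ^ j * lag g j <-> sgn s * (-1) ^ S j * lag g (S j) < 0) /\
    (sgn s * (-1) ^ j * lag g j < 0 <-> 0 < sgn s * (-1) ^ S j * lag g (S j))).
  { intros s j Hj. specialize (Hs j Hj).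
    assert (E : sgn s * (-1) ^ j * lag g j * (sgn s * (-1) ^ S j * lag g (S j)) < 0).
    { replace (sgn s * (-1) ^ j * lag g j * (sgn s * (-1) ^ S j * lag g (S j)))
        with (- ((sgn s * sgn s) * ((-1) ^ j * (-1) ^ j) * (lag g j * lag g (S j)))) by (simpl; ring).
      rewrite sgn_sqr, pow_m1_sqr. lra. }
    set (a := sgn s * (-1) ^ j * lag g j) in *.
    set (b := sgn s * (-1) ^ S j * lag g (S j)) in *. clearbody a b. repeat split; nra. }
  assert (Hn1 : sgn (negb s0) * (-1) ^ S n * lag g (S n) < 0) by (rewrite sgn_negb; lra).
  assert (P1 : sgn s0 * (-1) ^ n * lag g n < 0) by (apply (Halt s0 n ltac:(lia)); auto).
  assert (P3 : sgn s0 * (-1) ^ S (S n) * lag g (S (S n)) < 0) by (apply (Halt s0 (S n) ltac:(lia)); auto).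
  assert (P4 : 0 < sgn s0 * (-1) ^ S (S (S n)) * lag g (S (S (S n))))
    by (apply (Halt s0 (S (S n)) ltac:(lia)); auto).
  assert (M1 : 0 < sgn (negb s0) * (-1) ^ n * lag g n) by (rewrite sgn_negb; lra).
  assert (M3 : 0 < sgn (negb s0) * (-1) ^ S (S n) * lag g (S (S n))) by (rewrite sgn_negb; lra).
  assert (M4 : sgn (negb s0) * (-1) ^ S (S (S n)) * lag g (S (S (S n))) < 0) by (rewrite sgn_negb; lra).
  apply (Hl n ltac:(lia)) in P1. apply (Hl n ltac:(lia)) in M1.
  apply (Hl (S n) ltac:(lia)) in Hs0. apply (Hl (S n) ltac:(lia)) in Hn1.
  apply (Hl (S (S n)) ltac:(lia)) in P3. apply (Hl (S (S n)) ltac:(lia)) in M3.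
  apply (Hl (S (S (S n))) ltac:(lia)) in P4. apply (Hl (S (S (S n))) ltac:(lia)) in M4.
  assert (E0 : INR n = INR (S n) - 1) by (rewrite S_INR; ring).
  assert (E2 : INR (S (S n)) = INR (S n) + 1) by apply S_INR.
  assert (E3 : INR (S (S (S n))) = INR (S n) + 2) by (rewrite !S_INR; ring).
  rewrite E0 in P1, M1. rewrite E2 in P3, M3. rewrite E3 in P4, M4.
  set (a := INR (S n)) in *.
  assert (Htwo : exactly_two_in (shifted_spec Delta g s0) a (a + 1))
    by (apply exactly_two_between; auto).
  assert (Hnone : none_in (shifted_spec Delta g (negb s0)) a (a + 1))
    by (apply none_between; auto).
  assert (Hint : forall s j, (j <= 2)%nat -> ~ shifted_spec Delta g s (a - 1 + INR j)).
  { intros s j Hj.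
    assert (Hcase : s = s0 \/ s = negb s0) by (destruct s, s0; auto).
    assert (Hj' : (j = 0 \/ j = 1 \/ j = 2)%nat) by lia.
    destruct Hj' as [-> |[-> | ->]]; simpl INR;
    [replace (a - 1 + 0) with (a - 1) by ring
    |replace (a - 1 + 1) with a by ring
    |replace (a - 1 + (1 + 1)) with (a + 1) by ring];
    destruct Hcase as [-> | ->]; apply not_at_center; auto. }
  split; [|split; auto].
  + exists s0. split; [exact Htwo|]. split; [exact Hnone|].
    split; [apply exactly_two_between; auto; ring|].
    split; [apply none_between; auto; ring|].
    split; [apply exactly_two_between; auto; ring|apply none_between; auto; ring].
  + destruct Htwo as [x1 [x2 [H1 [H2 [H12 [S1 [S2 U]]]]]]].
    assert (Hor : forall x, shifted_spec Delta g s0 x ->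
      shifted_spec Delta g true x \/ shifted_spec Delta g false x) by (intros x Hx; destruct s0; auto).
    exists x1, x2. repeat split; auto; try lra.
    intros y Hy Sy.
    assert (Hys : exists s, shifted_spec Delta g s y)
      by (destruct Sy as [Sy|Sy]; [now exists true|now exists false]).
    destruct Hys as [s Sys].
    assert (Hya : y <> a).
    { intros ->. apply (Hint s 1%nat ltac:(lia)). simpl INR. now replace (a - 1 + 1) with a by ring. }
    assert (Hya1 : y <> a + 1).
    { intros ->. apply (Hint s 2%nat ltac:(lia)). simpl INR.
      now replace (a - 1 + (1 + 1)) with (a + 1) by ring. }
    assert (Hyy : a < y < a + 1) by lra.
    assert (Hcase : s = s0 \/ s = negb s0) by (destruct s, s0; auto).
    destruct Hcase as [-> | ->]; [now apply U|]. exfalso. now apply (Hnone y).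
Qed.
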